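(* Let $K\ge0$ be an integer and let $R^{(1)}$ and $W^{(1)}$ be the stationary response time and waiting time of a type-1 job under Nudge-$K$. Then for all $t\ge0$ $$P[R^{(1)}>t]=P[W^{(1)}>t]+(1-\lambda)\alpha_1e^{S_1t}\mathbf 1-(\nu_1,0)\,e^{A^{(1)}t}\begin{pmatrix}0\\ \mathbf 1\end{pmatrix}-(\pi_0^{(1)}-\pi_1^{(1)}R^{-1},0)\,e^{A^{(2)}t}\begin{pmatrix}0\\ \mathbf 1\end{pmatrix}+(\pi_0^{(2)}R^{-1},0)\,e^{A^{(3)}t}\begin{pmatrix}0\\ \mathbf 1\end{pmatrix},$$ where $$A^{(1)}=\begin{bmatrix}S^\top\otimes I+(s^*\alpha)^\top\otimes R&(S^\top\otimes I+(s^*\alpha)^\top\otimes R)\,\xi\,\alpha_1\\0&S_1\end{bmatrix},$$ $$A^{(2)}=\begin{bmatrix}S&(S\mathbf 1)\alpha_1\\0&S_1\end{bmatrix},\qquad A^{(3)}=\begin{bmatrix}S&S\begin{pmatrix}\mathbf 1/p\\0\end{pmatrix}\alpha_1\\0&S_1\end{bmatrix}.$$ Further, $-\lim_{t\to\infty}\frac1t\log P[R^{(1)}>t]=\theta_Z$, and $c_{R^{(1)}}=\lim_{t\to\infty}e^{\theta_Zt}P[R^{(1)}>t]=c_{W^{(1)}}\tilde S_1(-\theta_Z)$.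
   Context: Single-server queue with Poisson arrivals of rate $\lambda\in(0,1)$. Each arriving job is, independently, of type 1 with probability $p$ and of type 2 with probability $1-p$, where $0<p<1$. The processing time $X_i$ of a type-$i$ job has an order-$n_i$ phase-type distribution $(\alpha_i,S_i)$, i.e. $P[X_i>t]=\alpha_i e^{S_it}\mathbf 1$, where $\alpha_i$ is a probability row vector of size $n_i$, $S_i$ is an invertible subgenerator matrix (negative diagonal, nonnegative off-diagonal entries, nonpositive row sums), and $\mathbf 1$ is a column vector of ones of appropriate size. All processing times and interarrival times are independent. The job size $X$ of an arbitrary job is the mixture equal to $X_1$ with probability $p$ and $X_2$ with probability $1-p$; it is phase-type $(\alpha,S)$ with $\alpha=(p\alpha_1,(1-p)\alpha_2)$ and $S=\begin{bmatrix}S_1&0\\0&S_2\end{bmatrix}$, normalized so that $E[X]=\alpha(-S)^{-1}\mathbf 1=1$. Nudge-$K$: jobs are served nonpreemptively from the head of the queue, as in First-Come-First-Served, and arriving jobs join the back of the queue, except that an arriving type-1 job passes (is swapped with) waiting type-2 jobs at the back of the queue, one after the other, until it has passed $K$ of them, or it encounters a type-1 job, or it encounters a type-2 job that was already passed by another type-1 job, or it becomes the job waiting at the head of the queue. Thus a type-1 job is swapped with at most $K$ type-2 jobs, and each type-2 job is swapped at most once. The job in service is never swapped. The waiting time of a job is the time from its arrival until its service starts; the response time is the time from its arrival until its service completion. Notation: $s^*=(-S)\mathbf 1$; $X^\top$ denotes the transpose of a matrix $X$; $\otimes$ is the Kronecker product; in $\begin{pmatrix}\mathbf 1/p\\0\end{pmatrix}$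 and $(\mathbf 1^\top,0)$ the blocks have sizes $n_1$ and $n_2$. $\xi$ is the vector of size $(n_1+n_2)^2$ obtained by stacking the columns of the identity matrix of size $n_1+n_2$. The matrix $R$ and the row vectors are $$R=-\lambda(S-\lambda I+\lambda\mathbf 1\alpha)^{-1},\quad \pi_1=(1-\lambda)\alpha R,$$ $$\pi_0^{(1)}=\pi_1(I-(1-p)^{K+1}R^{K+1})(I-(1-p)R)^{-1},\quad \pi_1^{(1)}=\pi_1(1-p)^KR^{K+1},$$ $$\pi_0^{(2)}=\pi_1R(I-(1-p)^KR^K)(I-(1-p)R)^{-1}p,$$ $$\nu_1=\mathbf 1^\top\otimes\bigl[(\pi_1^{(1)}+\pi_0^{(2)})(I-R)^{-1}+\pi_1^{(1)}R^{-1}\bigr]+\frac{(\mathbf 1^\top,0)}{p}\otimes\pi_0^{(2)}R^{-1}.$$ $\tilde S_1(s)=\alpha_1(sI-S_1)^{-1}(-S_1)\mathbf 1$. $Z$ is the stationary workload (total unfinished work in the system), $\theta_Z=-\lim_{t\to\infty}\frac1t\log P[Z>t]$, and $c_{W^{(1)}}=\lim_{t\to\infty}e^{\theta_Zt}P[W^{(1)}>t]$. The distribution of $W^{(1)}$ is $$P[W^{(1)}>t]=\nu_1e^{(S^\top\otimes I+(s^*\alpha)^\top\otimes R)t}\xi+(\pi_0^{(1)}-\pi_1^{(1)}R^{-1})e^{St}\mathbf 1-\pi_0^{(2)}R^{-1}e^{St}\begin{pmatrix}\mathbf 1/p\\0\end{pmatrix}.$$ *)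

(* Defs.v *)
From HB Require Import structures.
From mathcomp Require Import all_boot all_order all_algebra finmap.
From mathcomp Require Import all_classical all_reals all_analysis.
From mathcomp Require Export mxtens.

Set Implicit Arguments.
Unset Strict Implicit.
Unset Printing Implicit Defensive.

Import Order.TTheory GRing.Theory Num.Theory.
Import numFieldNormedType.Exports.

Local Open Scope classical_set_scope.
Local Open Scope ring_scope.

Definition expmx (R : realType) (n : nat) (A : 'M[R]_n) : 'M[R]_n :=
  \matrix_(i, j) limn (series (fun k => (k`!%:R)^-1 * (A ^+ k) i j)).

(* The columns of M stacked on top of each other: entry (j, i) of the
   stacked vector, in the index order used by the Kronecker product *t,
   is the entry M i j. *)
Definition vec_cols (R : realType) (n : nat) (M : 'M[R]_n) : 'cV[R]_(n * n) :=
  \col_k M (mxtens_unindex k).2 (mxtens_unindex k).1.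

Notation ones := (const_mx 1).

Record is_phase_type (R : realType) (n : nat) (alpha : 'rV[R]_n) (S : 'M[R]_n)
    : Prop := {
  pht_ge0 : forall i, 0 <= alpha ord0 i;
  pht_sum1 : \sum_i alpha ord0 i = 1;
  pht_diag : forall i, S i i < 0;
  pht_offdiag : forall i j, i != j -> 0 <= S i j;
  pht_row : forall i, \sum_j S i j <= 0;
  pht_inv : S \in unitmx
}.

Definition pht_ccdf (R : realType) (n : nat) (alpha : 'rV[R]_n) (S : 'M[R]_n)
    (t : R) : R :=
  (alpha *m expmx (t *: S) *m ones : 'M[R]_1) ord0 ord0.

Definition pht_mean (R : realType) (n : nat) (alpha : 'rV[R]_n) (S : 'M[R]_n)
    : R :=
  (alpha *m invmx (- S) *m ones : 'M[R]_1) ord0 ord0.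

(* Only meaningful when sI - S is invertible. *)
Definition pht_lst (R : realType) (n : nat) (alpha : 'rV[R]_n) (S : 'M[R]_n)
    (s : R) : R :=
  (alpha *m invmx (s%:M - S) *m (- S) *m ones : 'M[R]_1) ord0 ord0.

Record params (R : realType) := Params {
  lam : R;
  p : R;
  n1 : nat;
  n2 : nat;
  alpha1 : 'rV[R]_n1;
  S1 : 'M[R]_n1;
  alpha2 : 'rV[R]_n2;
  S2 : 'M[R]_n2;
  K : nat
}.

Section formulas.
Context (R : realType) (q : params R).
Local Notation n := (n1 q + n2 q)%N.

Definition alpha : 'rV[R]_n := row_mx (p q *: alpha1 q) ((1 - p q) *: alpha2 q).
Definition Smx : 'M[R]_n := block_mx (S1 q) 0 0 (S2 q).
Definition sstar : 'cV[R]_n := (- Smx) *m ones.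

Definition Rmx : 'M[R]_n :=
  - lam q *: invmx (Smx - (lam q)%:M + lam q *: ((ones : 'cV[R]_n) *m alpha)).

Definition pi1 : 'rV[R]_n := (1 - lam q) *: (alpha *m Rmx).
Definition pi01 : 'rV[R]_n :=
  pi1 *m (1%:M - (1 - p q) ^+ (K q).+1 *: Rmx ^+ (K q).+1)
      *m invmx (1%:M - (1 - p q) *: Rmx).
Definition pi11 : 'rV[R]_n := (1 - p q) ^+ K q *: (pi1 *m Rmx ^+ (K q).+1).
Definition pi02 : 'rV[R]_n :=
  p q *: (pi1 *m Rmx *m (1%:M - (1 - p q) ^+ K q *: Rmx ^+ K q)
              *m invmx (1%:M - (1 - p q) *: Rmx)).

Definition nu1 : 'rV[R]_(n * n) :=
  (ones : 'rV[R]_n) *t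
    ((pi11 + pi02) *m invmx (1%:M - Rmx) + pi11 *m invmx Rmx)
  + ((p q)^-1 *: row_mx (ones : 'rV[R]_(n1 q)) (0 : 'rV[R]_(n2 q)))
      *t (pi02 *m invmx Rmx).

Definition xi : 'cV[R]_(n * n) := vec_cols (1%:M : 'M[R]_n).

Definition Mmx : 'M[R]_(n * n) :=
  (Smx^T *t (1%:M : 'M[R]_n)) + (sstar *m alpha)^T *t Rmx.

Definition ones_p : 'cV[R]_n :=
  col_mx (const_mx (p q)^-1 : 'cV[R]_(n1 q)) (0 : 'cV[R]_(n2 q)).

Definition W1_formula (t : R) : R :=
  (nu1 *m expmx (t *: Mmx) *m xi
   + (pi01 - pi11 *m invmx Rmx) *m expmx (t *: Smx) *m ones
   - pi02 *m invmx Rmx *m expmx (t *: Smx) *m ones_p : 'M[R]_1) ord0 ord0.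

Definition A1 : 'M[R]_(n * n + n1 q) :=
  block_mx Mmx (Mmx *m xi *m alpha1 q) 0 (S1 q).
Definition A2 : 'M[R]_(n + n1 q) :=
  block_mx Smx (Smx *m (ones : 'cV[R]_n) *m alpha1 q) 0 (S1 q).
Definition A3 : 'M[R]_(n + n1 q) :=
  block_mx Smx (Smx *m ones_p *m alpha1 q) 0 (S1 q).

(* (v, 0) e^{A t} (0, 1)^T for a block matrix A whose last block has order n1 *)
Definition corner (m : nat) (v : 'rV[R]_m) (A : 'M[R]_(m + n1 q)) (t : R) : R :=
  (row_mx v (0 : 'rV[R]_(n1 q)) *m expmx (t *: A)
     *m col_mx (0 : 'cV[R]_m) (ones : 'cV[R]_(n1 q)) : 'M[R]_1) ord0 ord0.

End formulas.

(* Jobs are numbered 0, 1, 2, ... in order of arrival.  Job i arrives a i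
   time units after job i-1 (job 0 arrives at time a 0, the queue being empty
   at time 0), is of type 1 iff b i, and has processing time x i. *)

Section paths.
Context (R : realType) (K : nat) (a : nat -> R) (b : nat -> bool) (x : nat -> R).

Definition arrival (n : nat) : R := \sum_(i < n.+1) a i.

(* A waiting job, with a flag telling whether a type-1 job has passed it. *)
Definition waiting_job : Type := (nat * bool)%type.

(* [free] is the completion time of the job served last (the server is busy at
   time u iff u < free), [line] lists the waiting jobs from the head of the
   queue to its back, [started] records (job, service start time). *)
Record state := State {
  free : R;
  line : seq waiting_job;
  started : seq (nat * R)
}.

(* Lets the jobs at the head of the line start service up to time u. *)
Fixpoint serve (u c : R) (l : seq waiting_job) (h : seq (nat * R)) : state :=
  match l with
  | [::] => State c [::] h
  | j :: l' => if c <= u then serve u (c + x j.1) l' ((j.1, c) :: h)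
               else State c l h
  end.

Definition advance (u : R) (s : state) : state :=
  serve u (free s) (line s) (started s).

(* Moves the arriving type-1 job j past at most k jobs of the line r, here
   listed from the back of the queue to its head. *)
Fixpoint nudge (j k : nat) (r : seq waiting_job) : seq waiting_job :=
  match k, r with
  | k'.+1, (i, false) :: r' =>
      if b i then (j, false) :: r else (i, true) :: nudge j k' r'
  | _, _ => (j, false) :: r
  end.

Definition join (j : nat) (l : seq waiting_job) : seq waiting_job :=
  if b j then rev (nudge j K (rev l)) else rcons l (j, false).

Definition arrive (j : nat) (s : state) : state :=
  let u := arrival j in
  let s' := advance u s in
  if free s' <= u then State (u + x j) [::] ((j, u) :: started s')
  else State (free s') (join j (line s')) (started s').

Fixpoint state_after (n : nat) : state :=
  if n is m.+1 then arrive m (state_after m) else State 0 [::] [::].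

(* The value 0 is used for a job that never starts, which has probability 0
   since the arrival times tend to infinity almost surely. *)
Definition start_time (n : nat) : R :=
  xget 0 [set s | exists N, (n, s) \in started (state_after N)].

Definition waiting_time (n : nat) : R := start_time n - arrival n.

Definition response_time (n : nat) : R := start_time n + x n - arrival n.

(* The number of arrivals in [0, u]: the index of the first job arriving
   after time u. *)
Definition num_arrivals (u : R) : nat :=
  xget 0%N [set n | u < arrival n /\ forall m, (m < n)%N -> arrival m <= u].

Definition workload (u : R) : R :=
  let s := advance u (state_after (num_arrivals u)) in
  Num.max 0 (free s - u) + \sum_(j <- line s) x j.1.

End paths.

Definition mutually_independent d (T : measurableType d) (R : realType)
    (P : probability T R) (I : choiceType) (F : I -> set (set T)) : Prop :=
  forall (J : {fset I}) (E : I -> set T),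
    (forall i, i \in J -> F i (E i)) ->
    P (\bigcap_(i in [set` J]) E i) = (\prod_(i <- J) P (E i))%E.

Definition preimages d d' (T : measurableType d) (T' : measurableType d')
    (f : T -> T') : set (set T) := [set f @^-1` B | B in measurable].

Section model.
Context (d : measure_display) (T : measurableType d) (R : realType)
  (P : probability T R) (q : params R).
Context (A : nat -> {RV P >-> R}) (B : nat -> {RV P >-> bool})
  (X : nat -> {RV P >-> R}).

Definition type1 (n : nat) : set T := [set w | B n w].

(* The processing time of a job depends on its type; everything else is
   mutually independent. *)
Record is_model : Prop := {
  model_interarrival : forall n (C : set R), measurable C ->
    P (A n @^-1` C) = exponential_prob (lam q) C;
  model_type1 : forall n, P (type1 n) = (p q)%:E;
  model_size1 : forall n t, 0 <= t ->
    P (type1 n `&` [set w | X n w > t])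
      = (p q * pht_ccdf (alpha1 q) (S1 q) t)%:E;
  model_size2 : forall n t, 0 <= t ->
    P (~` type1 n `&` [set w | X n w > t])
      = ((1 - p q) * pht_ccdf (alpha2 q) (S2 q) t)%:E;
  model_indep : mutually_independent P (fun k : nat + nat =>
    match k with
    | inl n => preimages (A n)
    | inr n => preimages (fun w => (B n w, X n w))
    end)
}.

Definition W (n : nat) (w : T) : R :=
  waiting_time (K q) (A ^~ w) (B ^~ w) (X ^~ w) n.
Definition Resp (n : nat) (w : T) : R :=
  response_time (K q) (A ^~ w) (B ^~ w) (X ^~ w) n.
Definition V (u : R) (w : T) : R :=
  workload (K q) (A ^~ w) (B ^~ w) (X ^~ w) u.

(* F is the ccdf of the stationary version, for type-1 jobs, of the sequence
   of per-job quantities Y: P[Y_n > t | job n is of type 1] tends to F t. *)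
Definition stationary_ccdf1 (Y : nat -> T -> R) (F : R -> R) : Prop :=
  forall t, 0 <= t ->
    (fun n => fine (P (type1 n `&` [set w | Y n w > t])) / fine (P (type1 n)))
      @ \oo --> F t.

Definition stationary_ccdf (Y : R -> T -> R) (F : R -> R) : Prop :=
  forall t, 0 <= t -> fine (P [set w | Y u w > t]) @[u --> +oo] --> F t.

End model.

Definition decay_rate (R : realType) (F : R -> R) (theta : R) : Prop :=
  - (t^-1 * ln (F t)) @[t --> +oo] --> theta.

Definition prefactor (R : realType) (F : R -> R) (theta c : R) : Prop :=
  expR (theta * t) * F t @[t --> +oo] --> c.

(* Main.v *)
(* The waiting time of a type-1 job depends neither on its own size nor on later
   arrivals, so its response time is the sum of two independent variables and
   P[R > t] = P[X_1 > t] + int_0^t P[W > t - s] f(s) ds, where f is the density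
   of X_1. The upper right blocks of the exponentials of A^(1), A^(2), A^(3) are
   the convolutions produced by an integration by parts of this integral, and
   the coefficient 1 - lambda of P[X_1 > t] comes from P[W > 0] = lambda, which
   follows from the formula for W because all the matrices involved are rational
   functions of R and E[X] = 1.

   If the two jobs following job n are of type 1, the second one joins the back of
   the queue and waits for all the work found there. Hence the tail of the work
   left behind by an arrival, at a fixed distance, is dominated by that of W. This
   work bounds the response time pathwise and, after averaging over time, bounds Z
   in law, whence W(t) <= R(t) <= C W(t - 2) and Z(t) <= C W(t - 2) for the tails.
   This gives the decay rate, and also the boundedness of the truncated moment
   J(t) = int_0^t e^{theta s} f(s) ds when c_W > 0, without which the value of the
   transform of X_1 at -theta need not be E[e^{theta X_1}]; the prefactor is then
   obtained by letting t tend to infinity in the convolution. *)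
Require Import Defs.
From HB Require Import structures.
From mathcomp Require Import all_boot all_order all_algebra finmap.
From mathcomp Require Import all_classical all_reals all_analysis measurable_realfun.
From mathcomp Require Import ring lra.

Set Implicit Arguments.
Unset Strict Implicit.
Unset Printing Implicit Defensive.

Import Order.TTheory GRing.Theory Num.Theory.
Import numFieldNormedType.Exports.

Local Open Scope classical_set_scope.
Local Open Scope ring_scope.

(** * Matrix exponentials *)

Section matrix_exponential.
Context {R : realType}.

(** No integral is ever formed. The convolution appears as the increment of an antiderivative
    [Phi t] of s -> P[W > t - s] f(s), the truncated moment as an antiderivative J; the mean value
    theorem stands in for monotonicity of the integral, and Riemann-Stieltjes sums link these
    increments to probabilities. The sums bracket the law of the response time of each single job n,
    so the existence of its stationary limit is derived from that of the waiting time. The shift 2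
    is the length of two interarrival times at most 1; together with two type-1 marks they have
    probability ((1 - e^{-lam}) p)^2, whatever the backlog. The decay rate needs two different
    sources: the prefactor of W bounds the tail of R from above even if it is 0, while the bound
    from below comes from the tail of Z. That tail must be shown positive before logarithms are
    taken, which is the role of the lower bound for the workload: a large type-1 job arrives shortly
    after a given time with a probability bounded away from 0. *)

Definition pow_coef n (A : 'M[R]_n) (i j : 'I_n) (k : nat) : R :=
  (k`!%:R)^-1 * (A ^+ k) i j.

Lemma powmxZ n (a : R) (A : 'M[R]_n) k : (a *: A) ^+ k = a ^+ k *: A ^+ k.
Proof.
elim: k => [|k IH]; first by rewrite !expr0 scale1r.
by rewrite !exprS IH -[LHS]/((a *: A) *m (a ^+ k *: A ^+ k))
  -scalemxAl -scalemxAr scalerA.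
Qed.

Lemma expmxZE n (A : 'M[R]_n) t i j :
  expmx (t *: A) i j = limn (pseries (pow_coef A i j) t).
Proof.
rewrite mxE; congr (limn (series _)); apply/funext => k.
by rewrite powmxZ mxE /pow_coef mulrA mulrAC.
Qed.

(** The sum c of all absolute entries dominates every absolute row sum, so each further factor A
    costs at most c. The exponential series of A is thereby dominated entrywise by the scalar one of
    c. *)
Lemma powmx_entry_le n (A : 'M[R]_n) k i j :
  `|(A ^+ k) i j| <= (\sum_i \sum_j `|A i j|) ^+ k.
Proof.
set c := \sum_i \sum_j _.
elim: k i j => [|k IH] i j.
  by rewrite !expr0 mxE normr_nat lern1; case: (_ == _).
rewrite exprS mxE (le_trans (ler_norm_sum _ _ _))//.
apply: (@le_trans _ _ (\sum_l `|A i l| * c ^+ k)).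
  by apply: ler_sum => l _; rewrite normrM ler_wpM2l.
rewrite -mulr_suml exprS; apply: ler_wpM2r.
  by apply: exprn_ge0; apply: sumr_ge0 => ? _; apply: sumr_ge0.
by rewrite /c [leRHS](bigD1 i)//= lerDl; apply: sumr_ge0 => ? _; apply: sumr_ge0.
Qed.

Lemma is_cvg_pow_coef n (A : 'M[R]_n) i j x : cvgn (pseries (pow_coef A i j) x).
Proof.
set c := \sum_i \sum_j `|A i j|.
have c0 : 0 <= c by apply: sumr_ge0 => ? _; apply: sumr_ge0.
apply: normed_cvg.
apply: (@series_le_cvg _ _ (exp_coeff (c * `|x|))).
- by move=> k; exact: normr_ge0.
- by move=> k; rewrite /exp_coeff/= mulr_ge0// exprn_ge0// mulr_ge0.
- move=> k; rewrite /exp_coeff /pow_coef/= !normrM normrX normfV normr_nat.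
  rewrite exprMn -mulrA mulrC; apply: ler_wpM2r; first by rewrite invr_ge0.
  by apply: ler_wpM2r; rewrite ?exprn_ge0// powmx_entry_le.
exact: is_cvg_series_exp_coeff.
Qed.

Lemma pseries_diffs_pow_coef n (A : 'M[R]_n) i j :
  pseries_diffs (pow_coef A i j) = fun k => (k`!%:R)^-1 * (A ^+ k.+1) i j.
Proof.
apply/funext => k; rewrite /pseries_diffs /pow_coef factS natrM invfM.
by rewrite mulrA mulVKf// pnatr_eq0.
Qed.

Lemma cvg_sumr I (r : seq I) T (F : set_system T) {FF : Filter F}
    (f : I -> T -> R) (l : I -> R) :
  (forall i, f i x @[x --> F] --> l i) ->
  \sum_(i <- r) f i x @[x --> F] --> \sum_(i <- r) l i.
Proof.
move=> fl; elim: r => [|i r IH].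
  by under eq_fun do rewrite big_nil; rewrite big_nil; exact: cvg_cst.
by under eq_fun do rewrite big_cons; rewrite big_cons; exact: cvgD.
Qed.

Lemma pseries_sum I (r : seq I) (c : I -> R) (f : I -> R^nat) x :
  (forall i, cvgn (pseries (f i) x)) ->
  pseries (fun k => \sum_(i <- r) c i * f i k) x @ \oo -->
  \sum_(i <- r) c i * limn (pseries (f i) x).
Proof.
move=> cf.
have -> : pseries (fun k => \sum_(i <- r) c i * f i k) x =
    fun k => \sum_(i <- r) c i * pseries (f i) x k.
  apply/funext => k; rewrite /pseries /series/=.
  under eq_bigr do rewrite mulr_suml.
  rewrite exchange_big/=; apply: eq_bigr => i _.
  by rewrite mulr_sumr; apply: eq_bigr => l _; rewrite mulrA.
by apply: cvg_sumr => i; apply: cvgMl_tmp; exact: cf.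
Qed.

(** Splitting A^(k+1) on the left gives the derivative of the exponential as A e^{tA}, splitting it
    on the right gives e^{tA} A; equating the two yields [expmx_comm]. *)
Lemma pow_coefS n (A : 'M[R]_n) i j :
  pseries_diffs (pow_coef A i j) = fun k => \sum_l A i l * pow_coef A l j k.
Proof.
rewrite pseries_diffs_pow_coef; apply/funext => k.
rewrite exprS mxE mulr_sumr; apply: eq_bigr => l _.
by rewrite /pow_coef mulrCA.
Qed.

Lemma pow_coefSr n (A : 'M[R]_n) i j :
  pseries_diffs (pow_coef A i j) = fun k => \sum_l A l j * pow_coef A i l k.
Proof.
rewrite pseries_diffs_pow_coef; apply/funext => k.
rewrite exprSr mxE mulr_sumr; apply: eq_bigr => l _.
by rewrite /pow_coef mulrA mulrC.
Qed.

(** Differentiation entry by entry, so that the rules for real functions and for scalar power series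
    apply directly. *)
Definition mx_derive m n (F : R -> 'M[R]_(m, n)) (s : R) (D : 'M[R]_(m, n)) :=
  forall i j, is_derive s 1 (fun x => F x i j) (D i j).

Lemma cvg_pseries_diffs_pow_coef n (A : 'M[R]_n) i j t :
  pseries (pseries_diffs (pow_coef A i j)) t @ \oo -->
  (A *m expmx (t *: A)) i j.
Proof.
rewrite pow_coefS mxE; under eq_bigr do rewrite expmxZE.
by apply: pseries_sum => l; exact: is_cvg_pow_coef.
Qed.

Lemma expmx_comm n (A : 'M[R]_n) t :
  expmx (t *: A) *m A = A *m expmx (t *: A).
Proof.
apply/matrixP => i j.
rewrite -[RHS](cvg_lim (@Rhausdorff R) (@cvg_pseries_diffs_pow_coef _ A i j t)).
apply/esym/cvg_lim => //.
rewrite pow_coefSr mxE; under eq_bigr do rewrite expmxZE mulrC.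
by apply: pseries_sum => l; exact: is_cvg_pow_coef.
Qed.

Lemma mx_derive_expmx n (A : 'M[R]_n) t :
  mx_derive (fun s => expmx (s *: A)) t (A *m expmx (t *: A)).
Proof.
move=> i j.
have -> : (fun s => expmx (s *: A) i j) = (fun s => limn (pseries (pow_coef A i j) s)).
  by apply/funext => s; rewrite expmxZE.
have -> : (A *m expmx (t *: A)) i j = limn (pseries (pseries_diffs (pow_coef A i j)) t).
  by apply/esym/cvg_lim => //; exact: cvg_pseries_diffs_pow_coef.
(* Termwise differentiation requires the series and its first two formal derivatives to converge at
   a point beyond |t|; the recursion [pow_coefS] reduces each of them to the preceding one. *)
apply: (@pseries_snd_diffs _ _ (`|t| + 1)).
- exact: is_cvg_pow_coef.
- by apply/cvg_ex; eexists; exact: cvg_pseries_diffs_pow_coef.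
- have -> : pseries_diffs (pseries_diffs (pow_coef A i j)) =
      fun k => \sum_l A i l * pseries_diffs (pow_coef A l j) k.
    apply/funext => k; rewrite {1}/pseries_diffs pow_coefS mulr_sumr.
    by apply: eq_bigr => l _; rewrite /pseries_diffs; ring.
  apply/cvg_ex; eexists; apply: pseries_sum => l.
  by apply/cvg_ex; eexists; exact: cvg_pseries_diffs_pow_coef.
by rewrite [ltRHS]ger0_norm// ltrDl.
Qed.

Lemma expmx0 n (A : 'M[R]_n) : expmx (0 *: A) = 1%:M.
Proof.
apply/matrixP => i j; rewrite expmxZE; apply: lim_near_cst => //.
near=> m; have -> : m = m.-1.+1 by rewrite prednK//; near: m; exists 1%N.
rewrite /pseries /series/= big_nat_recl//= big1 => [|k _].
  by rewrite addr0 expr0 mulr1 /pow_coef fact0 invr1 mul1r expr0.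
by rewrite exprS mul0r mulr0.
Unshelve. all: by end_near. Qed.

Lemma mx_derive_cst m n (C : 'M[R]_(m, n)) s : mx_derive (fun=> C) s 0.
Proof. by move=> i j; rewrite mxE; exact: is_derive_cst. Qed.

Lemma mx_deriveM m n k (F : R -> 'M[R]_(m, n)) (G : R -> 'M[R]_(n, k)) s DF DG :
  mx_derive F s DF -> mx_derive G s DG ->
  mx_derive (fun x => F x *m G x) s (DF *m G s + F s *m DG).
Proof.
move=> dF dG i j.
have -> : (fun x => (F x *m G x) i j) =
    \sum_l ((fun x => F x i l) * (fun x => G x l j)).
  by apply/funext => x; rewrite mxE fct_sumE; apply: eq_bigr.
apply: is_derive_eq.
  by apply: is_derive_sum => l; apply: is_deriveM; [exact: dF|exact: dG].
rewrite !mxE -big_split/=; apply: eq_bigr => l _.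
by rewrite addrC; congr (_ + _); rewrite mulrC.
Qed.

Lemma mx_derive_comp m n (F : R -> 'M[R]_(m, n)) (h : R -> R) (s : R) D (b : R) :
  mx_derive F (h s) D -> is_derive s 1 h b ->
  mx_derive (fun x => F (h x)) s (b *: D).
Proof.
move=> dF dh i j; rewrite mxE mulrC.
exact: (@is_derive1_comp R (fun x => F x i j) h).
Qed.

Lemma mx_deriveB m n (F : R -> 'M[R]_(m, n)) s t D :
  mx_derive F (t - s) D -> mx_derive (fun x => F (t - x)) s (- D).
Proof.
move=> dF; rewrite -scaleN1r; apply: mx_derive_comp => //.
rewrite -[X in is_derive _ _ _ X]add0r; apply: is_deriveB; exact: is_derive_cst.
Qed.

Lemma mx_deriveD m n (F G : R -> 'M[R]_(m, n)) s D E :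
  mx_derive F s D -> mx_derive G s E -> mx_derive (fun x => F x + G x) s (D + E).
Proof.
move=> dF dG i j; rewrite mxE.
have -> : (fun x => (F x + G x) i j) = (fun x => F x i j) + (fun x => G x i j).
  by apply/funext => x; rewrite mxE.
exact: is_deriveD.
Qed.

Lemma mx_derive_scale m n (h : R -> R) (F : R -> 'M[R]_(m, n)) (s b : R) D :
  is_derive s 1 h b -> mx_derive F s D ->
  mx_derive (fun x => h x *: F x) s (b *: F s + h s *: D).
Proof.
move=> dh dF i j; rewrite !mxE.
have -> : (fun x => (h x *: F x) i j) = h * (fun x => F x i j).
  by apply/funext => x; rewrite mxE.
apply: is_derive_eq; first by apply: is_deriveM; exact: dF.
by rewrite addrC; congr (_ + _); rewrite mulrC.
Qed.

Lemma derive_ge0_le (f df : R -> R) (a b : R) :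
  (forall x, a <= x <= b -> is_derive x 1 f (df x)) ->
  (forall x, a <= x <= b -> 0 <= df x) -> a <= b -> f a <= f b.
Proof.
move=> fdf df0 ab.
have fd x : x \in `]a, b[%R -> is_derive x 1 f (df x).
  by rewrite in_itv/= => /andP[ax xb]; apply: fdf; rewrite !ltW.
have fc : {within `[a, b], continuous f}.
  apply: derivable_within_continuous => x; rewrite in_itv/= => xab.
  exact: (@ex_derive _ _ _ _ _ _ _ (fdf x xab)).
have [c cab H] := MVT_segment ab fd fc.
by rewrite -subr_ge0 H mulr_ge0 ?subr_ge0// df0//; move: cab; rewrite in_itv.
Qed.

(** This takes the place of comparing two integrals: increments of antiderivatives are ordered like
    their integrands. *)
Lemma derive_le (f g df dg : R -> R) (a b : R) :
  (forall x, a <= x <= b -> is_derive x 1 f (df x)) ->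
  (forall x, a <= x <= b -> is_derive x 1 g (dg x)) ->
  (forall x, a <= x <= b -> df x <= dg x) -> a <= b ->
  f b - f a <= g b - g a.
Proof.
move=> fdf gdg dfg ab.
suff : (g - f) a <= (g - f) b by rewrite !fctE => ?; lra.
apply: (@derive_ge0_le _ (fun x => dg x - df x)) => // x xab.
  by apply: is_deriveB; [exact: gdg|exact: fdf].
by rewrite subr_ge0 dfg.
Qed.

End matrix_exponential.

(** * Intertwining and positivity of matrix exponentials, and phase-type densities *)

Section matrix_exponential_identities.
Context {R : realType}.

Lemma mx_derive0_cst m n (F : R -> 'M[R]_(m, n)) a b :
  (forall s, mx_derive F s 0) -> F a = F b.
Proof.
move=> dF; apply/matrixP => i j.
apply: (@is_derive_0_is_cst R (fun x => F x i j)) => x.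
by have := dF x i j; rewrite mxE.
Qed.

Lemma mx_derive_eq m n (F : R -> 'M[R]_(m, n)) s D E :
  mx_derive F s D -> D = E -> mx_derive F s E.
Proof. by move=> + <-. Qed.

Lemma mx_deriveN m n (F : R -> 'M[R]_(m, n)) s D :
  mx_derive F s D -> mx_derive (fun x => - F x) s (- D).
Proof.
move=> dF i j; rewrite mxE.
have -> : (fun x => (- F x) i j) = - (fun x => F x i j).
  by apply/funext => x; rewrite mxE.
exact: is_deriveN.
Qed.

Lemma mx_derive_mull m n k (C : 'M[R]_(k, m)) (F : R -> 'M[R]_(m, n)) s D :
  mx_derive F s D -> mx_derive (fun x => C *m F x) s (C *m D).
Proof.
move=> dF; apply: mx_derive_eq; first exact: mx_deriveM (mx_derive_cst C s) dF.
by rewrite mul0mx add0r.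
Qed.

Lemma mx_derive_mulr m n k (C : 'M[R]_(n, k)) (F : R -> 'M[R]_(m, n)) s D :
  mx_derive F s D -> mx_derive (fun x => F x *m C) s (D *m C).
Proof.
move=> dF; apply: mx_derive_eq; first exact: mx_deriveM dF (mx_derive_cst C s).
by rewrite mulmx0 addr0.
Qed.

Lemma mx_derive_expmxB n (A : 'M[R]_n) t s :
  mx_derive (fun x => expmx ((t - x) *: A)) s (- (expmx ((t - s) *: A) *m A)).
Proof.
apply: (@mx_deriveB _ _ _ (fun x => expmx (x *: A))).
by rewrite expmx_comm; exact: mx_derive_expmx.
Qed.

(** The function s -> e^{(t-s)C} X e^{sA} has derivative 0; its values at t and 0 are the two
    sides. *)
Lemma expmx_intertwine m n (X : 'M[R]_(m, n)) (A : 'M[R]_n) (C : 'M[R]_m) t :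
  X *m A = C *m X -> X *m expmx (t *: A) = expmx (t *: C) *m X.
Proof.
move=> XA.
have := @mx_derive0_cst _ _
  (fun s => expmx ((t - s) *: C) *m (X *m expmx (s *: A))) t 0.
rewrite subrr subr0 !expmx0 mul1mx mulmx1; apply => s.
apply: mx_derive_eq.
  apply: mx_deriveM; first exact: mx_derive_expmxB.
  apply: mx_derive_mull; exact: mx_derive_expmx.
by rewrite mulNmx -!mulmxA [X in _ + _ *m X]mulmxA XA !mulmxA addNr.
Qed.

Lemma expmxD_scalar n (A : 'M[R]_n) c t :
  expmx (t *: A) = expR (- c * t) *: expmx (t *: (A + c%:M)).
Proof.
have := @mx_derive0_cst _ _ (fun s => expR (- c * s) *:
  (expmx ((t - s) *: A) *m expmx (s *: (A + c%:M)))) 0 t.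
rewrite mulr0 expR0 scale1r subrr subr0 !expmx0 mul1mx mulmx1; apply => s.
apply: mx_derive_eq.
  apply: (@mx_derive_scale _ _ _ _ _ _ (expR (- c * s) * - c)).
    apply: (@is_derive1_comp _ expR (fun s => - c * s)).
    rewrite -[X in is_derive _ _ _ X]mulr1.
    exact: is_deriveZ.
  by apply: mx_deriveM; [exact: mx_derive_expmxB|exact: mx_derive_expmx].
rewrite mulNmx mulmxA mulmxDr mulmxDl mul_mx_scalar -scalemxAl addKr.
by rewrite scalerA -scalerDl -mulrDr addNr mulr0 scale0r.
Qed.

(** All terms of the series are nonnegative and the one of order 0 is the identity matrix. *)
Lemma expmx_ge0 n (N : 'M[R]_n) t i j : (forall i j, 0 <= N i j) -> 0 <= t ->
  (i == j)%:R <= expmx (t *: N) i j.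
Proof.
move=> N0 t0; rewrite expmxZE.
have P0 k i' j' : 0 <= (N ^+ k) i' j'.
  elim: k i' j' => [|k IH] i' j'; first by rewrite expr0 mxE ler0n.
  by rewrite exprS mxE sumr_ge0// => l _; rewrite mulr_ge0.
apply: limr_ge; first exact: is_cvg_pow_coef.
near=> m; have -> : m = m.-1.+1 by rewrite prednK//; near: m; exists 1%N.
rewrite /pseries /series/= big_nat_recl//=.
rewrite expr0 mulr1 /pow_coef fact0 invr1 mul1r expr0 mxE lerDl sumr_ge0// => k _.
by rewrite mulr_ge0 ?exprn_ge0// mulr_ge0.
Unshelve. all: by end_near. Qed.

(** Adding c, the sum of the |S i i|, to the diagonal makes the matrix nonnegative, and
    [expmxD_scalar] returns the factor e^{-ct}. The strictly positive diagonal bound is what later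
    keeps phase-type tails from vanishing. *)
Lemma expmx_metzler_ge n (S : 'M[R]_n) :
  (forall i j, i != j -> 0 <= S i j) ->
  exists c, forall t i j, 0 <= t ->
    expR (- c * t) * (i == j)%:R <= expmx (t *: S) i j.
Proof.
move=> S0; exists (\sum_i `|S i i|) => t i j t0.
rewrite (expmxD_scalar S (\sum_i `|S i i|)) [leRHS]mxE.
apply: ler_wpM2l; first exact: expR_ge0.
apply: expmx_ge0 => // k l; rewrite !mxE.
have [->|kl] := eqVneq k l; last by rewrite addr0 S0.
rewrite mulr1n (bigD1 l)//= addrA addr_ge0//; last exact: sumr_ge0.
by rewrite -[X in 0 <= X + _]opprK addrC subr_ge0 -normrN ler_norm.
Qed.

Lemma mulmx11 (A B : 'M[R]_1) : (A *m B) ord0 ord0 = A ord0 ord0 * B ord0 ord0.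
Proof. by rewrite mxE big_ord1. Qed.

Definition pht_pdf n (alpha : 'rV[R]_n) (S : 'M[R]_n) (t : R) : R :=
  (alpha *m expmx (t *: S) *m (- S *m ones) : 'M[R]_1) ord0 ord0.

Lemma is_derive_pht_ccdf n (alpha : 'rV[R]_n) (S : 'M[R]_n) (t : R) :
  is_derive t 1 (pht_ccdf alpha S) (- pht_pdf alpha S t).
Proof.
have -> : - pht_pdf alpha S t =
    (alpha *m (S *m expmx (t *: S)) *m ones : 'M[R]_1) ord0 ord0.
  by rewrite /pht_pdf mulNmx mulmxN [X in - X]mxE opprK -expmx_comm !mulmxA.
exact: (mx_derive_mulr ones (mx_derive_mull alpha (mx_derive_expmx S t))).
Qed.

(* The function differentiated here is an antiderivative in s of the integrand
   of the convolution, at t, of v e^{M r} xi with the phase-type density. *)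
Lemma mx_derive_convolution m n (v : 'rV[R]_m) (M : 'M[R]_m) (xi : 'cV[R]_m)
    (alpha : 'rV[R]_n) (S : 'M[R]_n) t s :
  let A := block_mx M (M *m xi *m alpha) 0 S in
  mx_derive (fun x => - (v *m expmx ((t - x) *: M) *m
      (xi *m (alpha *m expmx (x *: S) *m ones)
       + row_mx 1%:M 0 *m expmx (x *: A) *m col_mx 0 ones))) s
    ((v *m expmx ((t - s) *: M) *m xi) *m
     (alpha *m expmx (s *: S) *m (- S *m ones)) : 'M[R]_1).
Proof.
move=> A.
pose U : 'M[R]_(m, m + n) := row_mx 1%:M 0.
pose L : 'M[R]_(n, m + n) := row_mx 0 1%:M.
have UA : U *m A = M *m U + M *m xi *m alpha *m L.
  rewrite /U /L /A mul_row_block !mul1mx !mul0mx !addr0.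
  by rewrite !mul_mx_row !mulmx1 !mulmx0 add_row_mx addr0 add0r.
have LA : L *m A = S *m L.
  rewrite /L /A mul_row_block !mul1mx !mul0mx !add0r.
  by rewrite mul_mx_row mulmx0 mulmx1.
have dB : mx_derive (fun x => xi *m (alpha *m expmx (x *: S) *m (ones : 'cV[R]_n))
       + row_mx 1%:M 0 *m expmx (x *: A) *m col_mx 0 ones) s
  (M *m (xi *m (alpha *m expmx (s *: S) *m ones)
       + row_mx 1%:M 0 *m expmx (s *: A) *m col_mx 0 ones) +
   xi *m (alpha *m expmx (s *: S) *m (S *m ones))).
  apply: mx_derive_eq.
    apply: mx_deriveD.
      apply: mx_derive_mull; apply: mx_derive_mulr; apply: mx_derive_mull.
      exact: mx_derive_expmx.
    by apply: mx_derive_mulr; apply: mx_derive_mull; exact: mx_derive_expmx.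
  rewrite -expmx_comm -/U [U *m (A *m _)]mulmxA UA mulmxDl mulmxDl.
  rewrite -[M *m xi *m alpha *m L *m _]mulmxA (expmx_intertwine s LA).
  have Lc : L *m col_mx 0 ones = ones :> 'cV[R]_n.
    by rewrite /L mul_row_col mul0mx mul1mx add0r.
  rewrite -[_ *m (_ *m L) *m _]mulmxA -[_ *m L *m _]mulmxA Lc mulmxDr.
  by rewrite !mulmxA addrC [X in X + _ = _]addrC.
apply: mx_derive_eq.
  apply: mx_deriveN; apply: mx_deriveM; last exact: dB.
  by apply: mx_derive_mull; exact: mx_derive_expmxB.
rewrite /=; set b := (X in _ + _ *m (_ *m X + _)).
rewrite -/b mulmxDr mulmxN mulNmx -!mulmxA addKr.
by rewrite !mulNmx !mulmxN.
Qed.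

End matrix_exponential_identities.

(** * Phase-type distributions *)

Section phase_type.
Context {R : realType} {n : nat} (alpha : 'rV[R]_n) (S : 'M[R]_n).
Hypothesis ph : is_phase_type alpha S.
Local Notation G := (pht_ccdf alpha S).
Local Notation f := (pht_pdf alpha S).

(** A minimum principle for y = (-S)^{-1} 1, the vector of mean absorption times. If the minimum y_k
    were at most 0, row k of (-S) y would be at most y_k times a nonnegative row sum of -S, hence at
    most 0, whereas it equals 1. *)
Lemma pht_inv_ones_gt0 i : 0 < (invmx (- S) *m (ones : 'cV[R]_n)) i ord0.
Proof.
have uS : - S \in unitmx by rewrite -scaleN1r unitmxZ ?unitrN1 ?(pht_inv ph).
set y := invmx (- S) *m ones.
have Sy k : \sum_j - S k j * y j ord0 = 1.
  have : (- S *m y) k ord0 = 1 by rewrite mulKVmx// mxE.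
  rewrite mxE => <-; apply: eq_bigr => j _.
  by congr (_ * _); rewrite [RHS]mxE.
pose k := [arg min_(k < i) y k ord0]%O.
have yk j : y k ord0 <= y j ord0.
  by rewrite /k; case: Order.TotalTheory.arg_minP => // l _ H; apply: H.
apply: lt_le_trans (yk i); rewrite ltNge; apply/negP => yk0.
have := Sy k; apply/eqP; rewrite lt_eqF// (le_lt_trans _ ltr01)//.
apply: (@le_trans _ _ (\sum_j - S k j * y k ord0)).
  apply: ler_sum => j _; have [->//|kj] := eqVneq j k.
  by rewrite !mulNr lerN2 ler_wpM2l// (pht_offdiag ph)// eq_sym.
rewrite -mulr_suml sumrN mulNr oppr_le0 mulr_le0//; exact: (pht_row ph).
Qed.

Lemma pht_ccdf_0 : G 0 = 1.
Proof.
rewrite /pht_ccdf expmx0 mulmx1 mxE -[RHS](pht_sum1 ph).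
by apply: eq_bigr => i _; rewrite mxE mulr1.
Qed.

Lemma pht_row_ge0 t j : 0 <= t -> 0 <= (alpha *m expmx (t *: S)) ord0 j.
Proof.
move=> t0; have [c Hc] := expmx_metzler_ge (pht_offdiag ph).
rewrite mxE sumr_ge0// => i _; rewrite mulr_ge0 ?(pht_ge0 ph)//.
by apply: le_trans (Hc t i j t0); rewrite mulr_ge0 ?expR_ge0.
Qed.

Lemma pht_ccdfE t : G t = \sum_j (alpha *m expmx (t *: S)) ord0 j.
Proof. by rewrite /pht_ccdf mxE; apply: eq_bigr => i _; rewrite [const_mx _ _ _]mxE mulr1. Qed.

Lemma pht_ccdf_gt0 t : 0 <= t -> 0 < G t.
Proof.
move=> t0; have [c Hc] := expmx_metzler_ge (pht_offdiag ph).
apply: (@lt_le_trans _ _ (expR (- c * t))); first exact: expR_gt0.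
rewrite pht_ccdfE -[leLHS]mulr1 -[X in _ * X <= _](pht_sum1 ph) mulr_sumr.
apply: ler_sum => j _; rewrite mxE (bigD1 j)//=.
rewrite -[leLHS]addr0 lerD//.
  rewrite mulrC ler_wpM2l ?(pht_ge0 ph)//.
  by apply: le_trans (Hc t j j t0); rewrite eqxx mulr1.
rewrite sumr_ge0// => i _; rewrite mulr_ge0 ?(pht_ge0 ph)//.
by apply: le_trans (Hc t i j t0); rewrite mulr_ge0 ?expR_ge0.
Qed.

Lemma pht_exit_ge0 i : 0 <= (- S *m (ones : 'cV[R]_n)) i ord0.
Proof.
rewrite mulNmx mxE oppr_ge0 mxE.
by under eq_bigr do rewrite mxE mulr1; exact: (pht_row ph).
Qed.

Lemma pht_pdf_ge0 t : 0 <= t -> 0 <= f t.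
Proof.
move=> t0; rewrite /pht_pdf mxE sumr_ge0// => j _.
by rewrite mulr_ge0 ?pht_row_ge0// pht_exit_ge0.
Qed.

Lemma pht_ccdf_nincr s t : 0 <= s -> s <= t -> G t <= G s.
Proof.
move=> s0 st; rewrite -subr_ge0.
have := @derive_le R (fun=> 0) (fun x => - G x) (fun=> 0) f s t.
rewrite subrr opprK addrC; apply => // x /andP[sx _].
  by rewrite -[f x]opprK; apply: is_deriveN; exact: is_derive_pht_ccdf.
by rewrite pht_pdf_ge0// (le_trans s0).
Qed.

(** The density is at most G(t) times the sum of the exit rates. The bound controls the mesh error
    of the Riemann-Stieltjes sums. *)
Lemma pht_pdf_bounded : exists2 c, 0 <= c & forall t, 0 <= t -> f t <= c.
Proof.
pose c := \sum_i (- S *m (ones : 'cV[R]_n)) i ord0.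
have c0 : 0 <= c by apply: sumr_ge0 => i _; exact: pht_exit_ge0.
exists c => // t t0; apply: (@le_trans _ _ (G t * c)).
  rewrite pht_ccdfE /pht_pdf mxE mulr_suml; apply: ler_sum => j _.
  rewrite ler_wpM2l ?pht_row_ge0// /c (bigD1 j)//= lerDl.
  by apply: sumr_ge0 => i _; exact: pht_exit_ge0.
by rewrite ler_piMl// -pht_ccdf_0 pht_ccdf_nincr.
Qed.

(** Markov's inequality t G(t) <= m(0), with the integrated tail m(t) = alpha e^{tS} (-S)^{-1} 1,
    whose derivative is -G. No spectral information on S enters. *)
Lemma pht_ccdf_cvg0 : G t @[t --> +oo] --> 0.
Proof.
have uS : - S \in unitmx by rewrite -scaleN1r unitmxZ ?unitrN1 ?(pht_inv ph).
pose y : 'cV[R]_n := invmx (- S) *m ones.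
pose m (t : R) : R := (alpha *m expmx (t *: S) *m y : 'M[R]_1) ord0 ord0.
have m0 t : 0 <= t -> 0 <= m t.
  move=> t0; rewrite /m mxE sumr_ge0// => j _.
  by rewrite mulr_ge0 ?pht_row_ge0// ltW// pht_inv_ones_gt0.
have dm (t : R) : is_derive t 1 m (- G t).
  have -> : - G t = (alpha *m (S *m expmx (t *: S)) *m y : 'M[R]_1) ord0 ord0.
    rewrite /pht_ccdf -expmx_comm -[in LHS](mulKVmx uS ones) -/y.
    by rewrite mulNmx mulmxN [X in - X]mxE opprK !mulmxA.
  exact: (mx_derive_mulr y (mx_derive_mull alpha (mx_derive_expmx S t))).
have mG t : 0 <= t -> t * G t <= m 0.
  move=> t0.
  have : m 0 - m t >= t * G t.
    have := @derive_ge0_le R (fun x => - m x - x * G x)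
      (fun x => x * f x) 0 t.
    rewrite mul0r subr0 => H; rewrite -subr_ge0.
    suff : - m 0 <= - m t - t * G t by lra.
    apply: H => // x /andP[x0 xt]; last by rewrite mulr_ge0// pht_pdf_ge0.
    have H1 : is_derive x 1 (- m) (- - G x) by apply: is_deriveN; exact: dm.
    have H2 : is_derive x 1 (id * G) (x *: - f x + G x *: 1).
      by apply: is_deriveM; exact: is_derive_pht_ccdf.
    have H3 := is_deriveB H1 H2. refine (is_derive_eq H3 _).
    by rewrite /GRing.scale/= mulr1 mulrN opprD !opprK addrCA subrr addr0.
  by move=> /le_trans; apply; rewrite gerBl m0.
apply/cvgrPdist_le => e e0; near=> t.
have t0 : 0 < t by near: t; apply: nbhs_pinfty_gt; rewrite num_real.
rewrite sub0r normrN ger0_norm; last by apply/ltW/pht_ccdf_gt0/ltW.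
rewrite -(ler_pM2l t0) (le_trans (mG t (ltW t0)))// -ler_pdivrMr.
by near: t; apply: nbhs_pinfty_ge; rewrite num_real.
Unshelve. all: by end_near. Qed.

(* J is the truncated exponential moment of the phase-type density; once it is
   known to be bounded, it converges to the value of the transform, because
   e^{theta t} G(t) is at most the tail of J. *)
Lemma pht_truncated_moment (theta : R) :
  0 <= theta -> (- theta)%:M - S \in unitmx ->
  exists J : R -> R, [/\ J 0 = 0,
    forall t : R, is_derive t 1 J (expR (theta * t) * f t) &
    (exists K, forall t, 0 <= t -> J t <= K) ->
      J t @[t --> +oo] --> pht_lst alpha S (- theta) /\
      expR (theta * t) * G t @[t --> +oo] --> 0].
Proof.
move=> th0; set B := _ - S => uB.
pose L := pht_lst alpha S (- theta).
(* With this w, [psi] satisfies psi' = -f - theta psi, so -e^{theta t} psi(t) is an antiderivative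
   of e^{theta t} f(t); as psi(0) = L, adding L makes it vanish at 0. *)
pose w : 'cV[R]_n := invmx B *m (- S *m ones).
pose psi (t : R) : R := (alpha *m expmx (t *: S) *m w : 'M[R]_1) ord0 ord0.
pose e (t : R) : R := expR (theta * t).
have BS : S = - (B + theta%:M).
  by rewrite /B addrAC -[_%:M + _]raddfD/= addNr raddf0 add0r opprK.
have Sw : S *m w = - (- S *m ones) - theta *: w.
  by rewrite {1}BS mulNmx mulmxDl mul_scalar_mx mulKVmx// opprD.
have de (t : R) : is_derive t 1 e (e t * theta).
  apply: (@is_derive1_comp _ expR (fun s => theta * s)).
  rewrite -[X in is_derive _ _ _ X]mulr1; exact: is_deriveZ.
have dpsi (t : R) : is_derive t 1 psi (- f t - theta * psi t).
  have -> : - f t - theta * psi t =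
      (alpha *m (S *m expmx (t *: S)) *m w : 'M[R]_1) ord0 ord0.
    have entry (A C : 'M[R]_1) c :
        (- A - c *: C) ord0 ord0 = - A ord0 ord0 - c * C ord0 ord0 by rewrite !mxE.
    by rewrite -expmx_comm mulmxA -mulmxA Sw mulmxBr mulmxN -scalemxAr entry.
  exact: (mx_derive_mulr w (mx_derive_mull alpha (mx_derive_expmx S t))).
pose J (t : R) : R := L - e t * psi t.
have dJ (t : R) : is_derive t 1 J (e t * f t).
  have H2 : is_derive t 1 (e * psi)
      (e t *: (- f t - theta * psi t) + psi t *: (e t * theta)).
    by apply: is_deriveM.
  have H3 := is_deriveB (is_derive_cst L t 1) H2.
  refine (is_derive_eq H3 _); rewrite /GRing.scale/= mulrBr mulrN.
  by rewrite [psi t * _]mulrC -[e t * theta * _]mulrA subrK sub0r opprK.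
exists J; split => //.
  rewrite /J /e mulr0 expR0 mul1r /psi expmx0 mulmx1 /L /pht_lst.
  by rewrite !mulmxA subrr.
- move=> [K JK].
  have J_nd (s t : R) : 0 <= s -> s <= t -> J s <= J t.
    move=> s0 st; apply: (@derive_ge0_le _ J (fun x => e x * f x)) => // x /andP[sx _].
    by rewrite mulr_ge0 ?expR_ge0// pht_pdf_ge0// (le_trans s0).
  (* On [s, t] the weight in J is at least e^{theta s}. Letting t tend to infinity bounds e^{theta
     s} G(s) by what remains of J after s. *)
  have tailG (s t : R) : 0 <= s -> s <= t -> e s * (G s - G t) <= J t - J s.
    move=> s0 st.
    have := @derive_le R (fun x => - (e s * G x)) J (fun x => e s * f x)
      (fun x => e x * f x) s t.
    rewrite opprK addrC -mulrBr; apply => // x /andP[sx xt].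
      rewrite -[f x]opprK mulrN.
      apply: is_deriveN.
      by apply: is_deriveZ; exact: is_derive_pht_ccdf.
    rewrite ler_wpM2r ?pht_pdf_ge0// ?(le_trans s0)// ler_expR.
    by rewrite ler_wpM2l.
  pose Jinf := sup [set J t | t in [set t | 0 <= t]].
  have hs : has_sup [set J t | t in [set t | 0 <= t]].
    split; first by exists (J 0); exists 0 => /=.
    by exists K => _ [t t0 <-]; exact: JK.
  have JJ (t : R) : 0 <= t -> J t <= Jinf.
    by move=> t0; apply: sup_upper_bound => //; exists t.
  have cJ : J t @[t --> +oo] --> Jinf.
    apply/cvgrPdist_le => eps eps0.
    have [_ [t0 t00 <-] Ht] := sup_adherent eps0 hs.
    near=> t.
    have t0t : t0 <= t by near: t; apply: nbhs_pinfty_ge; rewrite num_real.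
    rewrite ger0_norm ?subr_ge0 ?JJ ?(le_trans t00)//.
    rewrite lerBlDl -lerBlDr; apply: le_trans (J_nd _ _ t00 t0t); exact: ltW.
  have eG (t : R) : 0 <= t -> e t * G t <= Jinf - J t.
    move=> t0.
    have cl : e t * (G t - G s) @[s --> +oo] --> e t * (G t - 0).
      apply: cvgMl_tmp; apply: cvgB; first exact: cvg_cst.
      exact: pht_ccdf_cvg0.
    rewrite subr0 in cl.
    rewrite -(cvg_lim (@Rhausdorff R) cl).
    apply: limr_le; first by apply/cvg_ex; eexists; exact: cl.
    near=> s; have ts : t <= s by near: s; apply: nbhs_pinfty_ge; rewrite num_real.
    by rewrite (le_trans (tailG t s t0 ts))// lerB// JJ// (le_trans t0).
  have ceG : e t * G t @[t --> +oo] --> 0.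
    apply: (@squeeze_cvgr _ _ _ _ (fun=> 0) (fun t => Jinf - J t)).
    - near=> t; have t0 : 0 <= t by near: t; apply: nbhs_pinfty_ge; rewrite num_real.
      by rewrite eG// mulr_ge0 ?expR_ge0// ltW// pht_ccdf_gt0.
    - exact: cvg_cst.
    - rewrite -(subrr Jinf); apply: cvgB; [exact: cvg_cst|exact: cJ].
  split => //.
  have cpsi : e t * psi t @[t --> +oo] --> 0.
    (* Each entry of the row alpha e^{tS} lies between 0 and G(t), so e^{theta t} G(t) -> 0 forces
       e^{theta t} psi(t) -> 0, and the limit of J is L. *)
    have crow j : e t * (alpha *m expmx (t *: S)) ord0 j @[t --> +oo] --> 0.
      apply: (@squeeze_cvgr _ _ _ _ (fun=> 0) (fun t => e t * G t)) => //.
      - near=> t; have t0 : 0 <= t by near: t; apply: nbhs_pinfty_ge; rewrite num_real.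
        rewrite mulr_ge0 ?expR_ge0 ?pht_row_ge0//= ler_wpM2l ?expR_ge0//.
        rewrite pht_ccdfE (bigD1 j)//= lerDl sumr_ge0// => i _.
        exact: pht_row_ge0.
      - exact: cvg_cst.
    have -> : (fun t => e t * psi t) = (fun t => \sum_j
        (e t * (alpha *m expmx (t *: S)) ord0 j) * w j ord0).
      apply/funext => t; rewrite /psi [X in _ * X]mxE mulr_sumr.
      by apply: eq_bigr => j _; rewrite mulrA.
    rewrite [X in _ --> X](_ : 0 = \sum_(j < n) 0 * w j ord0); last first.
      by rewrite big1// => j _; rewrite mul0r.
    apply: (@cvg_sumr R _ _ _ (pinfty_nbhs R) _ (fun j t =>
      e t * (alpha *m expmx (t *: S)) ord0 j * w j ord0)) => j.
    by apply: cvgMr_tmp; exact: crow.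
  rewrite -[X in _ --> X]subr0; apply: cvgB; [exact: cvg_cst|exact: cpsi].
Unshelve. all: by end_near. Qed.

End phase_type.

(** * The waiting-time formula *)

Section Z_matrices.
Context {R : realType}.

(* At an index maximizing |v_i| / y_i, a kernel vector v rescaled to touch y
   gives a nonnegative vector y - v vanishing at i, whose image by a matrix
   with nonpositive off-diagonal entries is nonpositive at i. *)
Lemma Zmatrix_unitmx n (N : 'M[R]_n) (y : 'cV[R]_n) :
  (forall i j, i != j -> N i j <= 0) ->
  (forall i, 0 < y i ord0) -> (forall i, 0 < (N *m y) i ord0) ->
  N \in unitmx.
Proof.
move=> N0 y0 Ny0; rewrite -unitmx_tr -row_free_unit -kermx_eq0.
apply/rowV0P => u /sub_kermxP uN.
have Nv : N *m u^T = 0 by apply: trmx_inj; rewrite trmx_mul trmxK uN trmx0.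
move: (u^T) Nv (trmxK u) => v Nv <-.
suff v0 i : v i ord0 = 0 by apply/rowP => i; rewrite !mxE v0.
pose k := [arg max_(k > i) (`|v k ord0| / y k ord0)]%O.
have kmax j : `|v j ord0| / y j ord0 <= `|v k ord0| / y k ord0.
  by rewrite /k; case: Order.TotalTheory.arg_maxP => // l _ H; apply: H.
pose c := `|v k ord0| / y k ord0.
have [c0|c0] := eqVneq c 0.
  have := kmax i; rewrite -/c c0 pmulr_lle0 ?invr_gt0//.
  by rewrite normr_le0 => /eqP.
have cgt0 : 0 < c by rewrite lt_neqAle eq_sym c0 divr_ge0// ltW.
pose sg : R := if 0 <= v k ord0 then 1 else -1.
pose w : 'cV[R]_n := c *: y - sg *: v.
have wk : w k ord0 = 0.
  rewrite !mxE /c divfK ?gt_eqF// /sg; case: ifPn => [v0|].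
    by rewrite ger0_norm// mul1r subrr.
  by rewrite -ltNge => v0; rewrite ltr0_norm// mulN1r subrr.
have w0 j : 0 <= w j ord0.
  rewrite !mxE subr_ge0 (@le_trans _ _ `|v j ord0|)//.
    rewrite /sg; case: ifPn => _; first by rewrite mul1r ler_norm.
    by rewrite mulN1r -normrN ler_norm.
  by rewrite -ler_pdivrMr//; exact: kmax.
have : 0 < (N *m w) k ord0.
  rewrite mulmxBr -!scalemxAr Nv scaler0 subr0 mxE mulr_gt0//.
rewrite mxE (bigD1 k)//= wk mulr0 add0r => /lt_geF /negP; case.
by apply: sumr_le0 => j jk; rewrite mulr_le0_ge0// N0// eq_sym.
Qed.

End Z_matrices.

Section waiting_time_formula.
Context {R : realType} (q : params R).
Hypothesis lam_gt0 : 0 < lam q.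
Hypothesis lam_lt1 : lam q < 1.
Hypothesis p_gt0 : 0 < p q.
Hypothesis p_lt1 : p q < 1.
Hypothesis ph1 : is_phase_type (alpha1 q) (S1 q).
Hypothesis ph2 : is_phase_type (alpha2 q) (S2 q).
Hypothesis mean1 : pht_mean (alpha q) (Smx q) = 1.
Local Notation n := (n1 q + n2 q)%N.
Local Notation one := (ones : 'cV[R]_n).

Lemma is_phase_type_mixture : is_phase_type (alpha q) (Smx q).
Proof.
have ? := ltW p_gt0; have ? : 0 <= 1 - p q by rewrite subr_ge0 ltW.
split.
- move=> i; rewrite /alpha -[i]splitK; case: (fintype.split i) => j /=.
    by rewrite row_mxEl mxE mulr_ge0// (pht_ge0 ph1).
  by rewrite row_mxEr mxE mulr_ge0// (pht_ge0 ph2).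
- rewrite big_split_ord/= /alpha.
  under eq_bigr do rewrite row_mxEl mxE.
  under [X in _ + X]eq_bigr do rewrite row_mxEr mxE.
  by rewrite -!mulr_sumr (pht_sum1 ph1) (pht_sum1 ph2) !mulr1 addrC subrK.
- move=> i; rewrite /Smx -[i]splitK; case: (fintype.split i) => j /=.
    by rewrite block_mxEul (pht_diag ph1).
  by rewrite block_mxEdr (pht_diag ph2).
- move=> i j; rewrite /Smx -[i]splitK -[j]splitK.
  case: (fintype.split i) => k; case: (fintype.split j) => l /= kl.
  + rewrite block_mxEul (pht_offdiag ph1)//.
  + by rewrite block_mxEur mxE.
  + by rewrite block_mxEdl mxE.
  + rewrite block_mxEdr (pht_offdiag ph2)//.
    by apply/eqP => kl1; move: kl; rewrite kl1 eqxx.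
- move=> i; rewrite big_split_ord/= /Smx -[i]splitK.
  case: (fintype.split i) => k /=.
    under eq_bigr do rewrite block_mxEul.
    rewrite [X in _ + X]big1 ?addr0 ?(pht_row ph1)// => j _.
    by rewrite block_mxEur mxE.
  under [X in _ + X]eq_bigr do rewrite block_mxEdr.
  rewrite big1 ?add0r ?(pht_row ph2)// => j _.
  by rewrite block_mxEdl mxE.
- rewrite unitmxE /Smx det_ublock unitrM -!unitmxE.
  by rewrite (pht_inv ph1) (pht_inv ph2).
Qed.

Let y : 'cV[R]_n := invmx (- Smx q) *m ones.

(** The resolvent matrix behind R, which is lam N(lam)^{-1}. Off the diagonal it is nonpositive, and
    E[X] = 1 gives N(mu) y = mu y + (1 - lam) 1, a positive vector for mu >= 0; hence it is a
    nonsingular M-matrix. *)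
Let N (mu : R) : 'M[R]_n := mu%:M - Smx q - lam q *: (one *m alpha q).

Let alpha_y : alpha q *m y = 1%:M.
Proof.
by apply/matrixP => i j; rewrite !ord1 -mean1 /pht_mean -mulmxA [in RHS]mxE eqxx.
Qed.

Let Ny mu : N mu *m y = mu *: y + (1 - lam q) *: one.
Proof.
have uS : - Smx q \in unitmx.
  by rewrite -scaleN1r unitmxZ ?unitrN1 ?(pht_inv is_phase_type_mixture).
rewrite /N mulmxBl mulmxDl mul_scalar_mx mulKVmx// -scalemxAl -mulmxA alpha_y.
by rewrite mulmx1 -addrA scalerBl scale1r.
Qed.

Let N_unit mu : 0 <= mu -> N mu \in unitmx.
Proof.
move=> mu0; have y0 := pht_inv_ones_gt0 is_phase_type_mixture.
apply: (@Zmatrix_unitmx _ _ _ y) => [i j ij|//|i].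
  have := pht_ge0 is_phase_type_mixture j.
  have := pht_offdiag is_phase_type_mixture ij.
  rewrite /N; move: (Smx q) (alpha q) => S a Sij aj.
  rewrite !mxE (negbTE ij) mulr0n add0r big_ord1 !mxE mul1r subr_le0.
  by apply: (@le_trans _ _ 0); rewrite ?oppr_le0 ?mulr_ge0// ltW.
rewrite Ny mxE [X in X + _]mxE [X in _ + X]mxE [const_mx _ _ _]mxE mulr1.
by rewrite ltr_wpDl ?mulr_ge0 ?subr_gt0// ltW// y0.
Qed.

Let RmxE : Rmx q = lam q *: invmx (N (lam q)).
Proof.
rewrite /Rmx.
have -> : Smx q - (lam q)%:M + lam q *: (ones *m alpha q) = -1 *: N (lam q).
  by rewrite scaleN1r /N !opprD !opprK [X in _ = X + _]addrC.
by rewrite invmxZ ?unitmxZ ?unitrN1 ?N_unit ?ltW// scalerA invrN1 mulrNN mulr1.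
Qed.

Let RN : Rmx q *m N (lam q) = (lam q)%:M.
Proof. by rewrite RmxE -scalemxAl mulVmx ?N_unit ?ltW// scalemx1. Qed.

Let NB mu nu : N (mu - nu) = N mu - nu%:M.
Proof. by rewrite /N raddfB/= -!addrA; congr (_ + _); rewrite addrC -addrA. Qed.

(** I - cR = lam^{-1} R N(lam (1 - c)), and c <= 1 keeps the argument of N nonnegative. The values c
    = 1 and c = 1 - p are the ones that occur in the formulas. *)
Let subR_unit c : c <= 1 -> 1%:M - c *: Rmx q \in unitmx.
Proof.
move=> c1; have l0 : lam q != 0 by rewrite gt_eqF.
have -> : 1%:M - c *: Rmx q = (lam q)^-1 *: (Rmx q *m N (lam q - lam q * c)).
  rewrite NB mulmxBr RN mul_mx_scalar scalerBr scale_scalar_mx mulVf//.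
  by rewrite [X in _ = _ - X]scalerA mulrA mulVf// mul1r.
rewrite unitmxZ ?unitfE ?invr_eq0// unitmx_mul N_unit.
  by rewrite andbT RmxE unitmxZ ?unitfE// unitmx_inv N_unit// ltW.
by rewrite -{1}[lam q]mulr1 -mulrBr mulr_ge0 ?subr_ge0// ltW.
Qed.

Let comm_inv n' (A B : 'M[R]_n') :
  A \in unitmx -> A *m B = B *m A -> invmx A *m B = B *m invmx A.
Proof.
move=> uA AB; rewrite -[RHS](mulKmx uA) [X in _ = _ *m X]mulmxA AB.
by rewrite -[X in _ = _ *m X]mulmxA mulmxV// mulmx1.
Qed.

(** Applying R to N(0) y = (1 - lam) 1 gives (1 - lam) R 1 = lam (I - R) y. *)
Let Rmx_sum_ones : Rmx q *m invmx (1%:M - Rmx q) *m one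
  = (lam q / (1 - lam q)) *: y.
Proof.
have l1 : 1 - lam q != 0 by rewrite subr_eq0 gt_eqF.
have uR : 1%:M - Rmx q \in unitmx by rewrite -[Rmx q]scale1r subR_unit.
have uRR : Rmx q \in unitmx.
  by rewrite RmxE unitmxZ ?unitfE ?gt_eqF// unitmx_inv N_unit// ltW.
rewrite -comm_inv//; last by rewrite mulmxBl mulmxBr mul1mx mulmx1.
rewrite -[RHS](mulKmx uR) -!mulmxA; congr (_ *m _).
have -> : one = (1 - lam q)^-1 *: (N 0 *m y).
  by rewrite Ny scale0r add0r scalerA mulVf// scale1r.
rewrite -[0](subrr (lam q)) NB -!scalemxAr mulmxA mulmxBr RN mul_mx_scalar.
have -> : (lam q)%:M - lam q *: Rmx q = lam q *: (1%:M - Rmx q).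
  by rewrite scalerBr scale_scalar_mx mulr1.
by rewrite -scalemxAl scalerA mulrC.
Qed.

(** Multiplying by I - R and by I - (1-p) R, which commute, clears both inverses and leaves a
    polynomial identity in R and R^(K+1), checked entrywise by [ring]. The resulting sum no longer
    depends on K. *)
Let pi_sum : (pi11 q + pi02 q) *m invmx (1%:M - Rmx q) + pi01 q
  = pi1 q *m invmx (1%:M - Rmx q).
Proof.
have uR : 1%:M - Rmx q \in unitmx by rewrite -[Rmx q]scale1r subR_unit.
have urR : 1%:M - (1 - p q) *: Rmx q \in unitmx.
  by rewrite subR_unit// gerBl ltW.
rewrite /pi11 /pi02 /pi01; move: (pi1 q) (Rmx q) uR urR => v Q uR urR.
rewrite -[X in _ + X](mulmxK uR) -mulmxDl; congr (_ *m _).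
set U := Q ^+ K q; set c := (1 - p q) ^+ K q; set a := invmx (1%:M - (1 - p q) *: Q).
have QU : Q ^+ (K q).+1 = Q *m U by rewrite exprS.
have QU' : U *m Q = Q *m U by rewrite -QU exprSr.
rewrite !QU [(1 - p q) ^+ _]exprS -/c.
have aQ : a *m (1%:M - Q) = (1%:M - Q) *m a.
  apply: comm_inv => //; rewrite !(mulmxBl, mulmxBr, mul1mx, mulmx1).
  by rewrite -scalemxAl -scalemxAr !opprB addrACA [RHS]addrACA [X in _ + X]addrC.
rewrite -[_ *m a *m _]mulmxA aQ [X in _ + X]mulmxA.
rewrite -[c *: _](mulmxK urR) -/a [p q *: _]scalemxAl -!mulmxDl.
rewrite -[RHS](mulmxK urR) -/a; congr (_ *m a).
rewrite -!mulmxA -scalemxAl -!mulmxA !scalemxAr -!mulmxDr; congr (_ *m _).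
set r := 1 - p q; have pr : p q = 1 - r by rewrite /r subKr.
set Z := Q *m U.
rewrite [Q *m (_ + _)]mulmxDr -[Q *m (_ *: U)]scalemxAr -/Z.
have -> : Q *m (U *m (c *: (1%:M - r *: Q))) = c *: Z - (c * r) *: (Z *m Q).
  by rewrite mulmxA -scalemxAr mulmxBr mulmx1 -scalemxAr scalerBr scalerA.
have -> : Q *m (p q *: (1%:M - c *: U)) = p q *: Q - (p q * c) *: Z.
  by rewrite -scalemxAr mulmxBr mulmx1 -scalemxAr scalerBr scalerA.
have -> : (1%:M - (r * c) *: Z) *m (1%:M - Q)
    = 1%:M - (r * c) *: Z - Q + (r * c) *: (Z *m Q).
  by rewrite mulmxBr mulmx1 mulmxBl mul1mx -scalemxAl opprB addrA addrAC.
rewrite pr; move: Z (Z *m Q) => Z ZQ.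
by apply/matrixP => i j; rewrite !mxE; ring.
Qed.

(** Pairing with the stacked identity matrix contracts the two tensor factors: only the diagonal
    indices k = l survive. *)
Let tens_row_vec_cols (u v : 'rV[R]_n) :
  u *t v *m xi q = v *m u^T :> 'M[R]_1.
Proof.
apply/matrixP => i j; rewrite !mxE.
rewrite (reindex (fun kl => @mxtens_index n n kl))/=; last first.
  exists (@mxtens_unindex n n) => k _; [exact: mxtens_indexK|exact: mxtens_unindexK].
transitivity (\sum_(kl : 'I_n * 'I_n) u ord0 kl.1 * v ord0 kl.2 * (kl.2 == kl.1)%:R).
  apply: eq_bigr => -[k l] _; rewrite !mxE !mxtens_indexK/=.
  by congr (u _ _ * v _ _ * _); exact: ord1.
rewrite -(pair_bigA _ (fun k l => u ord0 k * v ord0 l * (l == k)%:R))/=.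
apply: eq_bigr => k _; rewrite (bigD1 k)//= eqxx mulr1 big1 ?addr0.
  by rewrite mxE !ord1 mulrC.
by move=> l /negbTE ->; rewrite mulr0.
Qed.

(** At t = 0 all exponentials are identities and the terms containing R^{-1} cancel. What remains is
    pi_1 (I - R)^{-1} 1 = lam alpha y = lam. *)
Lemma W1_formula_0 : W1_formula q 0 = lam q.
Proof.
have l1 : 1 - lam q != 0 by rewrite subr_eq0 gt_eqF.
rewrite /W1_formula !expmx0 !mulmx1.
have -> : nu1 q *m xi q = (pi11 q + pi02 q) *m invmx (1%:M - Rmx q) *m one
    + pi11 q *m invmx (Rmx q) *m one + pi02 q *m invmx (Rmx q) *m ones_p q.
  rewrite /nu1 mulmxDl !tens_row_vec_cols mulmxDl trmx_const.
  have -> : ((p q)^-1 *: row_mx (ones : 'rV[R]_(n1 q)) (0 : 'rV[R]_(n2 q)))^T = ones_p q.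
    rewrite linearZ/= tr_row_mx trmx0 trmx_const /ones_p scale_col_mx scaler0.
    by congr col_mx; apply/matrixP => i j; rewrite !mxE mulr1.
  by [].
rewrite addrAC addrK mulmxBl addrA addrAC.
rewrite addrK -mulmxDl pi_sum.
rewrite /pi1 -!scalemxAl -!mulmxA [Rmx q *m (_ *m _)]mulmxA Rmx_sum_ones.
rewrite -scalemxAr alpha_y scale_scalar_mx mulr1 scale_scalar_mx mxE eqxx mulr1n.
by rewrite mulrC divfK.
Qed.

End waiting_time_formula.

(** * Convolution of a matrix-exponential tail with a phase-type density *)

Section convolution.
Context {R : realType} {m n : nat} (alpha : 'rV[R]_n) (S : 'M[R]_n).
Hypothesis ph : is_phase_type alpha S.

Definition conv_term (v : 'rV[R]_m) (M : 'M[R]_m) (xi : 'cV[R]_m) (t s : R) : R :=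
  (- (v *m expmx ((t - s) *: M) *m
      (xi *m (alpha *m expmx (s *: S) *m ones)
       + row_mx 1%:M 0 *m expmx (s *: block_mx M (M *m xi *m alpha) 0 S)
         *m col_mx 0 ones)) : 'M[R]_1) ord0 ord0.

Lemma is_derive_conv_term v M xi (t s : R) :
  is_derive s 1 (conv_term v M xi t)
    ((v *m expmx ((t - s) *: M) *m xi : 'M[R]_1) ord0 ord0 * pht_pdf alpha S s).
Proof.
rewrite /pht_pdf -mulmx11.
exact: (@mx_derive_convolution R m n v M xi alpha S t s ord0 ord0).
Qed.

(** At s = t the factor e^{(t-s)M} is the identity; at s = 0 the block exponential is, and its upper
    right block contributes nothing. *)
Lemma conv_term_ends v M xi t :
  conv_term v M xi t t - conv_term v M xi t 0 =
    (v *m expmx (t *: M) *m xi : 'M[R]_1) ord0 ord0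
    - (v *m xi : 'M[R]_1) ord0 ord0 * pht_ccdf alpha S t
    - (row_mx v 0 *m expmx (t *: block_mx M (M *m xi *m alpha) 0 S)
       *m col_mx 0 ones : 'M[R]_1) ord0 ord0.
Proof.
have G0 : alpha *m expmx (0 *: S) *m ones = 1%:M :> 'M[R]_1.
  by apply/matrixP => i j; rewrite !ord1 [RHS]mxE eqxx; exact: (pht_ccdf_0 ph).
pose A := block_mx M (M *m xi *m alpha) 0 S.
pose c : 'cV[R]_(m + n) := col_mx 0 ones.
pose g : 'M[R]_1 := alpha *m expmx (t *: S) *m ones.
have Ht : conv_term v M xi t t = - ((v *m xi) ord0 ord0 * g ord0 ord0
    + (row_mx v 0 *m expmx (t *: A) *m c) ord0 ord0).
  rewrite /conv_term [t - t]subrr [expmx (0 *: M)]expmx0 mulmx1 -/A -/c -/g.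
  rewrite mulmxDr !mulmxA mul_mx_row mulmx1 mulmx0 -[in RHS]mulmx11.
  by rewrite [LHS]mxE [X in - X = _]mxE /g !mulmxA.
have H0 : conv_term v M xi t 0 = - (v *m expmx (t *: M) *m xi) ord0 ord0.
  rewrite /conv_term [t - 0]subr0 G0 mulmx1 -/A -/c [expmx (0 *: A)]expmx0 mulmx1.
  by rewrite /c mul_row_col mul1mx mul0mx !addr0 [LHS]mxE.
by rewrite Ht H0 opprK opprD addrC addrA.
Qed.

End convolution.

Section waiting_convolution.
Context {R : realType} (q : params R).
Hypothesis ph1 : is_phase_type (alpha1 q) (S1 q).

(** The three summands of the waiting-time formula all have the form v e^{Mr} xi, with (M, xi) equal
    to ([Mmx], [xi]), ([Smx], 1) and ([Smx], [ones_p]), so one antiderivative scheme serves each of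
    them. *)
Lemma W1_convolution : exists Phi : R -> R -> R, forall t : R,
  (forall s : R, is_derive s 1 (Phi t)
     (W1_formula q (t - s) * pht_pdf (alpha1 q) (S1 q) s)) /\
  Phi t t - Phi t 0 = W1_formula q t - W1_formula q 0 * pht_ccdf (alpha1 q) (S1 q) t
    - corner (nu1 q) (A1 q) t
    - corner (pi01 q - pi11 q *m invmx (Rmx q)) (A2 q) t
    + corner (pi02 q *m invmx (Rmx q)) (A3 q) t.
Proof.
pose T1 := conv_term (alpha1 q) (S1 q) (nu1 q) (Mmx q) (xi q).
pose T2 := conv_term (alpha1 q) (S1 q) (pi01 q - pi11 q *m invmx (Rmx q))
  (Smx q) ones.
pose T3 := conv_term (alpha1 q) (S1 q) (pi02 q *m invmx (Rmx q)) (Smx q) (ones_p q).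
exists (fun t => T1 t + T2 t - T3 t) => t; split => [s|].
  refine (is_derive_eq (is_deriveB (is_deriveD (is_derive_conv_term _ _ _ _ _ t s)
    (is_derive_conv_term _ _ _ _ _ t s)) (is_derive_conv_term _ _ _ _ _ t s)) _).
  rewrite -mulrDl -mulrBl; congr (_ * _).
  by rewrite /W1_formula [in RHS]mxE [X in _ = X + _]mxE [X in _ = _ + X]mxE.
transitivity ((T1 t t - T1 t 0) + (T2 t t - T2 t 0) - (T3 t t - T3 t 0)).
  rewrite -[LHS]/((T1 t t + T2 t t - T3 t t) - (T1 t 0 + T2 t 0 - T3 t 0)).
  move: (T1 t t) (T1 t 0) (T2 t t) (T2 t 0) (T3 t t) (T3 t 0) => a b c d e f.
  ring.
have WE x : W1_formula q x = (nu1 q *m expmx (x *: Mmx q) *m xi q : 'M[R]_1) ord0 ord0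
    + ((pi01 q - pi11 q *m invmx (Rmx q)) *m expmx (x *: Smx q) *m ones : 'M[R]_1) ord0 ord0
    - (pi02 q *m invmx (Rmx q) *m expmx (x *: Smx q) *m ones_p q : 'M[R]_1) ord0 ord0.
  by rewrite /W1_formula [in LHS]mxE [X in X + _ = _]mxE [X in _ + X = _]mxE.
pose G := pht_ccdf (alpha1 q) (S1 q) t.
have E1 : T1 t t - T1 t 0 = (nu1 q *m expmx (t *: Mmx q) *m xi q : 'M[R]_1) ord0 ord0
    - (nu1 q *m xi q : 'M[R]_1) ord0 ord0 * G - corner (nu1 q) (A1 q) t.
  exact: (conv_term_ends ph1 (nu1 q) (Mmx q) (xi q) t).
have E2 : T2 t t - T2 t 0 =
    ((pi01 q - pi11 q *m invmx (Rmx q)) *m expmx (t *: Smx q)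
       *m (ones : 'cV[R]_(n1 q + n2 q)) : 'M[R]_1) ord0 ord0
    - ((pi01 q - pi11 q *m invmx (Rmx q)) *m (ones : 'cV[R]_(n1 q + n2 q))
         : 'M[R]_1) ord0 ord0 * G
    - corner (pi01 q - pi11 q *m invmx (Rmx q)) (A2 q) t.
  exact: (conv_term_ends ph1 (pi01 q - pi11 q *m invmx (Rmx q)) (Smx q)
    (ones : 'cV[R]_(n1 q + n2 q)) t).
have E3 : T3 t t - T3 t 0 =
    (pi02 q *m invmx (Rmx q) *m expmx (t *: Smx q) *m ones_p q : 'M[R]_1) ord0 ord0
    - (pi02 q *m invmx (Rmx q) *m ones_p q : 'M[R]_1) ord0 ord0 * G
    - corner (pi02 q *m invmx (Rmx q)) (A3 q) t.
  exact: (conv_term_ends ph1 (pi02 q *m invmx (Rmx q)) (Smx q) (ones_p q) t).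
clearbody T1 T2 T3; rewrite E1 E2 E3 WE [W1_formula q 0]WE.
rewrite [expmx (0 *: Mmx q)]expmx0 ![expmx (0 *: Smx q)]expmx0 !mulmx1 -/G.
set x1 := corner _ _ _; set x2 := corner _ _ _.
set x3 := corner _ _ _.
set a1 := (nu1 q *m expmx _ *m _) _ _; set a2 := (nu1 q *m _) _ _.
set b1 := ((pi01 q - _) *m expmx _ *m _) _ _; set b2 := ((pi01 q - _) *m _) _ _.
set c1 := (pi02 q *m _ *m expmx _ *m _) _ _; set c2 := (pi02 q *m _ *m _) _ _.
clearbody a1 a2 b1 b2 c1 c2 x1 x2 x3 G.
ring.
Qed.

End waiting_convolution.

(** * Sample paths of the Nudge-K queue *)

Section sample_paths.
Context {R : realType} (K : nat) (a : nat -> R) (b : nat -> bool) (x : nat -> R).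
Local Notation st := (state_after K a b x).
Implicit Types (l : seq waiting_job) (h : seq (nat * R)).

Definition work l : R := \sum_(j <- l) x j.1.

Definition jobs (s : state R) : seq nat := map fst (line s) ++ map fst (started s).

Lemma serve_started u c l h : {subset h <= started (serve x u c l h)}.
Proof.
elim: l c h => [|j l IH] c h //= i ih; case: ifP => // _.
by apply: IH; rewrite inE ih orbT.
Qed.

Lemma serve_suffix u c l h :
  exists2 l1, l = l1 ++ line (serve x u c l h) &
    Defs.free (serve x u c l h) = c + work l1.
Proof.
elim: l c h => [|j l IH] c h /=; first by exists [::]; rewrite // /work big_nil addr0.
case: ifP => _; last by exists [::]; rewrite // /work big_nil addr0.
have [l1 e1 e2] := IH (c + x j.1) ((j.1, c) :: h).
by exists (j :: l1); rewrite /= -?e1// e2 /work big_cons addrA.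
Qed.

Lemma serve_free u c l h : Defs.free (serve x u c l h) <= u -> line (serve x u c l h) = [::].
Proof. by elim: l c h => [|j l IH] c h //=; case: ifP => /= [_|->//]; exact: IH. Qed.

Lemma perm_jobs_serve u c l h : perm_eq (jobs (serve x u c l h)) (map fst l ++ map fst h).
Proof.
elim: l c h => [|j l IH] c h //=; case: ifP => // _.
by rewrite (permPl (IH _ _))/= -cat1s perm_catCA.
Qed.

Lemma perm_nudge j k l : perm_eq (map fst (nudge b j k l)) (j :: map fst l).
Proof.
elim: l k => [|[i fl] l IH] [|k] //=; case: fl => //; case: (b i) => //=.
apply: (@perm_trans _ (i :: j :: map fst l)); first by rewrite perm_cons.
by rewrite -(cat1s i) -(cat1s j) perm_catCA.
Qed.

Lemma perm_join j l : perm_eq (map fst (join K b j l)) (j :: map fst l).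
Proof.
rewrite /join; case: ifP => _; last by rewrite map_rcons perm_rcons.
rewrite map_rev perm_rev (permPl (perm_nudge _ _ _)) perm_cons.
by rewrite map_rev perm_rev.
Qed.

(** Serving moves a job from one list to the other and nudging permutes the line. Since no job can
    then be recorded as started twice, the choice made by [xget] in [start_time] is unique. *)
Lemma perm_jobs n : perm_eq (jobs (st n)) (iota 0 n).
Proof.
elim: n => [//|n IH].
rewrite (_ : iota 0 n.+1 = rcons (iota 0 n) n); last by rewrite -addn1 iotaD/= cats1.
rewrite perm_sym perm_rcons perm_sym /= /arrive.
have H : perm_eq (jobs (advance x (arrival a n) (st n))) (iota 0 n).
  by rewrite (permPl (perm_jobs_serve _ _ _ _)).
case: ifP => [/serve_free e|_].
  by move: H; rewrite /jobs /advance e/= perm_cons.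
apply: (@perm_trans _ (n :: jobs (advance x (arrival a n) (st n)))).
  by rewrite -cat_cons perm_cat2r perm_join.
by rewrite perm_cons.
Qed.

Lemma started_mono m n : (m <= n)%N -> {subset started (st m) <= started (st n)}.
Proof.
move=> /subnKC <-; elim: (n - m)%N => [|k IH] i im; first by rewrite addn0.
rewrite addnS /= /arrive; case: ifP => _ /=.
  by rewrite inE; apply/orP; right; apply: serve_started; exact: IH.
by apply: serve_started; exact: IH.
Qed.

Lemma started_inj n j c d :
  (j, c) \in started (st n) -> (j, d) \in started (st n) -> c = d.
Proof.
have : uniq (map fst (started (st n))).
  have : uniq (jobs (st n)) by rewrite (perm_uniq (perm_jobs n)) iota_uniq.
  by rewrite cat_uniq => /and3P[].
elim: (started _) => //= -[i e] h IH /andP[ih /IH{}IH].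
rewrite !inE => /predU1P[[-> ->]|jc] /predU1P[[]//|jd]; last exact: IH.
  by case/negP: ih; apply/mapP; exists (i, d).
by move=> ji _; case/negP: ih; apply/mapP; exists (j, c).
Qed.

Lemma start_timeE n N c : (n, c) \in started (st N) -> start_time K a b x n = c.
Proof.
move=> nc; apply: xget_unique; first by exists N.
move=> d [M nd]; apply: (@started_inj (maxn N M) n).
  by apply: started_mono nd; exact: leq_maxr.
by apply: started_mono nc; exact: leq_maxl.
Qed.

(** Splits off the default value 0 of a job that never starts, in a form from which measurability
    can be read. *)
Lemma start_time_gtE n t : (t < start_time K a b x n) =
  `[< (exists N c, (n, c) \in started (st N) /\ t < c) \/
      (t < 0 /\ ~ exists N c, (n, c) \in started (st N)) >].
Proof.
apply/idP/asboolP => [|[[N [c [/start_timeE -> //]]]|[t0 H]]].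
  have [[N [c nc]]|H] := pselect (exists N c, (n, c) \in started (st N)).
    by rewrite (start_timeE nc) => tc; left; exists N, c.
  rewrite /start_time xgetPN; first by right.
  by move=> s [N ns]; apply: H; exists N, s.
rewrite /start_time xgetPN// => s [N ns]; apply: H; by exists N, s.
Qed.

End sample_paths.

(** * The start of a job does not depend on its own size *)

Section service_time_independence.
Context {R : realType} (K : nat) (a : nat -> R) (b : nat -> bool) (x x' : nat -> R).
Variable n : nat.
Hypothesis xx' : forall i, i != n -> x i = x' i.

(** The invariant of two runs that differ only in the size of job n: they coincide until job n
    starts, and from then on both carry the same record of its start. *)
Let same (s s' : state R) :=
  s = s' \/ exists c, (n, c) \in started s /\ (n, c) \in started s'.

Let serve_same u c l h : same (serve x u c l h) (serve x' u c l h).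
Proof.
elim: l c h => [|j l IH] c h /=; first by left.
case: ifP => _; last by left.
have [jn|/xx' <-] := eqVneq j.1 n; last exact: IH.
by right; exists c; split; apply: serve_started; rewrite jn inE eqxx.
Qed.

Let state_same N : same (state_after K a b x N) (state_after K a b x' N).
Proof.
elim: N => [|N [IH|[c [c1 c2]]]]; first by left.
- rewrite /= -IH /arrive /advance.
  set s := state_after K a b x N.
  case: (serve_same (arrival a N) (Defs.free s) (line s) (started s)) => [<-|[c [c1 c2]]].
    have [->|/xx' <-] := eqVneq N n; last by left.
    case: ifP => _; last by left.
    by right; exists (arrival a n); rewrite /= !inE !eqxx.
  right; exists c; case: ifP => _; case: ifP => _ /=; rewrite ?inE ?c1 ?c2 ?orbT//.
- right; exists c; split.
    exact: (@started_mono _ _ _ _ _ N N.+1).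
  exact: (@started_mono _ _ _ _ _ N N.+1).
Qed.

Lemma start_time_indep : start_time K a b x n = start_time K a b x' n.
Proof.
have [[N [c [c1 c2]]]|H] := pselect (exists N c,
    (n, c) \in started (state_after K a b x N) /\
    (n, c) \in started (state_after K a b x' N)).
  by rewrite (start_timeE c1) (start_timeE c2).
congr (xget _ _); apply/seteqP; split => s [N Ns]; exists N.
  by case: (state_same N) => [<-//|[c c12]]; case: H; exists N, c.
by case: (state_same N) => [->//|[c c12]]; case: H; exists N, c.
Qed.

End service_time_independence.

(** * Work conservation and the fate of a type-1 job *)

Section completion_times.
Context {R : realType} (a x : nat -> R).

(* First-come-first-served departure times. By work conservation they also
   determine the total work in the Nudge-K queue. *)
Fixpoint completion (n : nat) : R :=
  if n is m.+1 then Num.max (completion m) (arrival a m) + x m else 0.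

Hypothesis a0 : forall i, 0 <= a i.
Hypothesis x0 : forall i, 0 <= x i.

Lemma arrivalS n : arrival a n.+1 = arrival a n + a n.+1.
Proof. by rewrite /arrival big_ord_recr. Qed.

Lemma arrival_mono m n : (m <= n)%N -> arrival a m <= arrival a n.
Proof.
move=> /subnKC <-; elim: (n - m)%N => [|k IH]; first by rewrite addn0.
by rewrite addnS arrivalS (le_trans IH)// lerDl.
Qed.

Lemma completion_mono m n : (m <= n)%N -> completion m <= completion n.
Proof.
move=> /subnKC <-; elim: (n - m)%N => [|k IH]; first by rewrite addn0.
by rewrite addnS /= (le_trans IH)// ler_wpDr// le_max lexx.
Qed.

End completion_times.

Section good_paths.
Context {R : realType} (K : nat) (a : nat -> R) (b : nat -> bool) (x : nat -> R).
Local Notation st := (state_after K a b x).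
Local Notation C := (completion a x).
Hypothesis a0 : forall i, 0 <= a i.
Hypothesis x0 : forall i, 0 <= x i.
Hypothesis arrival_unbounded : forall M, exists n, M < arrival a n.
Implicit Types (l : seq waiting_job) (h : seq (nat * R)).

Lemma work_ge0 l : 0 <= work x l.
Proof. by rewrite /work sumr_ge0. Qed.

Lemma work_perm l l' : perm_eq (map fst l) (map fst l') -> work x l = work x l'.
Proof.
by move=> ll'; rewrite /work -!(big_map fst xpredT (fun i => x i)); exact: perm_big.
Qed.

Lemma work_join j l : work x (join K b j l) = work x l + x j.
Proof.
rewrite (@work_perm _ ((j, false) :: l)) ?perm_join//.
by rewrite /work big_cons addrC.
Qed.

Lemma work_cat l l' : work x (l ++ l') = work x l + work x l'.
Proof. by rewrite /work big_cat. Qed.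

Lemma advance_work u s :
  Defs.free (advance x u s) + work x (line (advance x u s)) =
  Defs.free s + work x (line s).
Proof.
rewrite /advance; have [l1 e ->] := serve_suffix x u (Defs.free s) (line s) (started s).
by rewrite [in RHS]e work_cat addrA.
Qed.

Lemma completionE n : Defs.free (st n) + work x (line (st n)) = C n.
Proof.
elim: n => [|n IH]; first by rewrite /work big_nil addr0.
rewrite /= -IH -(advance_work (arrival a n) (st n)) /arrive.
set s := advance _ _ _; have [fs|fs] /= := leP (Defs.free s) (arrival a n).
  have -> : line s = [::] by exact: serve_free fs.
  by rewrite /work !big_nil !addr0 max_r.
 rewrite max_l; first by rewrite work_join addrA.
by rewrite (le_trans (ltW fs))// lerDl work_ge0.
Qed.

Lemma workloadE u n : u < arrival a n -> (forall m, (m < n)%N -> arrival a m <= u) ->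
  workload K a b x u = Num.max 0 (C n - u).
Proof.
move=> un nu.
have -> : workload K a b x u = let s := advance x u (st n) in
    Num.max 0 (Defs.free s - u) + work x (line s).
  rewrite /workload; have -> : num_arrivals a u = n; last by [].
  apply: xget_unique => // m [um mu].
  have [/nu H|/mu H|//] := ltngtP m n; first by rewrite ltNge H in um.
  by rewrite ltNge H in un.
rewrite -completionE -(advance_work u (st n)) /=; set s := advance x u _.
have [fs|fs] := leP (Defs.free s) u.
  have -> : line s = [::] by exact: serve_free fs.
  by rewrite /work big_nil !addr0.
rewrite max_r ?subr_ge0 1?ltW// max_r; first by rewrite addrAC.
by rewrite subr_ge0 (le_trans (ltW fs))// lerDl work_ge0.
Qed.

(* sigma is the service start time of job n that the state s predicts: nobody
   passes a type-1 job, so this prediction never changes. *)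
Definition tracked (n : nat) (sigma : R) (s : state R) :=
  (n, sigma) \in started s \/
  exists l1 l2 fl, line s = l1 ++ (n, fl) :: l2 /\ Defs.free s + work x l1 = sigma.

Lemma tracked_advance n sigma u s : tracked n sigma s -> tracked n sigma (advance x u s).
Proof.
case=> [H|[l1 [l2 [fl [e <-]]]]]; first by left; exact: serve_started.
rewrite /advance e; move: (Defs.free s) (started s) => c h.
elim: l1 c h {e} => [|j l1 IH] c h /=.
  rewrite /work big_nil addr0; case: ifP => _.
    by left; apply: serve_started; rewrite inE eqxx.
  by right; exists [::], l2, fl; rewrite /work big_nil addr0.
case: ifP => _; first by rewrite /work big_cons addrA; exact: IH.
by right; exists (j :: l1), l2, fl.
Qed.

(** The lists run from the back of the queue to its head, so t holds the jobs ahead of n. An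
    arriving job stops at the type-1 job n at the latest and leaves t untouched. *)
Lemma nudge_stop n fl j k r t : b n ->
  exists r', nudge b j k (r ++ (n, fl) :: t) = r' ++ (n, fl) :: t.
Proof.
move=> bn; elim: r k => [|[i f] r IH] [|k] /=.
- by exists [:: (j, false)].
- by exists [:: (j, false)]; rewrite bn; case: fl.
- by exists ((j, false) :: (i, f) :: r).
- case: f; first by exists ((j, false) :: (i, true) :: r).
  case: (b i); first by exists ((j, false) :: (i, false) :: r).
  by have [r' ->] := IH k; exists ((i, true) :: r').
Qed.

Lemma tracked_join n sigma j l f h : b n ->
  (exists l1 l2 fl, l = l1 ++ (n, fl) :: l2 /\ f + work x l1 = sigma) ->
  tracked n sigma (State f (join K b j l) h).
Proof.
move=> bn [l1 [l2 [fl [e es]]]]; right; rewrite /= /join e.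
case: ifP => _; last first.
  by exists l1, (rcons l2 (j, false)), fl; rewrite rcons_cat.
rewrite rev_cat rev_cons cat_rcons.
have [r' ->] := nudge_stop fl j K (rev l2) (rev l1) bn.
by exists l1, (rev r'), fl; rewrite rev_cat rev_cons revK cat_rcons.
Qed.

Lemma tracked_after n sigma m k : b n -> tracked n sigma (st m) ->
  tracked n sigma (st (m + k)).
Proof.
move=> bn H; elim: k => [|k IH]; first by rewrite addn0.
rewrite addnS /= /arrive.
have := tracked_advance (arrival a (m + k)) IH.
set s := advance _ _ _; have [fs|fs] /= := leP (Defs.free s) (arrival a (m + k)).
  have e : line s = [::] by exact: serve_free fs.
  case=> [H1|[l1 [l2 [fl []]]]].
    by left; rewrite inE H1 orbT.
  by rewrite e; case: l1.
by case=> [H1|H1]; [left|exact: tracked_join].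
Qed.

(** Follow the state up to an arrival later than sigma. Were job n still in line there, the server
    would be free by sigma, and a server that is free has an empty line. *)
Lemma tracked_start n sigma m : b n -> tracked n sigma (st m) ->
  start_time K a b x n = sigma.
Proof.
move=> bn H.
have [N0 HN0] := arrival_unbounded sigma.
pose N := (maxn N0 m); have mN : (m <= N)%N by exact: leq_maxr.
have := tracked_after (N - m) bn H; rewrite subnKC// => HN.
have : (n, sigma) \in started (advance x (arrival a N) (st N)).
  have := tracked_advance (arrival a N) HN; case=> // [[l1 [l2 [fl [e es]]]]].
  have : line (advance x (arrival a N) (st N)) != [::] by rewrite e; case: l1 {e es}.
  have : sigma < arrival a N.
    by rewrite (lt_le_trans HN0)// arrival_mono// leq_maxl.
  move=> sN /eqP; case; apply: serve_free.
  by rewrite (le_trans _ (ltW sN))// -es lerDl work_ge0.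
move=> H1; apply: (@start_timeE _ _ _ _ _ _ N.+1).
by rewrite /= /arrive; case: ifP => _ //=; rewrite inE H1 orbT.
Qed.

Lemma nudge_split j k r : exists r1 r2, nudge b j k r = r1 ++ (j, false) :: r2.
Proof.
elim: r k => [|[i f] r IH] [|k] /=; [by exists [::], [::]..|by exists [::], ((i, f) :: r)|].
case: f; first by exists [::], ((i, true) :: r).
case: (b i); first by exists [::], ((i, false) :: r).
by have [r1 [r2 ->]] := IH k; exists ((i, true) :: r1), r2.
Qed.

Lemma tracked_arrive n : b n -> exists sigma, [/\ tracked n sigma (st n.+1),
  arrival a n <= sigma & sigma + x n <= C n.+1].
Proof.
move=> bn; have := completionE n.+1; rewrite [st n.+1]/= /arrive.
set s := advance _ _ _; have [fs|fs] := leP (Defs.free s) (arrival a n).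
  move=> /= <-; exists (arrival a n); split => //.
    by left; rewrite inE eqxx.
  by rewrite lerDl work_ge0.
move=> <- /=; rewrite /join bn.
have [r1 [r2 e]] := nudge_split n K (rev (line s)).
rewrite e rev_cat rev_cons cat_rcons.
exists (Defs.free s + work x (rev r2)); split.
- by right; exists (rev r2), (rev r1), false.
- by rewrite (le_trans (ltW fs))// lerDl work_ge0.
- rewrite work_cat [work x (_ :: _)]big_cons -!addrA lerD2l lerD2l lerDl.
  exact: work_ge0.
Qed.

Lemma start_time_bounds n : b n ->
  arrival a n <= start_time K a b x n /\ start_time K a b x n + x n <= C n.+1.
Proof.
by move=> bn; have [sigma [H ? ?]] := tracked_arrive bn; rewrite (tracked_start bn H).
Qed.

(** No arriving type-1 job can pass the job at the back; an empty line counts as blocked. *)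
Definition blocked l := if rev l is (i, fl) :: _ then b i || fl else true.

Lemma blocked_nudge j k r : b j ->
  if nudge b j k r is (i, fl) :: _ then b i || fl else true.
Proof.
move=> bj; case: r k => [|[i f] r] [|k] /=; rewrite ?bj//.
by case: f => //=; rewrite ?bj//; case bi: (b i) => /=; rewrite ?bj// orbT.
Qed.

(* The type-1 job n or the last type-2 job that it has passed is at the back
   of the queue and blocks job n.+1. *)
Lemma start_time_after_type1 n : b n -> b n.+1 ->
  start_time K a b x n.+1 = Num.max (C n.+1) (arrival a n.+1).
Proof.
move=> bn bn1.
have bl : blocked (line (st n.+1)).
  rewrite /= /arrive; case: ifP => //= _; rewrite /blocked /join bn revK.
  exact: blocked_nudge.
(* Service removes jobs from the head only, so the back is unchanged unless the line has become
   empty. *)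
have bl' : blocked (line (advance x (arrival a n.+1) (st n.+1))).
  have [l1 e _] := serve_suffix x (arrival a n.+1) (Defs.free (st n.+1))
    (line (st n.+1)) (started (st n.+1)).
  move: bl; rewrite e /blocked rev_cat /advance.
  by case: (rev (line (serve _ _ _ _ _))).
have := completionE n.+1; rewrite -(advance_work (arrival a n.+1) (st n.+1)).
set s := advance _ _ _ => es.
apply: (@tracked_start _ _ n.+2) => //; rewrite [st n.+2]/= /arrive -/s.
move: bl' es; rewrite -/s.
have [fs|fs] /= := leP (Defs.free s) (arrival a n.+1).
  have -> : line s = [::] by exact: serve_free fs.
  move=> _; rewrite /work big_nil addr0 => <-.
  by rewrite max_r//; left; rewrite inE eqxx.
move=> bl' es; rewrite max_l; last first.
  by rewrite -es (le_trans (ltW fs))// lerDl work_ge0.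
right; exists (line s), [::], false; split => //=; rewrite /join bn1.
move: bl'; rewrite /blocked -[in RHS](revK (line s)).
case: (rev (line s)) => [|[i fl] r].
  by case: (K).
move=> H; have -> : nudge b n.+1 K ((i, fl) :: r) = (n.+1, false) :: (i, fl) :: r.
  by case: (K) => //= k; case: fl H => //; rewrite orbF => ->.
by rewrite cats1 -rev_cons.
Qed.

End good_paths.

(** * Measurability *)

Section measurability_of_states.
Context {d : measure_display} {T : measurableType d} {R : realType}.

(** Measurability for the discrete sigma-algebra, for values such as lines of waiting jobs. It is
    used with countable types, where a construction may be conditioned on the value of f. *)
Definition discrete_measurable (C : Type) (f : T -> C) :=
  forall S : set C, measurable (f @^-1` S).

Lemma measurable_bind (C : countType) (f : T -> C) (E : C -> set T) :
  discrete_measurable f -> (forall c, measurable (E c)) ->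
  measurable [set w | E (f w) w].
Proof.
move=> mf mE.
have -> : [set w | E (f w) w] = \bigcup_n
    (if (choice.unpickle n : option C) is Some c then f @^-1` [set c] `&` E c else set0).
  apply/seteqP; split => [w Ew|w [n _]].
    by exists (choice.pickle (f w)); rewrite // choice.pickleK.
  by case: choice.unpickle => // c [<-].
by apply: bigcup_measurable => n _; case: choice.unpickle => // c; exact: measurableI.
Qed.

Lemma discrete_measurable_cst C (c : C) : discrete_measurable (fun=> c).
Proof.
move=> S; have [Sc|Sc] := pselect (S c).
  by rewrite (_ : _ @^-1` _ = setT)//; apply/seteqP; split.
by rewrite (_ : _ @^-1` _ = set0)//; apply/seteqP; split.
Qed.

Lemma discrete_measurable_comp C C' (g : C -> C') (f : T -> C) :
  discrete_measurable f -> discrete_measurable (fun w => g (f w)).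
Proof. by move=> mf S; exact: (mf (g @^-1` S)). Qed.

Lemma discrete_measurable_bind (C : countType) C' (f : T -> C) (g : C -> T -> C') :
  discrete_measurable f -> (forall c, discrete_measurable (g c)) ->
  discrete_measurable (fun w => g (f w) w).
Proof.
move=> mf mg S.
by apply: (measurable_bind (E := fun c => g c @^-1` S)) => // c; exact: mg.
Qed.

Lemma discrete_measurable_bool (P : T -> bool) :
  measurable [set w | P w] -> discrete_measurable P.
Proof.
move=> mP S.
have -> : P @^-1` S = ([set w | P w] `&` [set _ | S true]) `|`
    (~` [set w | P w] `&` [set _ | S false]).
  apply/seteqP; split => w /=; case: (P w) => //.
  - by left.
  - by right; split.
  - by case=> [[]|[]].
  - by case=> [[]|[]].
apply: measurableU; apply: measurableI => //.
- exact: (@discrete_measurable_cst _ true S).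
- exact: measurableC.
- exact: (@discrete_measurable_cst _ false S).
Qed.

Lemma discrete_measurable_funb (P : T -> bool) :
  measurable_fun setT P -> discrete_measurable P.
Proof.
move=> mP; apply: discrete_measurable_bool.
by have := mP measurableT [set true]; rewrite setTI; apply.
Qed.

Lemma measurable_fun_bind (C : countType) (f : T -> C) (g : C -> T -> R) :
  discrete_measurable f -> (forall c, measurable_fun setT (g c)) ->
  measurable_fun setT (fun w => g (f w) w).
Proof.
move=> mf mg _ Y mY; rewrite setTI.
apply: (measurable_bind (E := fun c => g c @^-1` Y)) => // c.
by have := mg c measurableT Y mY; rewrite setTI.
Qed.

(** The list of records contains real numbers and is not countably valued, so only the events that a
    given job has started later than a given time are retained; they suffice for [start_time]. *)
Record measurable_state (F : T -> state R) : Prop := {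
  ms_free : measurable_fun setT (fun w => Defs.free (F w));
  ms_line : discrete_measurable (fun w => line (F w));
  ms_started : forall n t,
    measurable [set w | exists c, (n, c) \in started (F w) /\ t < c]
}.

Lemma measurable_state_bind (C : countType) (f : T -> C) (G : C -> T -> state R) :
  discrete_measurable f -> (forall c, measurable_state (G c)) ->
  measurable_state (fun w => G (f w) w).
Proof.
move=> mf mG; split.
- apply: (measurable_fun_bind (g := fun c w => Defs.free (G c w))) => // c.
  exact: ms_free (mG c).
- apply: (discrete_measurable_bind (g := fun c w => line (G c w))) => // c.
  exact: ms_line (mG c).
- move=> n t.
  apply: (measurable_bind (E := fun c => [set w | exists e,
    (n, e) \in started (G c w) /\ t < e])) => // c.
  exact: ms_started (mG c) n t.
Qed.

Lemma measurable_state_if (P : T -> bool) (F G : T -> state R) :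
  measurable_fun setT P -> measurable_state F -> measurable_state G ->
  measurable_state (fun w => if P w then F w else G w).
Proof.
move=> /discrete_measurable_funb mP mF mG.
by apply: (measurable_state_bind (G := fun c w => if c then F w else G w)) => // -[].
Qed.

Variables (K : nat) (a : nat -> T -> R) (b : nat -> T -> bool) (x : nat -> T -> R).
Hypothesis ma : forall i, measurable_fun setT (a i).
Hypothesis mb : forall i, measurable_fun setT (b i).
Hypothesis mx : forall i, measurable_fun setT (x i).

Let measurable_started_cons n t (j : nat) (c : T -> R) (h : T -> seq (nat * R)) :
  measurable_fun setT c ->
  measurable [set w | exists e, (n, e) \in h w /\ t < e] ->
  measurable [set w | exists e, (n, e) \in (j, c w) :: h w /\ t < e].
Proof.
move=> mc mh.
have -> : [set w | exists e, (n, e) \in (j, c w) :: h w /\ t < e] =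
    ([set w | t < c w] `&` [set _ | n = j]) `|`
    [set w | exists e, (n, e) \in h w /\ t < e].
  apply/seteqP; split => w /=.
    move=> [e []]; rewrite inE => /predU1P[[-> ->] te|eh te]; first by left.
    by right; exists e.
  move=> [[te ->]|[e [eh te]]]; first by exists (c w); rewrite inE eqxx.
  by exists e; rewrite inE eh orbT.
apply: measurableU => //; apply: measurableI.
  have := measurable_fun_ltr (measurable_cst t) mc.
  by move=> /discrete_measurable_funb /(_ [set true]).
exact: (@discrete_measurable_cst _ n [set k | k = j]).
Qed.

Let measurable_state_serve (u c : T -> R) l (h : T -> seq (nat * R)) :
  measurable_fun setT u -> measurable_fun setT c ->
  (forall n t, measurable [set w | exists e, (n, e) \in h w /\ t < e]) ->
  measurable_state (fun w => serve (x ^~ w) (u w) (c w) l (h w)).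
Proof.
move=> mu; elim: l c h => [|j l IH] c h mc mh /=.
  by split => //; exact: discrete_measurable_cst.
apply: measurable_state_if; first exact: measurable_fun_ler.
  apply: (IH (fun w => c w + x j.1 w) (fun w => (j.1, c w) :: h w)).
    exact: measurable_funD.
  by move=> n t; exact: measurable_started_cons.
by split => //; exact: discrete_measurable_cst.
Qed.

Lemma measurable_state_advance (u : T -> R) F :
  measurable_fun setT u -> measurable_state F ->
  measurable_state (fun w => advance (x ^~ w) (u w) (F w)).
Proof.
move=> mu mF; rewrite /advance.
apply: (measurable_state_bind (ms_line mF) (G := fun l w =>
  serve (x ^~ w) (u w) (Defs.free (F w)) l (started (F w)))) => l.
by apply: measurable_state_serve => //; [exact: ms_free|exact: ms_started].
Qed.

Let discrete_measurable_nudge j k l : discrete_measurable (fun w => nudge (b ^~ w) j k l).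
Proof.
elim: l k => [|[i f] l IH] [|k] /=; try exact: discrete_measurable_cst.
case: f; first exact: discrete_measurable_cst.
apply: (discrete_measurable_bind (discrete_measurable_funb (mb i))
  (g := fun c w => if c then _ else (i, true) :: nudge (b ^~ w) j k l)) => -[].
  exact: discrete_measurable_cst.
exact: (discrete_measurable_comp (cons (i, true))).
Qed.

Let discrete_measurable_join j (f : T -> seq waiting_job) : discrete_measurable f ->
  discrete_measurable (fun w => join K (b ^~ w) j (f w)).
Proof.
move=> mf; apply: (discrete_measurable_bind mf (g := fun l w => join K (b ^~ w) j l)) => l.
apply: (discrete_measurable_bind (discrete_measurable_funb (mb j)) (g := fun c w =>
  if c then rev (nudge (b ^~ w) j K (rev l)) else rcons l (j, false))) => -[].
  exact: (discrete_measurable_comp rev).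
exact: discrete_measurable_cst.
Qed.

Lemma measurable_arrival n : measurable_fun setT (fun w => arrival (a ^~ w) n).
Proof. exact: measurable_sum. Qed.

Lemma measurable_state_after n :
  measurable_state (fun w => state_after K (a ^~ w) (b ^~ w) (x ^~ w) n).
Proof.
elim: n => [|n IH].
  split => //=; first exact: discrete_measurable_cst.
  move=> n t; rewrite (_ : mkset _ = set0)//; apply/seteqP; split => // w [c []].
  by rewrite in_nil.
rewrite /= /arrive.
have ms := measurable_state_advance (measurable_arrival n) IH.
apply: measurable_state_if.
- by apply: measurable_fun_ler; [exact: ms_free ms|exact: measurable_arrival].
- split => /=.
  + by apply: measurable_funD => //; exact: measurable_arrival.
  + exact: discrete_measurable_cst.
  + move=> k t; apply: measurable_started_cons; first exact: measurable_arrival.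
    exact: ms_started ms k t.
- split => /=.
  + exact: ms_free ms.
  + exact: discrete_measurable_join (ms_line ms).
  + exact: ms_started ms.
Qed.

Lemma measurable_fun_gt (f : T -> R) :
  (forall t, measurable [set w | t < f w]) -> measurable_fun setT f.
Proof.
move=> H _; apply: (measurability _ (RGenOInfty.measurableE R)) => //.
move=> /= _ [_ [t ->] <-]; rewrite setTI preimage_itvoy; exact: H.
Qed.

Lemma measurable_start_time n :
  measurable_fun setT (fun w => start_time K (a ^~ w) (b ^~ w) (x ^~ w) n).
Proof.
apply: measurable_fun_gt => t.
pose E t := \bigcup_N [set w | exists c, (n, c) \in
  started (state_after K (a ^~ w) (b ^~ w) (x ^~ w) N) /\ t < c].
have mE s : measurable (E s).
  apply: bigcup_measurable => N _; exact: ms_started (measurable_state_after N) n s.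
(* Every recorded start time exceeds some -k, so the complement of the union of the E(-k) is the
   event that job n never starts, on which the default value 0 is compared with t. *)
have -> : [set w | t < start_time K (a ^~ w) (b ^~ w) (x ^~ w) n] =
    E t `|` ([set _ | t < 0] `&` ~` \bigcup_k E (- k%:R)).
  apply/seteqP; split => w /=; rewrite start_time_gtE.
    move=> /asboolP; case=> [[N [c nc]]|[t0 H]]; first by left; exists N => //; exists c.
    right; split => //; move=> [k _ [N _ [c [nc _]]]]; apply: H.
    by exists N, c.
  move=> H; apply/asboolP; move: H.
  case=> [[N _ [c nc]]|[t0 H]]; first by left; exists N, c.
  right; split => //; move=> [N [c nc]]; apply: H.
  exists (Num.truncn `|c|).+1 => //; exists N => //; exists c; split => //.
  by rewrite ltrNl (le_lt_trans (ler_norm _))// normrN; exact: truncnS_gt.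
apply: measurableU => //; apply: measurableI.
  exact: (@discrete_measurable_cst _ t [set k | k < 0]).
by apply: measurableC; apply: bigcup_measurable.
Qed.

Lemma discrete_measurable_num_arrivals u :
  discrete_measurable (fun w => num_arrivals (a ^~ w) u).
Proof.
pose A n := [set w | u < arrival (a ^~ w) n /\
  forall m, (m < n)%N -> arrival (a ^~ w) m <= u].
have mA n : measurable (A n).
  have -> : A n = [set w | u < arrival (a ^~ w) n] `&`
      \bigcap_m (if (m < n)%N then [set w | arrival (a ^~ w) m <= u] else setT).
    apply/seteqP; split => w /= [H1 H2]; split => //.
      by move=> m _; case: ifPn => // mn; exact: H2.
    by move=> m mn; have := H2 m Logic.I; rewrite mn.
  apply: measurableI.
    have := measurable_fun_ltr (measurable_cst u) (measurable_arrival n).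
    by move=> /discrete_measurable_funb /(_ [set true]).
  apply: bigcap_measurable => // m _; case: ifPn => // _.
  have := measurable_fun_ler (measurable_arrival m) (measurable_cst u).
  by move=> /discrete_measurable_funb /(_ [set true]).
have uA w m n : A m w -> A n w -> m = n.
  move=> [um mu] [un nu]; have [/nu H|/mu H|//] := ltngtP m n.
    by rewrite ltNge H in um.
  by rewrite ltNge H in un.
move=> S.
(* Outside the union of the A m no index qualifies and the default value 0 is taken. *)
have -> : (fun w => num_arrivals (a ^~ w) u) @^-1` S =
    \bigcup_(n in S) (A n `|` ([set _ | n = 0%N] `&` ~` \bigcup_m A m)).
  have numE w n : A n w -> num_arrivals (a ^~ w) u = n.
    by move=> An; apply: xget_unique => // m Am; exact: uA Am An.
  have num0 w : ~ (\bigcup_m A m) w -> num_arrivals (a ^~ w) u = 0%N.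
    by move=> H; apply: xgetPN => n An; apply: H; exists n.
  apply/seteqP; split => w /=.
    move=> Sw; have [[m _ Am]|H] := pselect ((\bigcup_m A m) w).
      by exists m; [rewrite -(numE _ _ Am)|left].
    by exists 0%N; [rewrite -(num0 _ H)|right].
  by move=> [n Sn [/numE ->//|[n0 /num0 ->]]]; rewrite -n0.
apply: bigcup_measurable => n _; apply: measurableU => //; apply: measurableI.
  exact: (@discrete_measurable_cst _ n [set k | k = 0%N]).
by apply: measurableC; exact: bigcup_measurable.
Qed.

Lemma measurable_workload u :
  measurable_fun setT (fun w => workload K (a ^~ w) (b ^~ w) (x ^~ w) u).
Proof.
rewrite /workload.
apply: (measurable_fun_bind (discrete_measurable_num_arrivals u) (g := fun n w =>
  let s := advance (x ^~ w) u (state_after K (a ^~ w) (b ^~ w) (x ^~ w) n) in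
  Num.max 0 (Defs.free s - u) + \sum_(j <- line s) x j.1 w)) => n /=.
have ms := measurable_state_advance (measurable_cst u) (measurable_state_after n).
apply: measurable_funD.
  apply: measurable_maxr => //; apply: measurable_funB => //; exact: ms_free ms.
apply: (measurable_fun_bind (ms_line ms) (g := fun l w => \sum_(j <- l) x j.1 w)) => l.
by apply: measurable_sum => i.
Qed.

End measurability_of_states.

(** * Independence *)

Section independence.
Context {d : measure_display} {T : measurableType d} {R : realType}
  (P : probability T R) {I : choiceType} (F : I -> set (set T)).
Hypothesis indep : mutually_independent P F.
Hypothesis F_measurable : forall i E, F i E -> measurable E.
Hypothesis F_setT : forall i, F i setT.
Hypothesis F_setI : forall i, setI_closed (F i).

(** The pi-system generating the joint history of the sources indexed by D. *)
Definition cylinders (D : set I) : set (set T) :=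
  [set S | exists (J : {fset I}) (E : I -> set T),
    [/\ forall i, i \in J -> D i, forall i, F i (E i) &
        S = \bigcap_(i in [set` J]) E i]].

Lemma sub_cylinders D i E : D i -> F i E -> cylinders D E.
Proof.
move=> Di FE; exists [fset i]%fset, (fun j => if j == i then E else setT); split.
- by move=> j; rewrite inE => /eqP ->.
- by move=> j; case: eqP => [->|].
- apply/seteqP; split => w /=.
    by move=> Ew j /=; rewrite inE => /eqP ->; rewrite eqxx.
  by move=> /(_ i); rewrite /= inE eqxx; apply.
Qed.

Lemma cylinders_setI D : setI_closed (cylinders D).
Proof.
move=> _ _ [J1 [E1 [D1 F1 ->]]] [J2 [E2 [D2 F2 ->]]].
exists (J1 `|` J2)%fset, (fun i => (if i \in J1 then E1 i else setT) `&`
  (if i \in J2 then E2 i else setT)); split.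
- by move=> i; rewrite inE => /orP[/D1|/D2].
- by move=> i; apply: F_setI; case: ifP.
- apply/seteqP; split => w /=.
    move=> [H1 H2] i /=; rewrite inE => _; split; case: ifP => //; [exact: H1|exact: H2].
  move=> H; split => i iJ; have := H i; rewrite /= inE iJ ?orbT => /(_ isT) [];
    by [].
Qed.

Lemma cylinders_measurable D : cylinders D `<=` measurable.
Proof.
move=> _ [J [E [_ FE ->]]]; apply: fin_bigcap_measurable => // i _.
exact: F_measurable (FE i).
Qed.

(** Pi-lambda argument: the events S for which the product formula holds form a lambda-system
    containing the cylinders over D. *)
Lemma independent_events (D : set I) (S : set T) (J : {fset I}) (E : I -> set T) :
  <<s cylinders D >> S -> (forall i, i \in J -> ~ D i) ->
  (forall i, i \in J -> F i (E i)) ->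
  (P (S `&` \bigcap_(i in [set` J]) E i) = P S * \prod_(i <- J) P (E i))%E.
Proof.
move=> GS JD FE.
pose c : \bar R := (\prod_(i <- J) P (E i))%E.
have PE : P (\bigcap_(i in [set` J]) E i) = c by exact: indep.
set EJ := \bigcap_(i in _) _ in PE *.
have mEJ : measurable EJ.
  by apply: fin_bigcap_measurable => // i /= iJ; exact: F_measurable (FE i iJ).
have cfin : c \is a fin_num by rewrite -PE fin_num_measure.
pose H := [set S | measurable S /\ (P (S `&` EJ) = P S * c)%E].
suff : <<s cylinders D >> `<=` H by move=> /(_ S GS) [].
apply: lambda_system_subset => //.
- exact: cylinders_setI.
- split => //.
  + by split => //; rewrite setTI PE probability_setT mul1e.
  + move=> X Y YX [mX eX] [mY eY]; split; first exact: measurableD.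
    have finP S' : measurable S' -> (P S' < +oo)%E.
      by move=> mS'; rewrite (le_lt_trans (probability_le1 _ _)) ?ltry.
    have mXE : measurable (X `&` EJ) by exact: measurableI.
    rewrite setIDAC setIDA (measureD mXE mY (finP _ mXE)) (measureD mX mY (finP _ mX)).
    have XY : X `&` Y = Y by apply/setIidPr.
    rewrite setIAC XY; transitivity (P X * c - P Y * c)%E; first by congr (_ - _)%E.
    rewrite muleBl// ?fin_num_measure//.
    by rewrite fin_num_adde_defl// fin_numN fin_num_measure.
  + move=> X ndX HX; split; first by apply: bigcup_measurable => k _; case: (HX k).
    have mX k : measurable (X k) by case: (HX k).
    have c1 : (P (X k) * c)%E @[k --> \oo] --> (P (\bigcup_k X k) * c)%E.
      apply: cvgeZr => //; apply: nondecreasing_cvg_mu => //.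
      exact: bigcup_measurable.
    have c2 : P (X k `&` EJ) @[k --> \oo] --> P (\bigcup_k X k `&` EJ).
      rewrite setI_bigcupl; apply: nondecreasing_cvg_mu.
      * by move=> k; exact: measurableI.
      * by apply: bigcup_measurable => k _; exact: measurableI.
      * move=> m n mn; apply/subsetPset; have Hs : X m `<=` X n by apply/subsetPset; exact: ndX.
        exact: setSI.
    have e : (fun k => P (X k `&` EJ)) = (fun k => P (X k) * c)%E.
      by apply/funext => k; case: (HX k).
    have l1 := cvg_lim (@ereal_hausdorff R) c1.
    move: c2; rewrite /comp e => /(cvg_lim (@ereal_hausdorff R)) <-.
    by rewrite -l1.
- move=> S' cS'; have mS' := cylinders_measurable cS'.
  move: cS' mS' => [J' [E' [D' F' ->]]] mS'; split => //.
  have dJ i : i \in J' -> i \notin J.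
    by move=> iJ'; apply/negP => /JD; apply; exact: D'.
  (* J' and J are disjoint, so the two families merge into one indexed by their union, to which
     mutual independence applies. *)
  pose E2 i := if i \in J' then E' i else E i.
  have FE2 i : i \in (J' `|` J)%fset -> F i (E2 i).
    by rewrite inE /E2; case: ifP => //= _ /FE.
  have -> : (\bigcap_(i in [set` J']) E' i) `&` EJ = \bigcap_(i in [set` (J' `|` J)%fset]) E2 i.
    apply/seteqP; split => w /=.
      move=> [H1 H2] i /=; rewrite inE /E2; case: ifP => //= iJ'; first by move=> _; exact: H1.
      exact: H2.
    move=> H3; split => i /= iJ; have := H3 i; rewrite /= inE iJ /E2 ?iJ ?orbT => /(_ isT)//.
    by case: ifPn => // /dJ; rewrite iJ.
  rewrite indep//.
  have -> : P (\bigcap_(i in [set` J']) E' i) = (\prod_(i <- J') P (E' i))%E.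
    by apply: indep => i _; exact: F'.
  rewrite /c (perm_big ((J' : seq I) ++ J)); last first.
    apply: uniq_perm; first exact: fset_uniq.
      rewrite cat_uniq !fset_uniq andbT /=; apply/hasPn => i iJ.
      by apply/negP => /dJ; rewrite iJ.
    by move=> i; rewrite mem_cat inE.
  rewrite big_cat; congr (_ * _)%E; apply: eq_big_seq => i iJ; rewrite /E2.
    by rewrite iJ.
  by case: ifPn => // /dJ; rewrite iJ.
Qed.

End independence.

(** * Probabilities as real numbers, and comparisons up to null sets *)

Section real_probabilities.
Context {d : measure_display} {T : measurableType d} {R : realType} (P : probability T R).
Implicit Types S E N : set T.

Definition pr S : R := fine (P S).

Lemma prE S : measurable S -> P S = (pr S)%:E.
Proof. by move=> mS; rewrite /pr fineK// fin_num_measure. Qed.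

Lemma pr_ge0 S : 0 <= pr S.
Proof. exact: fine_ge0. Qed.

Lemma pr_setT : pr setT = 1.
Proof. by rewrite /pr probability_setT. Qed.

Lemma pr_le S S' : measurable S -> measurable S' -> S `<=` S' -> pr S <= pr S'.
Proof. by move=> mS mS' SS'; rewrite -lee_fin -!prE// le_measure ?inE. Qed.

Lemma pr_le1 S : measurable S -> pr S <= 1.
Proof. by move=> mS; rewrite -pr_setT pr_le. Qed.

Lemma prU S S' : measurable S -> measurable S' -> S `&` S' = set0 ->
  pr (S `|` S') = pr S + pr S'.
Proof.
move=> mS mS' SS'; apply: EFin_inj; rewrite EFinD -!prE//; last exact: measurableU.
by rewrite measureU.
Qed.

Lemma prIC S E : measurable S -> measurable E ->
  pr S = pr (S `&` E) + pr (S `&` ~` E).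
Proof.
move=> mS mE; rewrite -prU.
- by rewrite -setIUr setUv setIT.
- exact: measurableI.
- by apply: measurableI => //; exact: measurableC.
- by rewrite setIACA setICr setI0.
Qed.

Lemma prU_le S S' : measurable S -> measurable S' -> pr (S `|` S') <= pr S + pr S'.
Proof.
move=> mS mS'; rewrite (@prIC (S `|` S') S)//; last exact: measurableU.
have mU := measurableU _ _ mS mS'; have mC := measurableC mS.
by apply: lerD; apply: pr_le => //; try exact: measurableI; move=> w [] // [].
Qed.

Lemma prC S : measurable S -> pr (~` S) = 1 - pr S.
Proof.
by move=> mS; rewrite -pr_setT (prIC measurableT mS) !setTI addrAC subrr add0r.
Qed.

Lemma pr_le_ae N S S' : measurable N -> pr N = 0 -> measurable S -> measurable S' ->
  (forall w, ~ N w -> S w -> S' w) -> pr S <= pr S'.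
Proof.
move=> mN N0 mS mS' SS'; have : pr S <= pr (S' `|` N).
  apply: pr_le => //; first exact: measurableU.
  by move=> w Sw; have [|nN] := pselect (N w); [right|left; exact: SS'].
by move=> /le_trans; apply; rewrite (le_trans (prU_le _ _))// N0 addr0.
Qed.

Lemma pr_eq_ae N S S' : measurable N -> pr N = 0 -> measurable S -> measurable S' ->
  (forall w, ~ N w -> S w <-> S' w) -> pr S = pr S'.
Proof.
move=> mN N0 mS mS' SS'; apply/eqP; rewrite eq_le.
by apply/andP; split; apply: (pr_le_ae mN N0) => // w /SS' [].
Qed.

Lemma measurable_ex_lt (E : nat -> set T) n : (forall i, measurable (E i)) ->
  measurable [set w | exists2 i, (i < n)%N & E i w].
Proof.
move=> mE; rewrite (_ : mkset _ = \bigcup_(i in [set i | (i < n)%N]) E i).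
  exact: bigcup_measurable.
by apply/seteqP; split => w [i ni Ei]; exists i.
Qed.

Lemma pr_ex_lt_le (E : nat -> set T) n : (forall i, measurable (E i)) ->
  pr [set w | exists2 i, (i < n)%N & E i w] <= \sum_(i < n) pr (E i).
Proof.
move=> mE; elim: n => [|n IH].
  rewrite big_ord0 (_ : mkset _ = set0) ?/pr ?measure0//.
  by apply/seteqP; split => w [].
rewrite big_ord_recr/= (le_trans _ (lerD IH (lexx _)))//.
apply: le_trans (prU_le (measurable_ex_lt n mE) (mE n)).
apply: pr_le; [exact: measurable_ex_lt|apply: measurableU => //; exact: measurable_ex_lt|].
by move=> w [i]; rewrite ltnS leq_eqVlt => /predU1P[->|]; [right|left; exists i].
Qed.

Lemma sum_pr_le (E : nat -> set T) n S : (forall i, measurable (E i)) -> measurable S ->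
  (forall i, (i < n)%N -> E i `<=` S) ->
  (forall i j w, (i < j)%N -> (j < n)%N -> E i w -> E j w -> False) ->
  \sum_(i < n) pr (E i) <= pr S.
Proof.
move=> mE mS ES dE.
suff -> : \sum_(i < n) pr (E i) = pr [set w | exists2 i, (i < n)%N & E i w].
  by apply: pr_le => //; [exact: measurable_ex_lt|move=> w [i /ES]; exact].
elim: n ES dE => [|n IH] ES dE.
  rewrite big_ord0 (_ : mkset _ = set0) ?/pr ?measure0//.
  by apply/seteqP; split => w [].
rewrite big_ord_recr/= IH; last 2 first.
  by move=> i ni; apply: ES; exact: ltnW.
  by move=> i j w ij jn; apply: dE => //; exact: ltnW.
rewrite -prU//; last 2 first.
  exact: measurable_ex_lt.
  by apply/seteqP; split => // w [[i ni Ei] En]; exact: (dE i n w).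
congr pr; apply/seteqP; split => w.
  by move=> [[i ni Ei]|En]; [exists i => //; exact: ltnW|exists n].
by move=> [i]; rewrite ltnS leq_eqVlt => /predU1P[->|]; [right|left; exists i].
Qed.

Lemma pr_bigcup0 (E : nat -> set T) : (forall i, measurable (E i)) ->
  (forall i, pr (E i) = 0) -> pr (\bigcup_i E i) = 0.
Proof.
move=> mE E0; have mU : measurable (\bigcup_i E i) by exact: bigcup_measurable.
have : P.-negligible (\bigcup_i E i).
  by apply: negligible_bigcup => k; apply/(negligibleP _ (mE k));
     exact: etrans (prE (mE k)) (congr1 _ (E0 k)).
by move/(negligibleP P mU); rewrite /pr => ->.
Qed.

Lemma pr0_le S e : measurable S -> (forall n, pr S <= e n) -> e @ \oo --> 0 -> pr S = 0.
Proof.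
move=> mS Se e0; apply/eqP; rewrite eq_le pr_ge0 andbT.
rewrite -(cvg_lim (@Rhausdorff R) e0); apply: limr_ge; first by apply/cvg_ex; exists 0.
by apply: nearW => n; exact: Se.
Qed.

End real_probabilities.

(** * The stochastic model *)

Section model_facts.
Context {d : measure_display} {T : measurableType d} {R : realType}
  (P : probability T R) (q : params R).
Context (A : nat -> {RV P >-> R}) (B : nat -> {RV P >-> bool})
  (X : nat -> {RV P >-> R}).
Hypothesis lam_gt0 : 0 < lam q.
Hypothesis p_gt0 : 0 < p q.
Hypothesis p_lt1 : p q < 1.
Hypothesis ph1 : is_phase_type (alpha1 q) (S1 q).
Hypothesis ph2 : is_phase_type (alpha2 q) (S2 q).
Hypothesis model : is_model q A B X.
Local Notation pr := (pr P).

Definition source (k : nat + nat) : set (set T) :=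
  match k with
  | inl n => preimages (A n)
  | inr n => preimages (fun w => (B n w, X n w))
  end.

Let measurable_A n : measurable_fun setT (A n). Proof. exact: measurable_funP. Qed.
Let measurable_B n : measurable_fun setT (B n). Proof. exact: measurable_funP. Qed.
Let measurable_X n : measurable_fun setT (X n). Proof. exact: measurable_funP. Qed.

Let measurable_BX n : measurable_fun setT (fun w => (B n w, X n w)).
Proof. exact: measurable_fun_pair. Qed.

Lemma source_measurable k E : source k E -> measurable E.
Proof.
case: k => n [Y mY <-].
  by have := measurable_A n measurableT mY; rewrite setTI.
by have := measurable_BX n measurableT mY; rewrite setTI.
Qed.

Lemma source_setT k : source k setT.
Proof. by case: k => n; exists setT. Qed.

Lemma source_setI k : setI_closed (source k).
Proof.
by case: k => n _ _ [Y mY <-] [Z mZ <-]; exists (Y `&` Z) => //; exact: measurableI.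
Qed.

Local Notation history D := (g_sigma_algebraType (cylinders source D)).

Lemma history_measurable D S : (measurable : set (set (history D))) S -> measurable (S : set T).
Proof.
apply: smallest_sub; first exact: sigma_algebra_measurable.
by apply: cylinders_measurable; exact: source_measurable.
Qed.

Lemma A_history (D : set (nat + nat)) i : D (inl i) ->
  measurable_fun setT (A i : history D -> R).
Proof.
move=> Di _ Y mY; rewrite setTI; apply: sub_sigma_algebra.
apply: (sub_cylinders (source_setT) Di); by exists Y.
Qed.

Let BX_history (D : set (nat + nat)) i Y : D (inr i) -> measurable Y ->
  (measurable : set (set (history D))) ((fun w => (B i w, X i w)) @^-1` Y).
Proof.
move=> Di mY; apply: sub_sigma_algebra.
apply: (sub_cylinders (source_setT) Di); by exists Y.
Qed.

Lemma B_history (D : set (nat + nat)) i : D (inr i) ->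
  measurable_fun setT (B i : history D -> bool).
Proof.
move=> Di _ Y mY; rewrite setTI.
have := BX_history Di (measurable_fst measurableT _ mY).
by rewrite setTI.
Qed.

Lemma X_history (D : set (nat + nat)) i : D (inr i) ->
  measurable_fun setT (X i : history D -> R).
Proof.
move=> Di _ Y mY; rewrite setTI.
have := BX_history Di (measurable_snd measurableT _ mY).
by rewrite setTI.
Qed.

Lemma pr_indep D k S E : (measurable : set (set (history D))) S -> ~ D k -> source k E ->
  pr (S `&` E) = pr S * pr E.
Proof.
move=> mS Dk kE.
have mS' := history_measurable mS; have mE := source_measurable kE.
have := @independent_events _ _ _ P _ source (model_indep model) source_measurable
  source_setT source_setI D S [fset k]%fset (fun j => if j == k then E else setT) mS.
rewrite big_seq_fset1 eqxx.
have -> : \bigcap_(i in [set` [fset k]%fset]) (if i == k then E else [set: T]) = E.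
  apply/seteqP; split => w /=; first by move=> /(_ k); rewrite /= inE eqxx; apply.
  by move=> Ew i /=; rewrite inE => /eqP ->; rewrite eqxx.
move=> H; apply: EFin_inj; rewrite EFinM -!prE//; last exact: measurableI.
apply: H => i; rewrite inE => /eqP -> //.
by rewrite eqxx.
Qed.

(* The first r sources of randomness in the order
   A_0, (B_0, X_0), A_1, (B_1, X_1), ... *)
Definition past (r : nat) : set (nat + nat) :=
  [set k | match k with inl i => (i.*2 < r)%N | inr i => (i.*2.+1 < r)%N end].

Lemma past_history r r' S : (r <= r')%N -> (measurable : set (set (history (past r)))) S ->
  (measurable : set (set (history (past r')))) S.
Proof.
move=> rr'; apply: sub_sigma_algebra2 => _ [J [E [D' FE ->]]].
exists J, E; split => // i /D'.
by case: i => i /= /leq_trans; apply.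
Qed.

Lemma measurable_lt_set d' (T' : measurableType d') (f g : T' -> R) :
  measurable_fun setT f -> measurable_fun setT g -> measurable [set w | f w < g w].
Proof.
by move=> mf mg; have := discrete_measurable_funb (measurable_fun_ltr mf mg) [set true].
Qed.

Lemma measurable_le_set d' (T' : measurableType d') (f g : T' -> R) :
  measurable_fun setT f -> measurable_fun setT g -> measurable [set w | f w <= g w].
Proof.
by move=> mf mg; have := discrete_measurable_funb (measurable_fun_ler mf mg) [set true].
Qed.

Let pr_A_itv n t : 0 < t -> pr (A n @^-1` `[0, t]) = 1 - expR (- lam q * t).
Proof.
move=> t0; rewrite /pr (model_interarrival model)//.
by rewrite exponential_prob_itv0c// -EFinB.
Qed.

Let cvg_expRN : (fun n => expR (- lam q) ^+ n) @ \oo --> 0.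
Proof.
apply: cvg_expr; rewrite ger0_norm ?expR_ge0// -expR0 ltr_expR.
by rewrite oppr_lt0.
Qed.

(** The exponential law gives [0, k] mass 1 - e^{-lam k}, and the negative values lie in the
    complement for every k. *)
Lemma pr_A_lt0 n : pr [set w | A n w < 0] = 0.
Proof.
have mA0 : measurable [set w | A n w < 0] by exact: measurable_lt_set.
apply: (pr0_le mA0 (e := fun k => expR (- lam q) ^+ k.+1)); last first.
  by have := cvg_expRN; rewrite -(cvg_shiftS (fun n => expR (- lam q) ^+ n)).
move=> k; have mI : measurable (A n @^-1` `[0, k.+1%:R]).
  by have := measurable_A n measurableT (measurable_itv `[0, k.+1%:R]); rewrite setTI.
have := pr_A_itv n (ltr0Sn R k); rewrite mulrC expRM_natl => H.
rewrite -[leRHS](subKr 1) -H -prC//; apply: pr_le => //; first exact: measurableC.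
by move=> w /= Aw; rewrite in_itv/= leNgt Aw.
Qed.

Lemma pr_A_le n t : 0 < t -> pr [set w | A n w <= t] = 1 - expR (- lam q * t).
Proof.
move=> t0; rewrite -(pr_A_itv n)//.
have mI : measurable (A n @^-1` `[0, t]).
  by have := measurable_A n measurableT (measurable_itv `[0, t]); rewrite setTI.
apply: (pr_eq_ae _ (pr_A_lt0 n)) => //; [exact: measurable_lt_set|exact: measurable_le_set|].
by move=> w /negP; rewrite -leNgt => Aw; rewrite /= in_itv/= Aw.
Qed.

Lemma pr_A_gt n t : 0 < t -> pr [set w | t < A n w] = expR (- lam q * t).
Proof.
move=> t0; rewrite -[RHS](subKr 1) -(pr_A_le n t0) -prC; last exact: measurable_le_set.
by congr pr; apply/seteqP; split => w /=; rewrite ltNge => /negP.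
Qed.

Lemma pr_type1 n : pr (type1 B n) = p q.
Proof. by rewrite /pr (model_type1 model). Qed.

Lemma measurable_type1 n : measurable (type1 B n).
Proof. by have := discrete_measurable_funb (measurable_B n) [set true]. Qed.

Lemma pr_type1_size n s : 0 <= s ->
  pr (type1 B n `&` [set w | X n w > s]) = p q * pht_ccdf (alpha1 q) (S1 q) s.
Proof. by move=> s0; rewrite /pr (model_size1 model). Qed.

Let measurable_X_gt n s : measurable [set w | X n w > s].
Proof. exact: measurable_lt_set. Qed.

Lemma pr_type1_size_itv n s t : 0 <= s -> s <= t ->
  pr (type1 B n `&` [set w | s < X n w /\ X n w <= t])
  = p q * (pht_ccdf (alpha1 q) (S1 q) s - pht_ccdf (alpha1 q) (S1 q) t).
Proof.
move=> s0 st; rewrite mulrBr -!(pr_type1_size n) ?(le_trans s0)//.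
have mt1 := measurable_type1 n.
have mD : measurable (type1 B n `&` [set w | s < X n w /\ X n w <= t]).
  apply: measurableI => //.
  apply: (@measurableI _ _ [set w | s < X n w] [set w | X n w <= t]) => //.
  exact: measurable_le_set.
rewrite (@prIC _ _ _ P (type1 B n `&` [set w | s < X n w]) [set w | X n w > t])//;
  last exact: measurableI.
rewrite [X in _ = X - _]addrC.
have -> : type1 B n `&` [set w | s < X n w] `&` [set w | t < X n w] =
    type1 B n `&` [set w | t < X n w].
  apply/seteqP; split => w /=; first by move=> [[]].
  by move=> [bw tw]; split => //; split => //; exact: le_lt_trans tw.
rewrite addrK; congr pr; apply/seteqP; split => w /=.
  by move=> [bw [sw wt]]; split => //; rewrite ltNge wt.
by move=> [[bw sw] /negP]; rewrite -leNgt.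
Qed.

Lemma pr_X_le0 n : pr [set w | X n w <= 0] = 0.
Proof.
have mt1 := measurable_type1 n.
have -> : [set w | X n w <= 0] = ~` [set w | X n w > 0].
  by apply/seteqP; split => w /=; rewrite leNgt => /negP.
rewrite prC// (prIC P (measurable_X_gt n 0) mt1) setIC pr_type1_size// setIC.
have -> : pr (~` type1 B n `&` [set w | X n w > 0])
    = (1 - p q) * pht_ccdf (alpha2 q) (S2 q) 0.
  by rewrite /pr (model_size2 model).
by rewrite (pht_ccdf_0 ph1) (pht_ccdf_0 ph2) !mulr1 [p q + _]addrC subrK subrr.
Qed.

Let rho := expR (- lam q).
Let rho_lt1 : rho < 1. Proof. by rewrite -expR0 ltr_expR oppr_lt0. Qed.
Let rho_gt0 : 0 < rho. Proof. exact: expR_gt0. Qed.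

Lemma pr_A_le1 n : pr [set w | A n w <= 1] = 1 - rho.
Proof. by rewrite pr_A_le// mulr1. Qed.

Lemma pr_A_gt1 n : pr [set w | 1 < A n w] = rho.
Proof. by rewrite pr_A_gt// mulr1. Qed.

Definition negative_path : set T :=
  \bigcup_n ([set w | A n w < 0] `|` [set w | X n w <= 0]).

Let measurable_negative_path : measurable negative_path.
Proof.
apply: bigcup_measurable => n _; apply: measurableU; first exact: measurable_lt_set.
exact: measurable_le_set.
Qed.

Let pr_negative_path : pr negative_path = 0.
Proof.
have mAn n : measurable [set w | A n w < 0] by exact: measurable_lt_set.
have mXn n : measurable [set w | X n w <= 0] by exact: measurable_le_set.
apply: pr_bigcup0 => n; first exact: measurableU.
apply/eqP; rewrite eq_le pr_ge0 andbT (le_trans (prU_le _ _ _))//.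
by rewrite pr_A_lt0 pr_X_le0 addr0.
Qed.

Definition arr n (w : T) : R := arrival (A ^~ w) n.
Let psum n (w : T) : R := \sum_(i < n) A i w.

Lemma psum_history n : measurable_fun setT (psum n : history (past n.*2) -> R).
Proof.
apply: measurable_sum => i; apply: (@A_history (past n.*2)).
by rewrite /past/= ltn_double.
Qed.

Lemma arr_history n : measurable_fun setT (arr n : history (past n.*2.+1) -> R).
Proof.
apply: measurable_sum => i; apply: (@A_history (past n.*2.+1)).
by rewrite /past/= ltnS leq_double -ltnS.
Qed.

(** If the sum of n+1 interarrival times is at most M, then either the last one is at most 1 and the
    others sum to at most M, or it exceeds 1 and they sum to at most M - 1. The two cases weigh 1 -
    rho and rho, and 2^M turns the recursion into multiplication by (1 - rho) + rho/2 = 1 -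
    rho/2. *)
Lemma pr_psum_le (n M : nat) :
  pr [set w | psum n w <= M%:R] <= 2 ^+ M * (1 - rho / 2) ^+ n.
Proof.
have q0 : 0 <= 1 - rho / 2 by move: rho_lt1 rho_gt0 => ? ?; lra.
have mS k (y : R) : (measurable : set (set (history (past k.*2)))) [set w | psum k w <= y].
  by apply: measurable_le_set => //; exact: psum_history.
have mS' k y := history_measurable (mS k y).
elim: n M => [|n IH] M.
  by rewrite expr0 mulr1 (le_trans (pr_le1 _ _))// exprn_ege1// ler1n.
(* For M = 0 the induction hypothesis says nothing about the bound -1; the event is then null
   because interarrival times are almost surely nonnegative. *)
have H2 : pr [set w | psum n w <= M%:R - 1] <= 2 ^+ M / 2 * (1 - rho / 2) ^+ n.
  case: M => [|M].
    rewrite (le_trans (pr_le_ae measurable_negative_path pr_negative_path _ measurable0 _))//.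
      move=> w nw /=; rewrite sub0r leNgt => /negP; apply.
      rewrite (@lt_le_trans _ _ 0) ?ltrN10// sumr_ge0// => i _.
      by rewrite leNgt; apply/negP => Ai; apply: nw; exists i => //; left.
    by rewrite /pr measure0 mulr_ge0 ?exprn_ge0// expr0 divr_ge0.
  by rewrite exprSr mulfK// -natr1 addrK; exact: IH.
have mle1 : measurable [set w | A n w <= 1] by exact: measurable_le_set.
have mgt1 : measurable [set w | 1 < A n w] by exact: measurable_lt_set.
have pn : ~ past n.*2 (inl n) by rewrite /past/= ltnn.
have i1 : pr ([set w | psum n w <= M%:R] `&` [set w | A n w <= 1]) =
    pr [set w | psum n w <= M%:R] * (1 - rho).
  rewrite -(pr_A_le1 n); apply: (pr_indep (mS n _) pn).
  by exists `]-oo, 1]%classic => //; rewrite preimage_itvNyc.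
have i2 : pr ([set w | psum n w <= M%:R - 1] `&` [set w | 1 < A n w]) =
    pr [set w | psum n w <= M%:R - 1] * rho.
  rewrite -(pr_A_gt1 n); apply: (pr_indep (mS n _) pn).
  by exists `]1, +oo[%classic => //; rewrite preimage_itvoy.
have I1 : measurable ([set w | psum n w <= M%:R] `&` [set w | A n w <= 1]) by exact: measurableI.
have I2 : measurable ([set w | psum n w <= M%:R - 1] `&` [set w | 1 < A n w]) by exact: measurableI.
apply: (@le_trans _ _ (pr ([set w | psum n w <= M%:R] `&` [set w | A n w <= 1] `|`
   [set w | psum n w <= M%:R - 1] `&` [set w | 1 < A n w]))).
  apply: (pr_le_ae measurable_negative_path pr_negative_path) => //.
    exact: measurableU.
  move=> w nw /=; rewrite /psum big_ord_recr/= => H.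
  have An0 : 0 <= A n w by rewrite leNgt; apply/negP => Ai; apply: nw; exists n => //; left.
  by have [A1|A1] := leP (A n w) 1; [left|right]; split => //; lra.
rewrite (le_trans (prU_le _ _ _))// i1 i2.
have := IH M; set u := pr _; set v := pr _ in H2 *; set e := (1 - rho / 2) ^+ n in H2 *.
move=> Hu; rewrite exprSr -/e.
have e1 := ler_wpM2r (ltW rho_gt0) H2.
have r1 : 0 <= 1 - rho by rewrite subr_ge0 ltW.
have e2 := ler_wpM2r r1 Hu.
apply: le_trans (lerD e2 e1) _; rewrite le_eqVlt; apply/orP; left; apply/eqP.
by field.
Qed.

Lemma pr_arr_le (n M : nat) :
  pr [set w | arr n w <= M%:R] <= 2 ^+ M * (1 - rho / 2) ^+ n.+1.
Proof. exact: (pr_psum_le n.+1 M). Qed.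

(** The null set outside of which all the sample-path lemmas apply. *)
Definition bad_path : set T :=
  negative_path `|` \bigcup_(M : nat) \bigcap_n [set w | arr n w <= M%:R].

Let measurable_arr_le n y : measurable [set w | arr n w <= y].
Proof. by apply: measurable_le_set => //; exact: measurable_sum. Qed.

Lemma measurable_bad_path : measurable bad_path.
Proof.
apply: measurableU => //; apply: bigcup_measurable => M _.
exact: bigcap_measurable.
Qed.

Lemma pr_bad_path : pr bad_path = 0.
Proof.
have mC M : measurable (\bigcap_n [set w | arr n w <= M%:R]) by exact: bigcap_measurable.
apply/eqP; rewrite eq_le pr_ge0 andbT (le_trans (prU_le _ _ _))//.
  exact: bigcup_measurable.
rewrite pr_negative_path add0r pr_bigcup0// => M.
apply: (pr0_le (mC M) (e := fun n => 2 ^+ M * (1 - rho / 2) ^+ n.+1)).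
  move=> n; apply: le_trans (pr_arr_le n M); apply: pr_le => //.
  by move=> w; apply.
rewrite -[X in _ --> X](mulr0 (2 ^+ M)); apply: cvgMl_tmp.
rewrite (cvg_shiftS (fun n => (1 - rho / 2) ^+ n)).
by apply: cvg_expr; rewrite ger0_norm; move: rho_lt1 rho_gt0 => ? ?; lra.
Qed.

Lemma good_path w : ~ bad_path w -> [/\ forall i, 0 <= A i w,
  forall i, 0 <= X i w & forall M, exists n, M < arrival (A ^~ w) n].
Proof.
move=> nw.
have A0 i : 0 <= A i w.
  by rewrite leNgt; apply/negP => Ai; apply: nw; left; exists i => //; left.
split => // [i|M].
  by rewrite leNgt; apply/negP => /ltW Xi; apply: nw; left; exists i => //; right.
apply: contrapT => H; apply: nw; right; exists (Num.truncn `|M|).+1 => // n _ /=.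
have [//|nM] := leP (arr n w) (Num.truncn `|M|).+1%:R.
exfalso; apply: H; exists n; apply: lt_trans nM.
by rewrite (le_lt_trans (ler_norm _))// truncnS_gt.
Qed.

End model_facts.

(** * Waiting and response time of a single type-1 job *)

Section stationary_facts.
Context {d : measure_display} {T : measurableType d} {R : realType}
  (P : probability T R) (q : params R).
Context (A : nat -> {RV P >-> R}) (B : nat -> {RV P >-> bool})
  (X : nat -> {RV P >-> R}).
Hypothesis lam_gt0 : 0 < lam q.
Hypothesis p_gt0 : 0 < p q.
Hypothesis p_lt1 : p q < 1.
Hypothesis ph1 : is_phase_type (alpha1 q) (S1 q).
Hypothesis ph2 : is_phase_type (alpha2 q) (S2 q).
Hypothesis model : is_model q A B X.
Local Notation pr := (pr P).
Local Notation history D := (g_sigma_algebraType (cylinders (source A B X) D)).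
Local Notation G := (pht_ccdf (alpha1 q) (S1 q)).
Local Notation bad := (bad_path A X).

Let measurable_A n : measurable_fun setT (A n). Proof. exact: measurable_funP. Qed.
Let measurable_B n : measurable_fun setT (B n). Proof. exact: measurable_funP. Qed.
Let measurable_X n : measurable_fun setT (X n). Proof. exact: measurable_funP. Qed.

(* The waiting time job n would have as a type-1 job: it ignores the type and
   the size of job n. *)
Definition W_ignoring (n : nat) (w : T) : R :=
  start_time (K q) (A ^~ w) (fun i => if i == n then true else B i w)
    (fun i => if i == n then 0 else X i w) n - arr A n w.

Lemma W_ignoringE n w : type1 B n w -> W q A B X n w = W_ignoring n w.
Proof.
move=> bw; rewrite /W /waiting_time /W_ignoring; congr (_ - _).
have -> : (fun i => if i == n then true else B i w) = B ^~ w.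
  by apply/funext => i; case: eqP => // ->.
by apply: start_time_indep => i /negbTE ->.
Qed.

Lemma RespE n w : type1 B n w -> Resp q A B X n w = W_ignoring n w + X n w.
Proof.
by move=> bw; rewrite -W_ignoringE// /Resp /response_time /W /waiting_time addrAC.
Qed.

Lemma W_ignoring_history n :
  measurable_fun setT (W_ignoring n : history [set k | k <> inr n] -> R).
Proof.
pose b i (w : history [set k | k <> inr n]) := if i == n then true else B i w.
pose x i (w : history [set k | k <> inr n]) := if i == n then 0 else X i w.
have HA i : measurable_fun setT (A i : history [set k | k <> inr n] -> R).
  exact: A_history.
apply: measurable_funB; last exact: measurable_sum.
apply: (@measurable_start_time _ (history [set k | k <> inr n]) R (K q) A b x) => // i.
  rewrite /b; have [//|/eqP ni] := eqVneq i n.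
  by apply: B_history => /= -[].
rewrite /x; have [//|/eqP ni] := eqVneq i n.
by apply: X_history => /= -[].
Qed.

Lemma measurable_W_ignoring_gt n t : measurable [set w | W_ignoring n w > t].
Proof.
apply: (@history_measurable _ _ _ P A B X [set k | k <> inr n]).
by apply: measurable_lt_set => //; exact: W_ignoring_history.
Qed.

Lemma pr_W_ignoring n t E : preimages (fun w => (B n w, X n w)) E ->
  pr (E `&` [set w | W_ignoring n w > t]) = pr E * pr [set w | W_ignoring n w > t].
Proof.
move=> sE; rewrite setIC mulrC.
apply: (pr_indep model (D := [set k | k <> inr n]) (k := inr n)) => //.
by apply: measurable_lt_set => //; exact: W_ignoring_history.
Qed.

Let source_type1 n (Y : set R) : measurable Y ->
  preimages (fun w => (B n w, X n w)) (type1 B n `&` (X n @^-1` Y)).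
Proof.
move=> mY; exists ([set true] `*` Y); first exact: measurableX.
by apply/seteqP; split => w.
Qed.

Lemma type1_W_gt n t :
  type1 B n `&` [set w | W q A B X n w > t] = type1 B n `&` [set w | W_ignoring n w > t].
Proof. by apply/seteqP; split => w [bw] /=; rewrite W_ignoringE. Qed.

Lemma pr_type1_W n t :
  pr (type1 B n `&` [set w | W q A B X n w > t]) = p q * pr [set w | W_ignoring n w > t].
Proof.
rewrite type1_W_gt pr_W_ignoring ?(pr_type1 model)//.
by have := source_type1 n measurableT; rewrite preimage_setT setIT.
Qed.

Lemma measurable_type1_W n t : measurable (type1 B n `&` [set w | W q A B X n w > t]).
Proof.
rewrite type1_W_gt; apply: measurableI; first exact: measurable_type1.
exact: measurable_W_ignoring_gt.
Qed.

Lemma measurable_type1_Resp n t : measurable (type1 B n `&` [set w | Resp q A B X n w > t]).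
Proof.
have -> : type1 B n `&` [set w | Resp q A B X n w > t] =
    type1 B n `&` [set w | W_ignoring n w + X n w > t].
  by apply/seteqP; split => w [bw] /=; rewrite RespE.
apply: measurableI; first exact: measurable_type1.
apply: measurable_lt_set => //; apply: measurable_funD => //.
by apply: measurable_fun_gt => s; exact: measurable_W_ignoring_gt.
Qed.

Lemma W_ge0 n w : ~ bad w -> type1 B n w -> 0 <= W_ignoring n w.
Proof.
move=> /good_path [a0 x0 ub] bw; rewrite -W_ignoringE//.
rewrite /W /waiting_time subr_ge0.
by have [] := @start_time_bounds R (K q) (A ^~ w) (B ^~ w) (X ^~ w) a0 x0 ub n bw.
Qed.

Lemma pr_type1_size_W n s t r : 0 <= s -> s <= t ->
  pr (type1 B n `&` [set w | s < X n w /\ X n w <= t] `&` [set w | W_ignoring n w > r])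
  = p q * (G s - G t) * pr [set w | W_ignoring n w > r].
Proof.
move=> s0 st; rewrite pr_W_ignoring ?(pr_type1_size_itv model)//.
have -> : [set w | s < X n w /\ X n w <= t] = X n @^-1` `]s, t].
  by apply/seteqP; split => w /=; rewrite in_itv/= => /andP.
by apply: source_type1.
Qed.

(* Riemann-Stieltjes sums bounding the convolution of the law of the waiting
   time with that of the job size. *)
Lemma Resp_lower n m t : (0 < m)%N -> 0 <= t ->
  p q * G t + \sum_(i < m) p q * (G (i%:R * t / m%:R) - G (i.+1%:R * t / m%:R)) *
    pr [set w | W_ignoring n w > t - i%:R * t / m%:R]
  <= pr (type1 B n `&` [set w | Resp q A B X n w > t]).
Proof.
move=> m0 t0.
pose s (i : nat) : R := i%:R * t / m%:R.
have s0 i : 0 <= s i by rewrite /s divr_ge0// mulr_ge0.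
have ss i j : (i <= j)%N -> s i <= s j.
  by move=> ij; rewrite /s ler_wpM2r ?invr_ge0// ler_wpM2r// ler_nat.
have sm : s m = t by rewrite /s mulrAC divff ?mul1r// pnatr_eq0 -lt0n.
have mb := measurable_type1 B n.
have mbad := measurable_bad_path A X.
(* Disjoint events on which W + X > t: either X > t, where W >= 0 off [bad] suffices, or X lies in
   (s_i, s_(i+1)] and W > t - s_i. *)
pose Ei i := type1 B n `&` [set w | s i < X n w /\ X n w <= s i.+1] `&`
  [set w | W_ignoring n w > t - s i] `&` ~` bad.
pose E i := if i is j.+1 then Ei j
  else type1 B n `&` [set w | X n w > t] `&` ~` bad.
have mX i : measurable [set w | s i < X n w /\ X n w <= s i.+1].
  apply: (@measurableI _ _ [set w | s i < X n w] [set w | X n w <= s i.+1]).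
    exact: measurable_lt_set.
  exact: measurable_le_set.
have mXt : measurable [set w | X n w > t] by exact: measurable_lt_set.
have mE i : measurable (E i).
  case: i => [|i] /=; apply: measurableI; try exact: measurableC.
    exact: measurableI.
  by apply: measurableI; [exact: measurableI|exact: measurable_W_ignoring_gt].
have prbad S : measurable S -> pr (S `&` ~` bad) = pr S.
  move=> mS; apply: (pr_eq_ae mbad (pr_bad_path lam_gt0 ph1 ph2 model)) => //.
    by apply: measurableI => //; exact: measurableC.
  by move=> w nw; split => [[]|].
have := @sum_pr_le _ _ _ P E m.+1 _ mE (measurable_type1_Resp n t).
rewrite big_ord_recl /= prbad; last exact: measurableI.
rewrite (pr_type1_size model)// => H; apply: le_trans (H _ _).
- rewrite lerD2l; apply: ler_sum => i _.
  rewrite /Ei prbad; first by rewrite pr_type1_size_W// ss.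
  by apply: measurableI; [exact: measurableI|exact: measurable_W_ignoring_gt].
- move=> [|i] _ w /=.
    move=> [[bw tX] nw]; split => //=; rewrite RespE//.
    by rewrite (lt_le_trans tX)// lerDr W_ge0.
  by move=> [[[bw [sX Xs]] Ww] nw]; split => //=; rewrite RespE//; move: Ww => /= Ww; lra.
- move=> [|i] [|j] w //= ij jm.
    move=> [[_ tX] _] [[[_ [_ Xs]] _] _].
    have := lt_le_trans tX Xs; apply/negP; rewrite -leNgt -sm ss//.
  move=> [[[_ [_ Xs]] _] _] [[[_ [sX _]] _] _].
  by have := lt_le_trans sX Xs; apply/negP; rewrite -leNgt ss.
Qed.

Lemma Resp_upper n m t : (0 < m)%N -> 0 <= t ->
  pr (type1 B n `&` [set w | Resp q A B X n w > t]) <=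
  p q * G t + \sum_(i < m) p q * (G (i%:R * t / m%:R) - G (i.+1%:R * t / m%:R)) *
    pr [set w | W_ignoring n w > t - i.+1%:R * t / m%:R].
Proof.
move=> m0 t0.
pose s (i : nat) : R := i%:R * t / m%:R.
have s0 i : 0 <= s i by rewrite /s divr_ge0// mulr_ge0.
have ss i j : (i <= j)%N -> s i <= s j.
  by move=> ij; rewrite /s ler_wpM2r ?invr_ge0// ler_wpM2r// ler_nat.
have sm : s m = t by rewrite /s mulrAC divff ?mul1r// pnatr_eq0 -lt0n.
have sz : s 0%N = 0 by rewrite /s !mul0r.
have mb := measurable_type1 B n.
pose E i := type1 B n `&` [set w | s i < X n w /\ X n w <= s i.+1] `&`
  [set w | W_ignoring n w > t - s i.+1].
have mX i : measurable [set w | s i < X n w /\ X n w <= s i.+1].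
  apply: (@measurableI _ _ [set w | s i < X n w] [set w | X n w <= s i.+1]).
    exact: measurable_lt_set.
  exact: measurable_le_set.
have mXt : measurable [set w | X n w > t] by exact: measurable_lt_set.
have mE i : measurable (E i).
  by apply: measurableI; [exact: measurableI|exact: measurable_W_ignoring_gt].
have mtX : measurable (type1 B n `&` [set w | X n w > t]) by exact: measurableI.
apply: (@le_trans _ _ (pr ((type1 B n `&` [set w | X n w > t]) `|`
    [set w | exists2 i, (i < m)%N & E i w]))); last first.
  apply: le_trans (prU_le _ _ _) _ => //; first exact: measurable_ex_lt.
  rewrite (pr_type1_size model)// lerD2l (le_trans (pr_ex_lt_le _ _ _))//.
  by apply: ler_sum => i _; rewrite /E pr_type1_size_W// ss.
have mN : measurable [set w | X n w <= 0] by exact: measurable_le_set.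
apply: (pr_le_ae mN (pr_X_le0 ph1 ph2 model n)).
- exact: measurable_type1_Resp.
- by apply: measurableU => //; exact: measurable_ex_lt.
move=> w /negP; rewrite -ltNge => X0 [bw /=]; rewrite RespE// => Rt.
have [Xt|Xt] := ltP t (X n w); [by left|right].
(* The grid interval containing X ends at the least s_i with X <= s_i; X > 0 rules out i = 0. *)
have : exists i, (i <= m)%N && (X n w <= s i) by exists m; rewrite leqnn sm.
move=> /ex_minnP [[|i] /andP[im Xi] imin]; first by move: X0; rewrite ltNge -sz Xi.
exists i => //; split; last by rewrite /=; lra.
split => //=; split => //; rewrite ltNge; apply/negP => Xi'.
by have := imin i; rewrite (ltnW im) Xi' => /(_ isT); rewrite ltnn.
Qed.

End stationary_facts.

(** * Backlog behind an arrival, compared with waiting times and with the workload *)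

Section workload_bounds.
Context {d : measure_display} {T : measurableType d} {R : realType}
  (P : probability T R) (q : params R).
Context (A : nat -> {RV P >-> R}) (B : nat -> {RV P >-> bool})
  (X : nat -> {RV P >-> R}).
Hypothesis lam_gt0 : 0 < lam q.
Hypothesis p_gt0 : 0 < p q.
Hypothesis p_lt1 : p q < 1.
Hypothesis ph1 : is_phase_type (alpha1 q) (S1 q).
Hypothesis ph2 : is_phase_type (alpha2 q) (S2 q).
Hypothesis model : is_model q A B X.
Local Notation pr := (pr P).
Local Notation history r :=
  (g_sigma_algebraType (cylinders (source A B X) (past r))).
Local Notation hmeasurable r := (measurable : set (set (history r))).
Local Notation G := (pht_ccdf (alpha1 q) (S1 q)).
Local Notation bad := (bad_path A X).
Local Notation rho := (expR (- lam q)).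
Local Notation comp n w := (completion (A ^~ w) (X ^~ w) n).

Let rho_lt1 : rho < 1. Proof. by rewrite -expR0 ltr_expR oppr_lt0. Qed.
Let rho_gt0 : 0 < rho. Proof. exact: expR_gt0. Qed.
Let mbad : measurable bad. Proof. exact: measurable_bad_path. Qed.
Let pbad : pr bad = 0. Proof. exact: (pr_bad_path lam_gt0 ph1 ph2 model). Qed.
Let measurable_A n : measurable_fun setT (A n). Proof. exact: measurable_funP. Qed.
Let measurable_X n : measurable_fun setT (X n). Proof. exact: measurable_funP. Qed.

Let hmeas r (S : set T) : hmeasurable r S -> measurable (S : set T).
Proof. exact: (@history_measurable _ _ _ P A B X (past r) S). Qed.

Lemma past_history_fun r r' (f : T -> R) : (r <= r')%N ->
  measurable_fun setT (f : history r -> R) -> measurable_fun setT (f : history r' -> R).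
Proof.
move=> rr' mf _ Y mY; have := mf measurableT Y mY; rewrite !setTI.
exact: past_history.
Qed.

Lemma comp_history n : measurable_fun setT ((fun w => comp n w) : history n.*2 -> R).
Proof.
elim: n => [|n IH] //=; apply: measurable_funD; last first.
  by apply: X_history; rewrite /past/= doubleS.
apply: measurable_maxr; first by apply: past_history_fun IH; rewrite doubleS -addn2 leq_addr.
by apply: past_history_fun (@arr_history _ _ _ _ A B X n); rewrite doubleS.
Qed.

Let arr_measurable n : measurable_fun setT (arr A n).
Proof. exact: measurable_sum. Qed.

Lemma arr_hist n r : (n.*2 < r)%N -> measurable_fun setT (arr A n : history r -> R).
Proof. by move=> nr; apply: past_history_fun (@arr_history _ _ _ _ A B X n). Qed.

(* More than t units of work are present right after the arrival of job n. *)
Definition backlog n (t : R) : set T := [set w | comp n.+1 w - arr A n w > t].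

Lemma backlog_history n t : hmeasurable n.+1.*2 (backlog n t).
Proof.
apply: measurable_lt_set => //; apply: measurable_funB; first exact: (@comp_history n.+1).
by apply: arr_hist; rewrite doubleS.
Qed.

Let A_event n (Y : set R) : measurable Y -> source A B X (inl n) (A n @^-1` Y).
Proof. by move=> mY; exists Y. Qed.

Let pr_A n r (S : set T) (Y : set R) : hmeasurable r S -> (r <= n.*2)%N -> measurable Y ->
  pr (S `&` A n @^-1` Y) = pr S * pr (A n @^-1` Y).
Proof.
move=> mS rn mY; apply: (pr_indep model mS (k := inl n)); last exact: A_event.
by rewrite /past/= ltnNge rn.
Qed.

Let type1_source n : source A B X (inr n) (type1 B n).
Proof.
exists ([set true] `*` setT); first exact: measurableX.
by apply/seteqP; split => w //= [].
Qed.

(** The squared factor is the probability that the next two interarrival times are at most 1 and the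
    next two jobs of type 1. Job n+2 then waits for all the work, of which at most 2 units have been
    processed since job n arrived. *)
Lemma backlog_le n t :
  pr (backlog n t) * ((1 - rho) * p q) ^+ 2 <=
  pr (type1 B n.+2 `&` [set w | W q A B X n.+2 w > t - 2]).
Proof.
have m0 := @backlog_history n t.
(* The sources are added one at a time in chronological order, so each event lies in a history that
   is independent of the next source. *)
pose S1 := backlog n t `&` A n.+1 @^-1` `]-oo, 1].
pose S2 := S1 `&` type1 B n.+1.
pose S3 := S2 `&` A n.+2 @^-1` `]-oo, 1].
pose S4 := S3 `&` type1 B n.+2.
have mA k r : (k.*2 < r)%N -> hmeasurable r (A k @^-1` `]-oo, 1]).
  move=> kr; have /(_ measurableT `]-oo, 1]%classic) := @A_history _ _ _ P A B X (past r) k kr.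
  by rewrite setTI; apply.
have mB k r : (k.*2.+1 < r)%N -> hmeasurable r (type1 B k).
  move=> kr; have /(_ measurableT [set true]) := @B_history _ _ _ P A B X (past r) (k) kr.
  by rewrite setTI; apply.
have m1 : hmeasurable n.+1.*2.+1 S1.
  by apply: measurableI; [exact: past_history m0|exact: mA].
have m2 : hmeasurable n.+2.*2 S2.
  apply: measurableI; first exact: past_history m1.
  by apply: mB; rewrite doubleS.
have m3 : hmeasurable n.+2.*2.+1 S3.
  by apply: measurableI; [exact: past_history m2|exact: mA].
have A1 k : pr (A k @^-1` `]-oo, 1]) = 1 - rho.
  by rewrite -(pr_A_le1 lam_gt0 model k) preimage_itvNyc.
have <- : pr S4 = pr (backlog n t) * ((1 - rho) * p q) ^+ 2.
  rewrite (pr_indep model m3 (k := inr n.+2))//; last by rewrite /past/= ltnn.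
  rewrite (pr_A m2)// (pr_indep model m1 (k := inr n.+1))//; last by rewrite /past/= ltnn.
  rewrite (pr_A m0)// !A1 !(pr_type1 model) expr2; ring.
apply: (pr_le_ae mbad pbad).
- apply: measurableI; first exact: hmeas m3.
  exact: measurable_type1.
- exact: (@measurable_type1_W _ _ _ P q A B X n.+2 (t - 2)).
move=> w /good_path [a0 x0 ub] [[[[bk A1w] b1] A2w] b2]; split => //=.
rewrite /W /waiting_time (@start_time_after_type1 R (K q) (A ^~ w) (B ^~ w) (X ^~ w)
  a0 x0 ub n.+1 b1 b2) !arrivalS.
have := completion_mono (A ^~ w) x0 (leqnSn n.+1).
move: A1w A2w bk; rewrite /backlog /= !in_itv/= => A1w A2w bk.
have : comp n.+2 w <= Num.max (comp n.+2 w) (arrival (A ^~ w) n + A n.+1 w + A n.+2 w).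
  by rewrite le_max lexx.
rewrite /arr in bk; rewrite /=; set M := Num.max _ _; move=> H1 H2.
rewrite -/M; lra.
Qed.

Lemma Resp_le_backlog n t :
  pr (type1 B n `&` [set w | Resp q A B X n w > t]) <= pr (backlog n t).
Proof.
apply: (pr_le_ae mbad pbad).
- exact: (@measurable_type1_Resp _ _ _ P q A B X n t).
- exact: hmeas (@backlog_history n t).
move=> w /good_path [a0 x0 ub] [bw]; rewrite /backlog /Resp /response_time/=.
have [_ H] := @start_time_bounds R (K q) (A ^~ w) (B ^~ w) (X ^~ w) a0 x0 ub n bw.
by move=> Ht; rewrite (lt_le_trans Ht)// lerD2r.
Qed.

(** Job n is the last one to have arrived by the integer time u. *)
Definition slot n (u : nat) : set T := [set w | arr A n w <= u%:R /\ u%:R < arr A n.+1 w].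

Let measurable_slot n u : measurable (slot n u).
Proof.
apply: (@measurableI _ _ [set w | arr A n w <= u%:R] [set w | u%:R < arr A n.+1 w]).
  exact: measurable_le_set.
exact: measurable_lt_set.
Qed.

Definition cell n (v : nat) : set T := [set w | v%:R - 1 < arr A n w /\ arr A n w <= v%:R].

Let cell_history n v r : (n.*2 < r)%N -> hmeasurable r (cell n v).
Proof.
move=> nr.
apply: (@measurableI _ (history r) [set w | v%:R - 1 < arr A n w] [set w | arr A n w <= v%:R]).
  by apply: measurable_lt_set => //; exact: arr_hist.
by apply: measurable_le_set => //; exact: arr_hist.
Qed.

Let pr_A_gt_nat n (k : nat) : pr (A n @^-1` `]k%:R, +oo[) <= rho ^+ k.
Proof.
have mI : measurable (A n @^-1` `]k%:R, +oo[).
  by have := measurable_A n measurableT (measurable_itv `]k%:R, +oo[); rewrite setTI.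
case: k mI => [|k] mI; first by rewrite expr0 pr_le1.
by rewrite preimage_itvoy (pr_A_gt lam_gt0 model)// mulrC expRM_natl.
Qed.

(** With v the arrival time of job n rounded up, the next interarrival time must exceed u - v; it is
    independent of S and of the cell, and this has probability at most rho^(u-v). *)
Lemma slot_upper n (S : set T) u : hmeasurable n.+1.*2 S ->
  pr (S `&` slot n u) <= \sum_(v < u.+1) rho ^+ (u - v) * pr (S `&` cell n v).
Proof.
move=> mS.
have mSc v : hmeasurable n.+1.*2 (S `&` cell n v).
  by apply: measurableI => //; apply: cell_history; rewrite doubleS.
pose E v := S `&` cell n v `&` A n.+1 @^-1` `](u - v)%:R, +oo[.
have mE v : measurable (E v).
  apply: measurableI; first exact: hmeas (mSc v).
  by have := measurable_A n.+1 measurableT (measurable_itv `](u - v)%:R, +oo[); rewrite setTI.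
apply: (@le_trans _ _ (pr [set w | exists2 v, (v < u.+1)%N & E v w])).
  apply: (pr_le_ae mbad pbad) => //.
  - by apply: measurableI => //; exact: hmeas mS.
  - exact: measurable_ex_lt.
  move=> w /good_path [a0 _ _] [Sw [nu un]].
  have : exists v, arr A n w <= v%:R by exists u.
  move=> /ex_minnP [v nv vmin]; have vu := vmin u nu.
  exists v => //; split.
    split => //; split => //; case: v nv vmin vu => [|v] nv vmin vu.
      rewrite sub0r (@lt_le_trans _ _ 0) ?ltrN10//.
      by rewrite /arr /arrival sumr_ge0.
    rewrite -natr1 addrK ltNge; apply/negP => /vmin; by rewrite ltnn.
  rewrite /= in_itv/= andbT natrB//.
  by move: un; rewrite /arr arrivalS => un; move: nv; rewrite /arr => nv; lra.
apply: le_trans (pr_ex_lt_le _ _ mE) _; apply: ler_sum => v _.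
rewrite (pr_A (mSc v))// mulrC.
by apply: ler_wpM2r; [exact: pr_ge0|exact: pr_A_gt_nat].
Qed.

(** On average job n is the last arrival for at most 1/(1 - rho) integer times, even on S. The
    bounds b of [slot_upper] satisfy b(u+1) = rho b(u) + H(u+1), so (1 - rho) times their sum is at
    most the sum of H, and the cells are disjoint. *)
Lemma sum_slot_le n (S : set T) M : hmeasurable n.+1.*2 S ->
  \sum_(u < M) pr (S `&` slot n u) <= pr S / (1 - rho).
Proof.
move=> mS; rewrite ler_pdivlMr ?subr_gt0//.
pose H v := pr (S `&` cell n v).
pose b u := \sum_(v < u.+1) rho ^+ (u - v) * H v.
have bS u : b u.+1 = rho * b u + H u.+1.
  rewrite /b big_ord_recr/= subnn expr0 mul1r mulr_sumr; congr (_ + _).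
  by apply: eq_bigr => v _; rewrite subSn ?exprS ?mulrA //; exact: ltn_ord v.
have b0 u : 0 <= b u.
  by apply: sumr_ge0 => v _; rewrite mulr_ge0 ?exprn_ge0 ?pr_ge0// ltW.
have sb k : (1 - rho) * (\sum_(u < k.+1) b u) + rho * b k = \sum_(u < k.+1) H u.
  elim: k => [|k IH].
    by rewrite !big_ord1 /b big_ord1 subnn expr0; ring.
  by rewrite big_ord_recr/= [RHS]big_ord_recr/= -IH bS; ring.
have sH k : \sum_(u < k) H u <= pr S.
  have mE v : measurable (S `&` cell n v).
    apply: measurableI; first exact: hmeas mS.
    exact: hmeas (@cell_history n v n.*2.+1 (ltnSn _)).
  apply: (sum_pr_le P mE (hmeas mS)) => [i _|i j w ij _]; first exact: subIsetl.
  move=> [_ [_ ni]] [_ [nj _]].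
  have := lt_le_trans nj ni; apply/negP; rewrite -leNgt lerBrDr natr1 ler_nat//.
case: M => [|M]; first by rewrite big_ord0 mul0r pr_ge0.
apply: le_trans (sH M.+1); rewrite -sb mulrC.
apply: (@le_trans _ _ ((1 - rho) * \sum_(u < M.+1) b u)).
  apply: ler_wpM2l; first by rewrite subr_ge0 ltW.
  apply: ler_sum => u _.
  exact: slot_upper.
by rewrite lerDl mulr_ge0// ltW.
Qed.

Lemma measurable_V_gt u t : measurable [set w | V q A B X u w > t].
Proof.
apply: measurable_lt_set => //.
by apply: (@measurable_workload _ T R (K q) A B X) => i; exact: measurable_funP.
Qed.

Let VE w u : ~ bad w -> exists2 m, V q A B X u w = Num.max 0 (comp m w - u) &
  u < arr A m w /\ forall k, (k < m)%N -> arr A k w <= u.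
Proof.
move=> /good_path [a0 x0 ub]; have [m0 um0] := ub u.
have : exists m, u < arr A m w by exists m0.
move=> /ex_minnP [m um mmin]; have mu k : (k < m)%N -> arr A k w <= u.
  by move=> km; rewrite leNgt; apply/negP => /mmin; rewrite leqNgt km.
exists m => //; exact: workloadE.
Qed.

(** If n is the last arrival by time u, the workload at u is at most the backlog that n created; the
    last term collects the paths with more than N arrivals by time u. *)
Lemma V_upper N (u : nat) t : 0 <= t ->
  pr [set w | V q A B X u%:R w > t] <=
  \sum_(n < N) pr (backlog n t `&` slot n u) + pr [set w | arr A N w <= u%:R].
Proof.
move=> t0; have mE n : measurable (backlog n t `&` slot n u).
  by apply: measurableI => //; exact: hmeas (@backlog_history n t).
have mN : measurable [set w | arr A N w <= u%:R] by exact: measurable_le_set.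
apply: (@le_trans _ _ (pr ([set w | exists2 n, (n < N)%N & (backlog n t `&` slot n u) w]
    `|` [set w | arr A N w <= u%:R]))); last first.
  apply: le_trans (prU_le _ (measurable_ex_lt _ mE) mN) _.
  by rewrite lerD2r pr_ex_lt_le.
apply: (pr_le_ae mbad pbad) => //.
- exact: measurable_V_gt.
- by apply: measurableU => //; exact: measurable_ex_lt.
move=> w nw /=; have [[|n] -> [un nu]] := VE u%:R nw.
  by rewrite /= sub0r max_l ?oppr_le0// ltNge t0.
have un' := nu n (ltnSn n).
rewrite lt_max ltNge t0/= => Ct.
have [nN|Nn] := ltnP n N; [left|right].
  by exists n => //; split => //; rewrite /backlog/= (lt_le_trans Ct)// lerD2l lerN2.
have [a0 _ _] := good_path nw.
exact: le_trans (arrival_mono a0 Nn) un'.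
Qed.

(** From an arrival in (v-1, v], an interarrival time in (u-v+1, u-v+2] brings the next job into (u,
    u+2]. Its probability is rho (1 - rho) rho^(u-v), which is rho (1 - rho) times the weight in
    [slot_upper], so the sums compare term by term. *)
Lemma slot_lower n u :
  rho * (1 - rho) * pr (slot n u) <=
  pr (slot n u `&` [set w | arr A n.+1 w <= u%:R + 2]).
Proof.
have mc v : hmeasurable n.+1.*2 (cell n v) by apply: cell_history; rewrite doubleS.
pose E v := cell n v `&` A n.+1 @^-1` `](u - v).+1%:R, (u - v).+2%:R].
have mI k : measurable (A n.+1 @^-1` `]k.+1%:R, k.+2%:R]).
  by have := measurable_A n.+1 measurableT (measurable_itv `]k.+1%:R, k.+2%:R]); rewrite setTI.
have mE v : measurable (E v).
  by apply: measurableI; [exact: hmeas (mc v)|exact: mI].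
have pI k : pr (A n.+1 @^-1` `]k.+1%:R, k.+2%:R]) = rho ^+ k.+1 * (1 - rho).
  have mg j : measurable [set w | j.+1%:R < A n.+1 w] by exact: measurable_lt_set.
  have pg j : pr [set w | j.+1%:R < A n.+1 w] = rho ^+ j.+1.
    by rewrite (pr_A_gt lam_gt0 model)// mulrC expRM_natl.
  have := prIC P (mg k) (mg k.+1).
  have -> : [set w | k.+1%:R < A n.+1 w] `&` [set w | k.+2%:R < A n.+1 w] =
      [set w | k.+2%:R < A n.+1 w].
    apply/seteqP; split => w /=; first by case.
    by move=> H; split => //; apply: lt_trans H; rewrite ltr_nat.
  have -> : [set w | k.+1%:R < A n.+1 w] `&` ~` [set w | k.+2%:R < A n.+1 w] =
      A n.+1 @^-1` `]k.+1%:R, k.+2%:R].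
    apply/seteqP; split => w /=; rewrite in_itv/=.
      by move=> [-> /negP]; rewrite -leNgt.
    by move=> /andP[-> H]; split => //; apply/negP; rewrite -leNgt.
  by rewrite !pg => H; rewrite mulrBr mulr1 -exprSr [X in _ = X - _]H addrAC subrr add0r.
apply: (@le_trans _ _ (\sum_(v < u.+1) pr (E v))).
  have := @slot_upper n setT u measurableT; rewrite setTI => H.
  have r0 : 0 <= rho * (1 - rho) by rewrite mulr_ge0 ?subr_ge0 ?ltW.
  apply: le_trans (ler_wpM2l r0 H) _; rewrite mulr_sumr; apply: ler_sum => v _.
  rewrite setTI /E (pr_A (mc v))// pI exprS le_eqVlt; apply/orP; left; apply/eqP.
  by ring.
have mB : measurable (slot n u `&` [set w | arr A n.+1 w <= u%:R + 2]).
  by apply: measurableI => //; exact: measurable_le_set.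
apply: (sum_pr_le P mE mB) => [v vu|i j w ij ju].
  move=> w [[vn nv]]; rewrite /= in_itv/= -![in X in X -> _]natr1 => /andP[].
  rewrite !natrB// => H1 H2.
  have := nv; rewrite /slot /arr/= arrivalS => nv'; rewrite /arr in vn.
  have vu' : v%:R <= u%:R :> R by rewrite ler_nat.
  by split => /=; [split|]; rewrite /arr ?arrivalS/=; lra.
move=> [[_ ni] _] [[nj _] _].
have := lt_le_trans nj ni; apply/negP; rewrite -leNgt lerBrDr natr1 ler_nat//.
Qed.

(** A type-1 job that arrives in (u, u+2] as the first one after u, with size above t + 2, leaves
    more than t work at time u + 2. These events are disjoint in n, and the slot probabilities are
    bounded below by a telescoping sum. *)
Lemma V_lower N (u : nat) t : 0 <= t ->
  p q * G (t + 2) * (rho * (1 - rho)) *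
    (pr [set w | arr A 0 w <= u%:R] - pr [set w | arr A N w <= u%:R])
  <= pr [set w | V q A B X u.+2%:R w > t].
Proof.
move=> t0.
pose S n := slot n u `&` [set w | arr A n.+1 w <= u%:R + 2].
pose Y n := type1 B n.+1 `&` [set w | X n.+1 w > t + 2].
have mS n : hmeasurable n.+1.*2.+1 (S n).
  have ma k : (k <= n.+1)%N -> measurable_fun setT (arr A k : history n.+1.*2.+1 -> R).
    by move=> kn; apply: arr_hist; rewrite ltnS leq_double.
  apply: (@measurableI _ (history n.+1.*2.+1)).
    apply: (@measurableI _ (history n.+1.*2.+1) [set w | arr A n w <= u%:R]
      [set w | u%:R < arr A n.+1 w]).
      by apply: measurable_le_set => //; exact: ma.
    by apply: measurable_lt_set => //; exact: ma.
  by apply: measurable_le_set => //; exact: ma.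
have mY n : measurable (Y n).
  by apply: measurableI; [exact: measurable_type1|exact: measurable_lt_set].
have sY n : source A B X (inr n.+1) (Y n).
  exists ([set true] `*` `]t + 2, +oo[); first exact: measurableX.
  by apply/seteqP; split => w /=; rewrite in_itv/= andbT.
have pSY n : pr (S n `&` Y n) = pr (S n) * (p q * G (t + 2)).
  rewrite (pr_indep model (mS n) _ (sY n)); last by rewrite /past/= ltnn.
  by rewrite /Y (pr_type1_size model)// addr_ge0.
pose E n := S n `&` Y n `&` ~` bad.
have mSY n : measurable (S n `&` Y n) by apply: measurableI => //; exact: hmeas (mS n).
have mE n : measurable (E n) by apply: measurableI => //; exact: measurableC.
have pE n : pr (E n) = pr (S n) * (p q * G (t + 2)).
  rewrite -pSY; apply: (pr_eq_ae mbad pbad) => // w nw.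
  by split => [[]|].
have marr n : measurable [set w | arr A n w <= u%:R] by exact: measurable_le_set.
have tele : pr [set w | arr A 0 w <= u%:R] - pr [set w | arr A N w <= u%:R] <=
    \sum_(n < N) pr (slot n u).
  elim: N => [|N IH]; first by rewrite big_ord0 subrr.
  rewrite big_ord_recr/=.
  suff : pr [set w | arr A N w <= u%:R] <= pr (slot N u) + pr [set w | arr A N.+1 w <= u%:R].
    by move: IH; lra.
  apply: le_trans (prU_le _ (measurable_slot N u) (marr N.+1)).
  apply: pr_le => //; first exact: measurableU.
  by move=> w Nu; have [H|H] := leP (arr A N.+1 w) u%:R; [right|left].
have pG : 0 <= p q * G (t + 2).
  by rewrite mulr_ge0 ?ltW// (pht_ccdf_gt0 ph1)// addr_ge0.
have r0 : 0 <= rho * (1 - rho) by rewrite mulr_ge0 ?subr_ge0 ?ltW.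
apply: (@le_trans _ _ (\sum_(n < N) pr (E n))).
  apply: le_trans (ler_wpM2l (mulr_ge0 pG r0) tele) _; rewrite mulr_sumr.
  apply: ler_sum => n _; rewrite pE -mulrA mulrC.
  by rewrite ler_wpM2r// slot_lower.
apply: (sum_pr_le P mE (measurable_V_gt _ _)) => [n nN w [[[[nu un] n2] [bw /= Xt]] nw]|].
  have [m -> [um mu]] := VE u.+2%:R nw; have [a0 x0 _] := good_path nw.
  have nm : (n.+2 <= m)%N.
    rewrite ltnNge; apply/negP => mn.
    have := arrival_mono a0 mn; rewrite leNgt => /negP; apply.
    by apply: le_lt_trans um; rewrite /= in n2; rewrite -!natr1; move: n2; rewrite /arr; lra.
  rewrite lt_max; apply/orP; right.
  have := completion_mono (A ^~ w) x0 nm.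
  have : arrival (A ^~ w) n.+1 + X n.+1 w <= comp n.+2 w.
    by rewrite [leRHS]/= lerD2r le_max lexx orbT.
  move: un; rewrite /arr -!natr1; lra.
move=> i j w ij jN [[[[_ ui] _] _] nw] [[[[ju _] _] _] _].
have [a0 _ _] := good_path nw.
have := arrival_mono a0 ij; rewrite leNgt => /negP; apply.
exact: le_lt_trans ju ui.
Qed.

End workload_bounds.

(** * Tail asymptotics *)

Section tail_asymptotics.
Context {R : realType} {n : nat} (alpha : 'rV[R]_n) (S : 'M[R]_n).
Hypothesis ph : is_phase_type alpha S.
Local Notation G := (pht_ccdf alpha S).
Local Notation f := (pht_pdf alpha S).
Variables (FW FR FZ : R -> R) (theta cW C : R) (Phi : R -> R -> R).
Hypothesis FW_ge0 : forall t, 0 <= t -> 0 <= FW t.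
Hypothesis FW_le1 : forall t, 0 <= t -> FW t <= 1.
Hypothesis FW_FR : forall t, 0 <= t -> FW t <= FR t.
Hypothesis FR_FW : forall t, 2 <= t -> FR t <= C * FW (t - 2).
Hypothesis FZ_FW : forall t, 2 <= t -> FZ t <= C * FW (t - 2).
Hypothesis FZ_gt0 : forall t, 0 <= t -> 0 < FZ t.
Hypothesis FZ_le1 : forall t, 0 <= t -> FZ t <= 1.
Hypothesis FZ_decay : decay_rate FZ theta.
Hypothesis FW_prefactor : prefactor FW theta cW.
Hypothesis FR_Phi : forall t, 0 <= t -> FR t = G t + (Phi t t - Phi t 0).
Hypothesis dPhi : forall t s : R, 0 <= s -> s <= t ->
  is_derive s 1 (Phi t) (FW (t - s) * f s).

Let near_ge (a : R) : \forall t \near +oo, a <= t.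
Proof. by apply: nbhs_pinfty_ge; rewrite num_real. Qed.

Let C_gt0 : 0 < C.
Proof.
have := lt_le_trans (FZ_gt0 (ler0n R 2)) (FZ_FW (lexx _)); rewrite subrr => H.
rewrite ltNge; apply/negP => C0; move: H; rewrite ltNge => /negP; apply.
by rewrite mulr_le0_ge0// FW_ge0.
Qed.

(** Positivity passes from Z to W, and from W to R, so that the logarithms below are taken of
    positive numbers. *)
Let FW_gt0 t : 0 <= t -> 0 < FW t.
Proof.
move=> t0; have t2 : 2 <= t + 2 by rewrite lerDr.
have := lt_le_trans (FZ_gt0 (le_trans (ler0n R 2) t2)) (FZ_FW t2).
by rewrite addrK pmulr_rgt0.
Qed.

Let FR_gt0 t : 0 <= t -> 0 < FR t.
Proof. by move=> t0; rewrite (lt_le_trans (FW_gt0 t0))// FW_FR. Qed.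

Let theta_ge0 : 0 <= theta.
Proof.
rewrite -(cvg_lim (@Rhausdorff R) FZ_decay); apply: limr_ge.
  by apply/cvg_ex; exists theta.
near=> t; have t1 : 0 <= t by near: t; exact: near_ge.
by rewrite oppr_ge0 mulr_ge0_le0 ?invr_ge0// ln_le0// FZ_le1.
Unshelve. all: by end_near. Qed.

Let cW_ge0 : 0 <= cW.
Proof.
rewrite -(cvg_lim (@Rhausdorff R) FW_prefactor); apply: limr_ge.
  by apply/cvg_ex; exists cW.
near=> t; rewrite mulr_ge0 ?expR_ge0// FW_ge0//; near: t; exact: near_ge.
Unshelve. all: by end_near. Qed.

Let cvg_inv : t^-1 @[t --> +oo] --> (0 : R).
Proof. apply/cvgrPdist_le => eps eps0; near=> t.
have t0 : 0 < t by near: t; apply: nbhs_pinfty_gt; rewrite num_real.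
rewrite sub0r normrN ger0_norm ?invr_ge0 ?(ltW t0)//.
rewrite -[eps]invrK lef_pV2 ?posrE ?invr_gt0//; near: t; exact: near_ge.
Unshelve. all: by end_near. Qed.

Let cvg_shift (h : R -> R) (a l : R) : h t @[t --> +oo] --> l ->
  h (t - a) @[t --> +oo] --> l.
Proof.
move=> hl; apply: (cvg_comp (fun t => t - a) h) hl.
apply/cvgryPge => B; near=> t; rewrite lerBrDr; near: t; exact: near_ge.
Unshelve. all: by end_near. Qed.

Lemma decay_rate_FR : decay_rate FR theta.
Proof.
(* An eventual upper bound of e^{theta t} FW(t) that is positive even if cW = 0. It gives the lower
   envelope; the upper one comes from FZ(t + 2) <= C FR(t). *)
pose D := cW + 1; have D0 : 0 < D by rewrite ltr_wpDl.
apply: (@squeeze_cvgr _ _ _ _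
  (fun t => theta - t^-1 * (ln (C * D) + 2 * theta))
  (fun t => t^-1 * ln C + (1 + t^-1 * 2) * - ((t - - 2)^-1 * ln (FZ (t - - 2))))).
- near=> t.
  have t2 : 2 < t by near: t; apply: nbhs_pinfty_gt; rewrite num_real.
  have t0 : 0 < t by apply: lt_trans t2.
  have FRt := FR_gt0 (ltW t0).
  apply/andP; split.
    have HD : expR (theta * (t - 2)) * FW (t - 2) <= D.
      near: t; apply: (cvgr_le cW); last by rewrite /D ltrDl.
      exact: cvg_shift FW_prefactor.
    have : FR t <= C * D * expR (- (theta * (t - 2))).
      rewrite (le_trans (FR_FW (ltW t2)))// -mulrA ler_pM2l//.
      by rewrite expRN ler_pdivlMr ?expR_gt0// mulrC.
    have CD0 : 0 < C * D by rewrite mulr_gt0.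
    rewrite -ler_ln ?posrE ?mulr_gt0 ?expR_gt0// lnM ?posrE ?expR_gt0// expRK => H.
    rewrite -subr_ge0.
    have -> : - (t^-1 * ln (FR t)) - (theta - t^-1 * (ln (C * D) + 2 * theta)) =
        t^-1 * (ln (C * D) - theta * (t - 2) - ln (FR t)).
      by field; rewrite gt_eqF.
    by rewrite mulr_ge0 ?invr_ge0 ?(ltW t0)// subr_ge0.
  rewrite opprK; have t22 : 2 <= t + 2 by rewrite lerDr ltW.
  have : FZ (t + 2) <= C * FR t.
    rewrite (le_trans (FZ_FW t22))// addrK ler_pM2l// FW_FR// ltW//.
  have FZt : 0 < FZ (t + 2) by rewrite FZ_gt0// addr_ge0// ltW.
  rewrite -ler_ln ?posrE ?mulr_gt0// lnM ?posrE// => H.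
  rewrite -subr_ge0.
  have -> : t^-1 * ln C + (1 + t^-1 * 2) * - ((t + 2)^-1 * ln (FZ (t + 2))) -
      - (t^-1 * ln (FR t)) = t^-1 * (ln C + ln (FR t) - ln (FZ (t + 2))).
    by field; rewrite !gt_eqF// addr_gt0.
  by rewrite mulr_ge0 ?invr_ge0 ?(ltW t0)// subr_ge0.
- rewrite -[X in _ --> X]subr0; apply: cvgB; first exact: cvg_cst.
  by rewrite -[X in _ --> X](mul0r (ln (C * D) + 2 * theta)); exact: cvgMr_tmp.
- rewrite -[X in _ --> X]add0r -[X in _ --> X + _](mul0r (ln C)).
  apply: cvgD; first exact: cvgMr_tmp.
  rewrite -[X in _ --> X]mul1r; apply: cvgM; last exact: cvg_shift FZ_decay.
  rewrite -[X in _ --> X]addr0; apply: cvgD; first exact: cvg_cst.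
  by rewrite -[X in _ --> X](mul0r 2); exact: cvgMr_tmp.
Unshelve. all: by end_near. Qed.

Let e (t : R) : R := expR (theta * t).
Let eD s t : e (s + t) = e s * e t. Proof. by rewrite /e mulrDr expRD. Qed.
Let e_gt0 t : 0 < e t. Proof. exact: expR_gt0. Qed.

Let eFR_le t : 2 <= t -> e t * FR t <= C * e 2 * (e (t - 2) * FW (t - 2)).
Proof.
move=> t2; rewrite -[X in e X](subrK 2) eD.
apply: le_trans (ler_wpM2l _ (FR_FW t2)) _; first by rewrite mulr_ge0 ?ltW.
by rewrite le_eqVlt; apply/orP; left; apply/eqP; ring.
Qed.

Lemma prefactor_FR : (- theta)%:M - S \in unitmx ->
  prefactor FR theta (cW * pht_lst alpha S (- theta)).
Proof.
move=> uB; rewrite /prefactor -/(e _).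
(* If cW = 0, the domination of FR by a shifted FW gives the limit 0, with no need to interpret the
   value of the transform. *)
have [cW0|cW_neq0] := eqVneq cW 0.
  rewrite cW0 mul0r.
  apply: (@squeeze_cvgr _ _ _ _ (fun=> 0)
    (fun t => C * e 2 * (e (t - 2) * FW (t - 2)))).
  - near=> t; have t2 : 2 <= t by near: t; exact: near_ge.
    have t0 : 0 <= t by apply: le_trans t2.
    by rewrite eFR_le// andbT mulr_ge0 ?(ltW (e_gt0 _)) ?(ltW (FR_gt0 t0)).
  - exact: cvg_cst.
  - rewrite -(mulr0 (C * e 2)); apply: cvgMl_tmp.
    by have := cvg_shift 2 FW_prefactor; rewrite cW0.
have cW_gt0 : 0 < cW by rewrite lt_neqAle eq_sym cW_neq0.
have [J [J0 dJ Jlim]] := pht_truncated_moment ph theta_ge0 uB.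
have J_nd s t : 0 <= s -> s <= t -> J s <= J t.
  move=> s0 st; apply: (@derive_ge0_le _ J (fun x => e x * f x)) => // x /andP[sx _].
  by rewrite mulr_ge0 ?expR_ge0// (pht_pdf_ge0 ph)// (le_trans s0).
have J_ge0 t : 0 <= t -> 0 <= J t by move=> t0; rewrite -J0 J_nd.
(* For x <= t - T0 the factor e^{theta (t-x)} FW(t-x) is within eps of cW, and the scaled increments
   of [Phi t] are compared with those of J. *)
have head_bounds eps : 0 < eps -> exists2 T0, 0 <= T0 & forall t, T0 <= t ->
    (cW - eps) * J (t - T0) <= e t * (Phi t (t - T0) - Phi t 0) <= (cW + eps) * J (t - T0).
  move=> eps0.
  have [T1 [_ HT1]] : \forall r \near +oo, `|cW - e r * FW r| <= eps.
    by move/cvgrPdist_le: FW_prefactor => /(_ _ eps0).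
  pose T0 := Num.max 0 (T1 + 1); exists T0; first by rewrite le_max lexx.
  move=> t T0t.
  have HT r : T0 <= r -> cW - eps <= e r * FW r <= cW + eps.
    move=> T0r; have : T1 < r.
      by rewrite (lt_le_trans _ T0r)// lt_max ltrDl ltr01 orbT.
    by move=> /HT1; rewrite ler_norml => /andP[H1 H2]; apply/andP; split; lra.
  have dE x : 0 <= x <= t - T0 ->
      is_derive x 1 (fun y => e t * Phi t y) (e t * (FW (t - x) * f x)).
    move=> /andP[x0 xt]; apply: is_deriveZ; apply: dPhi => //.
    by rewrite (le_trans xt)// gerBl le_max lexx.
  have t0 : 0 <= t - T0 by rewrite subr_ge0.
  have eE x : e t * (FW (t - x) * f x) = (e (t - x) * FW (t - x)) * (e x * f x).
    by rewrite -[X in e X](subrK x) eD; ring.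
  have xb x : 0 <= x <= t - T0 ->
      (cW - eps) * (e x * f x) <= e t * (FW (t - x) * f x) <= (cW + eps) * (e x * f x).
    move=> /andP[x0 xt]; rewrite eE.
    have /HT /andP[H1 H2] : T0 <= t - x by lra.
    have ef : 0 <= e x * f x by rewrite mulr_ge0 ?expR_ge0// (pht_pdf_ge0 ph).
    by rewrite !ler_wpM2r.
  apply/andP; split.
  - have := @derive_le R (fun y => (cW - eps) * J y) (fun y => e t * Phi t y)
      (fun x => (cW - eps) * (e x * f x)) (fun x => e t * (FW (t - x) * f x)) 0 (t - T0).
    rewrite J0 mulr0 subr0 -mulrBr; apply => // x xt.
    by have /andP[] := xb x xt.
  - have := @derive_le R (fun y => e t * Phi t y) (fun y => (cW + eps) * J y)
      (fun x => e t * (FW (t - x) * f x)) (fun x => (cW + eps) * (e x * f x)) 0 (t - T0).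
    rewrite J0 mulr0 subr0 -mulrBr; apply => // x xt.
    by have /andP[] := xb x xt.
(* On the last stretch of length T0 only FW <= 1 is used: the increment is at most the probability
   of a size above t - T0. *)
have tail_bounds T0 t : 0 <= T0 -> T0 <= t ->
    0 <= Phi t t - Phi t (t - T0) <= G (t - T0).
  move=> T00 T0t; have tt : t - T0 <= t by rewrite gerBl.
  have t0 : 0 <= t - T0 by rewrite subr_ge0.
  have rng x : t - T0 <= x <= t -> 0 <= x /\ x <= t.
    by move=> /andP[tx xt]; split => //; exact: le_trans tx.
  apply/andP; split.
    rewrite subr_ge0; apply: (@derive_ge0_le R (Phi t) (fun x => FW (t - x) * f x)) => //.
      by move=> x /rng [x0 xt]; exact: dPhi.
    by move=> x /rng [x0 xt]; rewrite mulr_ge0 ?FW_ge0 ?subr_ge0// (pht_pdf_ge0 ph).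
  have := @derive_le R (Phi t) (fun x => - G x) (fun x => FW (t - x) * f x) f (t - T0) t.
  rewrite opprK [- G t + _]addrC => H; apply: le_trans (H _ _ _ tt) _.
  - by move=> x /rng [x0 xt]; exact: dPhi.
  - move=> x _; rewrite -[f x]opprK; apply: is_deriveN; exact: is_derive_pht_ccdf.
  - move=> x /rng [x0 xt]; rewrite ler_piMl ?(pht_pdf_ge0 ph)// FW_le1// subr_ge0//.
  - rewrite gerBl; apply: ltW; apply: (pht_ccdf_gt0 ph); exact: le_trans tt.
have [JL eG0] : J t @[t --> +oo] --> pht_lst alpha S (- theta) /\
    expR (theta * t) * G t @[t --> +oo] --> 0.
  apply: Jlim.
  have c2 : 0 < cW / 2 by rewrite divr_gt0.
  have [T0 T00 HT0] := head_bounds _ c2.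
  have [T1 [_ HT1]] : \forall t \near +oo, e (t - 2) * FW (t - 2) <= cW + 1.
    by apply: (cvgr_le cW); [exact: cvg_shift FW_prefactor|rewrite ltrDl].
  (* From (cW/2) J(s - T0) <= e^{theta s} FR(s) <= C e^{2 theta} (cW + 1), where the first
     inequality is the head bound with eps = cW/2. The time s below is large and satisfies t <= s -
     T0, so monotonicity of J carries the bound to t. *)
  pose K := C * e 2 * (cW + 1) / (cW / 2); exists K => t t0.
  pose s := Num.max (t + T0) (Num.max 2 (T1 + 1)).
  have sT0 : T0 <= s by rewrite le_max lerDr t0.
  have s2 : 2 <= s by rewrite !le_max lexx orbT.
  have sT1 : T1 < s by rewrite !lt_max ltrDl ltr01 !orbT.
  have s0 : 0 <= s by exact: le_trans s2.
  apply: (@le_trans _ _ (J (s - T0))).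
    by apply: J_nd => //; rewrite lerBrDr le_max lexx.
  rewrite /K ler_pdivlMr// mulrC.
  have /andP[H1 _] := HT0 s sT0.
  have -> : cW / 2 = cW - cW / 2 by field.
  apply: le_trans H1 _.
  have /andP[H2 _] := tail_bounds T0 s T00 sT0.
  apply: (@le_trans _ _ (e s * FR s)).
    rewrite ler_pM2l// FR_Phi//.
    have := pht_ccdf_gt0 ph s0; move: H2; lra.
  apply: le_trans (eFR_le s2) _; rewrite ler_pM2l ?HT1//.
  by rewrite mulr_gt0.
set L := pht_lst alpha S (- theta) in JL *.
have L0 : 0 <= L.
  rewrite -(cvg_lim (@Rhausdorff R) JL); apply: limr_ge; first by apply/cvg_ex; exists L.
  by near=> t; apply: J_ge0; near: t; exact: near_ge.
apply/cvgrPdist_le => eta eta0.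
(* L + 1 rather than L, which is only known to be nonnegative. The errors add up to 3/4 of eta: two
   of eta/4 for the head, two of eta/8 for the terms in G. *)
pose eps := eta / (4 * (L + 1)).
have L1 : 0 < L + 1 by rewrite ltr_wpDl.
have eps0 : 0 < eps by rewrite divr_gt0// mulr_gt0.
have epsL : eps * L <= eta / 4.
  have -> : eta / 4 = eps * (L + 1) by rewrite /eps; field; rewrite gt_eqF.
  by rewrite ler_pM2l// lerDl.
have [T0 T00 HT0] := head_bounds _ eps0.
have e4 : 0 < eta / 4 by rewrite divr_gt0.
have e8 : 0 < eta / 8 by rewrite divr_gt0.
near=> t.
have T0t : T0 <= t by near: t; exact: near_ge.
have t0 : 0 <= t by exact: le_trans T0t.
have /andP[h1 h2] := HT0 t T0t.
have /andP[r1 r2] := tail_bounds T0 t T00 T0t.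
have up : (cW + eps) * J (t - T0) <= (cW + eps) * L + eta / 4.
  near: t; apply: (cvgr_le ((cW + eps) * L)); last by rewrite ltrDl.
  by apply: cvgMl_tmp; exact: cvg_shift JL.
have lo : (cW - eps) * L - eta / 4 <= (cW - eps) * J (t - T0).
  near: t; apply: (cvgr_ge ((cW - eps) * L)); last by rewrite gtrBl.
  by apply: cvgMl_tmp; exact: cvg_shift JL.
have g1 : e t * G t <= eta / 8.
  by near: t; apply: (cvgr_le 0).
have g2 : e T0 * (e (t - T0) * G (t - T0)) <= eta / 8.
  near: t; apply: (cvgr_le 0) => //.
  rewrite -(mulr0 (e T0)); apply: cvgMl_tmp; exact: (cvg_shift T0 eG0).
have g2' : e t * G (t - T0) <= eta / 8.
  by apply: le_trans g2; rewrite mulrA -eD [T0 + _]addrC subrK.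
have g0 : 0 <= e t * G t by rewrite mulr_ge0 ?(ltW (e_gt0 _))// ltW// (pht_ccdf_gt0 ph).
have r1' : 0 <= e t * (Phi t t - Phi t (t - T0)) by rewrite mulr_ge0 ?(ltW (e_gt0 _)).
have r2' : e t * (Phi t t - Phi t (t - T0)) <= e t * G (t - T0) by rewrite ler_pM2l.
have -> : e t * FR t = e t * G t + (e t * (Phi t (t - T0) - Phi t 0)
    + e t * (Phi t t - Phi t (t - T0))) by rewrite FR_Phi//; ring.
move: h1 h2 up lo r1' r2' g0 g1 g2' epsL; rewrite !mulrDl !mulNr.
set x1 := cW * L; set x2 := eps * L; set x3 := e t * (_ - _).
set x4 := e t * (_ - _); set x5 := e t * G t; set x6 := e t * G _.
set x7 := cW * J _; set x8 := eps * J _.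
clearbody x1 x2 x3 x4 x5 x6 x7 x8 => h1' h2' up' lo' s1 s2 s3 s4 s5 s6.
rewrite ler_norml; apply/andP; split; lra.
Unshelve. all: by end_near. Qed.

End tail_asymptotics.

(** * Stationary response time *)

Section limits.
Context {d : measure_display} {T : measurableType d} {R : realType}
  (P : probability T R) (q : params R).
Context (A : nat -> {RV P >-> R}) (B : nat -> {RV P >-> bool})
  (X : nat -> {RV P >-> R}) (FW FZ : R -> R).
Hypothesis lam_gt0 : 0 < lam q.
Hypothesis p_gt0 : 0 < p q.
Hypothesis p_lt1 : p q < 1.
Hypothesis ph1 : is_phase_type (alpha1 q) (S1 q).
Hypothesis ph2 : is_phase_type (alpha2 q) (S2 q).
Hypothesis model : is_model q A B X.
Hypothesis FW_stationary : stationary_ccdf1 B (W q A B X) FW.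
Hypothesis FZ_stationary : stationary_ccdf P (V q A B X) FZ.
Local Notation pr := (pr P).
Local Notation G := (pht_ccdf (alpha1 q) (S1 q)).
Local Notation f := (pht_pdf (alpha1 q) (S1 q)).
Local Notation rho := (expR (- lam q)).

Let rho_lt1 : rho < 1. Proof. by rewrite -expR0 ltr_expR oppr_lt0. Qed.
Let rho_gt0 : 0 < rho. Proof. exact: expR_gt0. Qed.

Definition w_tail n t : R := pr [set w | W_ignoring q A B X n w > t].

(** [W_ignoring] is independent of the type of job n, so the conditional tail in the stationarity
    hypothesis is its unconditional tail. *)
Lemma cvg_w_tail t : 0 <= t -> w_tail n t @[n --> \oo] --> FW t.
Proof.
move=> t0; have := FW_stationary t0.
have -> // : (fun n => fine (P (type1 B n `&` [set w | W q A B X n w > t])) /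
    fine (P (type1 B n))) = w_tail ^~ t.
apply/funext => n; rewrite -/(pr _) -/(pr (type1 B n)).
by rewrite (pr_type1_W model) (pr_type1 model) mulrC mulKf// gt_eqF.
Qed.

Let cvg_bounds (u v : nat -> R) a b : u @ \oo --> a -> v @ \oo --> b ->
  (forall n, u n <= v n) -> a <= b.
Proof.
move=> ua vb uv; rewrite -(cvg_lim (@Rhausdorff R) ua) -(cvg_lim (@Rhausdorff R) vb).
apply: ler_lim; [by apply/cvg_ex; exists a|by apply/cvg_ex; exists b|].
by apply: nearW => n; exact: uv.
Qed.

Let cvgMc (c l : R) (u : nat -> R) : u @ \oo --> l -> (fun n => c * u n) @ \oo --> c * l.
Proof. by move=> ul; exact: cvgMl_tmp. Qed.

Lemma FW_ge0 t : 0 <= t -> 0 <= FW t.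
Proof.
move=> t0; apply: (cvg_bounds (cvg_cst 0) (cvg_w_tail t0)) => n; exact: pr_ge0.
Qed.

Lemma FW_le1 t : 0 <= t -> FW t <= 1.
Proof.
move=> t0; apply: (@cvg_bounds _ (fun=> 1) _ 1 (cvg_w_tail t0)); first exact: cvg_cst.
move=> n.
by apply: pr_le1; exact: measurable_W_ignoring_gt.
Qed.

Lemma FW_nincr s t : 0 <= s -> s <= t -> FW t <= FW s.
Proof.
move=> s0 st; apply: (cvg_bounds (cvg_w_tail (le_trans s0 st)) (cvg_w_tail s0)) => n.
apply: pr_le; try exact: measurable_W_ignoring_gt.
by move=> w /=; exact: le_lt_trans.
Qed.

Definition resp_tail n t : R :=
  pr (type1 B n `&` [set w | Resp q A B X n w > t]) / p q.

(** For a fixed mesh the bracketing sums converge as n grows, since they involve finitely many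
    values of the tail of W. The limiting sums also bracket Phi t - Phi 0 because FW is
    nonincreasing, and refining the mesh closes the gap. *)
Lemma cvg_resp_tail (Phi : R -> R) (t : R) : 0 <= t ->
  (forall s : R, 0 <= s -> s <= t -> is_derive s 1 Phi (FW (t - s) * f s)) ->
  resp_tail n t @[n --> \oo] --> G t + (Phi t - Phi 0).
Proof.
move=> t0 dPhi; have [c c0 fc] := pht_pdf_bounded ph1.
pose s m (i : nat) : R := i%:R * t / m%:R.
pose L m (w : R -> R) : R := \sum_(i < m) (G (s m i) - G (s m i.+1)) * w (t - s m i).
pose U m (w : R -> R) : R := \sum_(i < m) (G (s m i) - G (s m i.+1)) * w (t - s m i.+1).
have s0 m i : 0 <= s m i by rewrite /s divr_ge0// mulr_ge0.
have ss m i j : (i <= j)%N -> s m i <= s m j.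
  by move=> ij; rewrite /s ler_wpM2r ?invr_ge0// ler_wpM2r// ler_nat.
have sm m : (0 < m)%N -> s m m = t.
  by move=> m0; rewrite /s mulrAC divff ?mul1r// pnatr_eq0 -lt0n.
have sz m : s m 0%N = 0 by rewrite /s !mul0r.
have st m i : (i <= m)%N -> s m i <= t.
  by case: m => [|m] im; [rewrite /s invr0 mulr0|rewrite -(sm m.+1)// ss].
have Ln m n : (0 < m)%N -> G t + L m (w_tail n) <= resp_tail n t.
  move=> m0; rewrite /resp_tail ler_pdivlMr// mulrDl mulrC /L mulr_suml.
  apply: le_trans (Resp_lower lam_gt0 ph1 ph2 model n m0 t0).
  by rewrite lerD2l; apply: ler_sum => i _; rewrite /w_tail [leLHS]mulrC mulrA.
have Un m n : (0 < m)%N -> resp_tail n t <= G t + U m (w_tail n).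
  move=> m0; rewrite /resp_tail ler_pdivrMr// mulrDl mulrC /U mulr_suml.
  apply: le_trans (Resp_upper ph1 ph2 model n m0 t0) _.
  by rewrite lerD2l; apply: ler_sum => i _; rewrite /w_tail [leRHS]mulrC mulrA.
have cvgL m : L m (w_tail n) @[n --> \oo] --> L m FW.
  apply: (@cvg_sumr R _ _ _ _ _ (fun i n => _)) => i; apply: cvgMl_tmp.
  by apply: cvg_w_tail; rewrite subr_ge0 st// ltnW.
have cvgU m : U m (w_tail n) @[n --> \oo] --> U m FW.
  apply: (@cvg_sumr R _ _ _ _ _ (fun i n => _)) => i; apply: cvgMl_tmp.
  by apply: cvg_w_tail; rewrite subr_ge0 st.
have Phi_tele m : (0 < m)%N -> Phi t - Phi 0 = \sum_(i < m) (Phi (s m i.+1) - Phi (s m i)).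
  move=> m0; rewrite -(big_mkord xpredT (fun i => Phi (s m i.+1) - Phi (s m i))).
  by rewrite (telescope_sumr (fun i => Phi (s m i)))// sm// sz.
have step m i : (i < m)%N ->
    (G (s m i) - G (s m i.+1)) * FW (t - s m i) <= Phi (s m i.+1) - Phi (s m i) <=
    (G (s m i) - G (s m i.+1)) * FW (t - s m i.+1).
  move=> im; have ii := ss m i i.+1 (leqnSn i); have it := st m i.+1 im.
  have dG (k x : R) : is_derive x 1 (fun y => - (k * G y)) (k * f x).
    rewrite -[f x]opprK mulrN; apply: is_deriveN; apply: is_deriveZ.
    exact: is_derive_pht_ccdf.
  have rng x : s m i <= x <= s m i.+1 -> 0 <= x /\ x <= t.
    by move=> /andP[ix xi]; split; [exact: le_trans ix|exact: le_trans it].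
  have dP (x : R) : s m i <= x <= s m i.+1 -> is_derive x 1 Phi (FW (t - x) * f x).
    by move=> /rng [x0 xt]; exact: dPhi.
  apply/andP; split.
    have := @derive_le R (fun y => - (FW (t - s m i) * G y)) Phi
      (fun x => FW (t - s m i) * f x) (fun x => FW (t - x) * f x) (s m i) (s m i.+1).
    rewrite opprK [- _ + _]addrC -mulrBr mulrC; apply => // x /[dup] /rng [x0 xt] /andP[ix xi].
    apply: ler_wpM2r; first exact: (pht_pdf_ge0 ph1).
    by apply: FW_nincr; rewrite ?subr_ge0// lerD2l lerN2.
  have := @derive_le R Phi (fun y => - (FW (t - s m i.+1) * G y))
      (fun x => FW (t - x) * f x) (fun x => FW (t - s m i.+1) * f x) (s m i) (s m i.+1).
  rewrite opprK [- _ + _]addrC -mulrBr [FW _ * (_ - _)]mulrC; apply => // x /[dup] /rng [x0 xt] /andP[ix xi].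
  apply: ler_wpM2r; first exact: (pht_pdf_ge0 ph1).
  by apply: FW_nincr; rewrite ?subr_ge0// lerD2l lerN2.
have LI m : (0 < m)%N -> L m FW <= Phi t - Phi 0.
  by move=> m0; rewrite (Phi_tele m)//; apply: ler_sum => i _; have /andP[] := step m i (ltn_ord i).
have IU m : (0 < m)%N -> Phi t - Phi 0 <= U m FW.
  by move=> m0; rewrite (Phi_tele m)//; apply: ler_sum => i _; have /andP[] := step m i (ltn_ord i).
(* Each increment of G is at most c t / m by boundedness of the density, and the differences of FW
   telescope to at most 1. *)
have UL m : (0 < m)%N -> U m FW - L m FW <= c * t / m%:R.
  move=> m0; have ct0 : 0 <= c * t / m%:R by rewrite divr_ge0// mulr_ge0.
  apply: (@le_trans _ _ (\sum_(i < m) c * t / m%:R *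
      (FW (t - s m i.+1) - FW (t - s m i)))).
    rewrite /U /L -sumrB; apply: ler_sum => i _; rewrite -mulrBr; apply: ler_wpM2r.
      rewrite subr_ge0; apply: FW_nincr; first by rewrite subr_ge0 st.
      by rewrite lerD2l lerN2 ss.
    have := @derive_le R (fun y => - G y) (fun y => c * y) f (fun=> c) (s m i) (s m i.+1).
    have -> : c * s m i.+1 - c * s m i = c * t / m%:R.
      by rewrite -mulrBr /s -!mulrBl -natrB// subSnn mul1r mulrA.
    rewrite opprK [- _ + _]addrC; apply => [x _|x _|x /andP[ix _]|].
    - rewrite -[f x]opprK; apply: is_deriveN; exact: is_derive_pht_ccdf.
    - rewrite -[X in is_derive _ _ _ X]mulr1; exact: is_deriveZ.
    - by apply: fc; exact: le_trans ix.
    - exact: ss.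
  rewrite -mulr_sumr -[leRHS]mulr1; apply: ler_wpM2l => //.
  rewrite -(big_mkord xpredT (fun i => FW (t - s m i.+1) - FW (t - s m i))).
  rewrite (telescope_sumr (fun i => FW (t - s m i)))// sm// sz subrr subr0.
  by have := FW_le1 (lexx 0); have := FW_ge0 t0; lra.
apply/cvgrPdist_le => eps eps0.
have [m m0 mc] : exists2 m : nat, (0 < m)%N & c * t / m%:R <= eps / 2.
  exists (Num.truncn (c * t / (eps / 2))).+1 => //.
  rewrite ler_pdivrMr// -ler_pdivrMl ?divr_gt0// mulrC ltW// truncnS_gt//.
have e2 : 0 < eps / 2 by rewrite divr_gt0.
have H1 := LI m m0; have H2 := IU m m0; have H3 := UL m m0.
near=> n.
have h1 := Ln m n m0; have h2 := Un m n m0.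
have h3 : L m FW - eps / 2 <= L m (w_tail n).
  by near: n; apply: (cvgr_ge (L m FW)) => //; rewrite gtrBl.
have h4 : U m (w_tail n) <= U m FW + eps / 2.
  by near: n; apply: (cvgr_le (U m FW)) => //; rewrite ltrDl.
rewrite ler_norml; apply/andP; split; lra.
Unshelve. all: by end_near. Qed.

Lemma backlog_W_tail n t :
  pr (backlog A X n t) <= p q / ((1 - rho) * p q) ^+ 2 * w_tail n.+2 (t - 2).
Proof.
have k0 : 0 < ((1 - rho) * p q) ^+ 2 by rewrite exprn_gt0// mulr_gt0// subr_gt0.
rewrite mulrAC ler_pdivlMr//.
have := backlog_le lam_gt0 ph1 ph2 model n t.
by rewrite (pr_type1_W model).
Qed.

Let cvg_w_tail2 (t : R) : 2 <= t -> w_tail n.+2 (t - 2) @[n --> \oo] --> FW (t - 2).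
Proof.
move=> t2; have t0 : 0 <= t - 2 by rewrite subr_ge0.
have := cvg_w_tail t0.
by rewrite -(cvg_shiftS (w_tail ^~ (t - 2))) -(cvg_shiftS (fun n => w_tail n.+1 (t - 2))).
Qed.

Let kappa := ((1 - rho) * p q) ^+ 2.
Let kappa_gt0 : 0 < kappa.
Proof. by rewrite exprn_gt0// mulr_gt0// subr_gt0. Qed.

Lemma resp_limit_le (t FRt : R) : 2 <= t -> resp_tail n t @[n --> \oo] --> FRt ->
  FRt <= kappa^-1 * FW (t - 2).
Proof.
move=> t2 cR; have cW := cvgMc (c := kappa^-1) (cvg_w_tail2 t2).
apply: (@cvg_bounds (resp_tail ^~ t) (fun n => kappa^-1 * w_tail n.+2 (t - 2))
  _ _ cR cW) => n; rewrite /resp_tail ler_pdivrMr//.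
apply: le_trans (Resp_le_backlog lam_gt0 ph1 ph2 model n t) _.
apply: le_trans (backlog_W_tail n t) _.
by rewrite -/kappa le_eqVlt; apply/orP; left; apply/eqP; ring.
Qed.

Lemma resp_limit_ge (t FRt : R) : 0 <= t -> resp_tail n t @[n --> \oo] --> FRt -> FW t <= FRt.
Proof.
move=> t0 cR; apply: (cvg_bounds (cvg_w_tail t0) cR) => n.
rewrite /resp_tail ler_pdivlMr// mulrC -(pr_type1_W model).
have mN := measurable_bad_path A X.
apply: (pr_le_ae mN (pr_bad_path lam_gt0 ph1 ph2 model)).
- exact: measurable_type1_W.
- exact: measurable_type1_Resp.
move=> w /good_path [_ x0 _] [bw Ww]; split => //=; apply: lt_le_trans Ww _.
rewrite /W /Resp /waiting_time /response_time; have := x0 n; lra.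
Qed.

Lemma cvg_V (t : R) : 0 <= t ->
  pr [set w | V q A B X u%:R w > t] @[u --> \oo] --> FZ t.
Proof.
move=> t0; apply: (cvg_comp (fun u : nat => u%:R : R) _ _ (FZ_stationary t0)).
exact: cvgr_idn.
Qed.

Lemma FZ_le1 (t : R) : 0 <= t -> FZ t <= 1.
Proof.
move=> t0; apply: (@cvg_bounds _ (fun=> 1) _ 1 (cvg_V t0)); first exact: cvg_cst.
by move=> n; apply: pr_le1; exact: measurable_V_gt.
Qed.

Lemma FZ_gt0 (t : R) : 0 <= t -> 0 < FZ t.
Proof.
move=> t0; pose z := p q * G (t + 2) * (rho * (1 - rho)) * ((1 - rho) / 2).
have z0 : 0 < z.
  rewrite !mulr_gt0 ?subr_gt0 ?invr_gt0//; apply: (pht_ccdf_gt0 ph1).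
  by rewrite addr_ge0.
apply: lt_le_trans z0 _.
have cV : pr [set w | V q A B X u.+3%:R w > t] @[u --> \oo] --> FZ t.
  have := cvg_V t0; set h := fun u : nat => _.
  by rewrite -(cvg_shiftS h) -(cvg_shiftS (fun u => h u.+1)) -(cvg_shiftS (fun u => h u.+2)).
apply: (@cvg_bounds (fun=> z) _ z _ _ cV) => [|u]; first exact: cvg_cst.
have h0 : pr [set w | arr A 0 w <= u.+1%:R] >= 1 - rho.
  rewrite -(pr_A_le1 lam_gt0 model 0); apply: pr_le.
  - by apply: measurable_le_set => //; exact: measurable_funP.
  - by apply: measurable_le_set => //; apply: measurable_sum => i; exact: measurable_funP.
  - move=> w /= H; rewrite /arr /arrival big_ord1; apply: le_trans H _.
    by rewrite ler1n.
have q1 : (2 ^+ u.+1 * (1 - rho / 2) ^+ n.+1) @[n --> \oo] --> (0 : R).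
  rewrite -[X in _ --> X](mulr0 (2 ^+ u.+1)); apply: cvgMl_tmp.
  rewrite (cvg_shiftS (fun n => (1 - rho / 2) ^+ n)).
  by apply: cvg_expr; rewrite ger0_norm; move: rho_lt1 rho_gt0 => ? ?; lra.
have r2 : 0 < (1 - rho) / 2 by rewrite divr_gt0// subr_gt0.
(* N depends on u, but the resulting bound z does not: the first arrival occurs by time u + 1 with
   probability at least 1 - rho, and half of this is kept. *)
have [N _ HN] : \forall n \near \oo, 2 ^+ u.+1 * (1 - rho / 2) ^+ n.+1 <= (1 - rho) / 2.
  exact: (cvgr_le 0).
have hN := le_trans (pr_arr_le lam_gt0 ph1 ph2 model N u.+1) (HN N (leqnn N)).
apply: le_trans (V_lower lam_gt0 p_gt0 ph1 ph2 model N u.+1 t0).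
rewrite /z; apply: ler_wpM2l.
  rewrite !mulr_ge0 ?subr_ge0 ?(ltW rho_gt0) ?(ltW rho_lt1) ?(ltW p_gt0)//.
  by apply/ltW/(pht_ccdf_gt0 ph1); rewrite addr_ge0.
by move: h0 hN; lra.
Qed.

Let cvg_index c : (fun m => (c.+1 * m.+1).-1) @ \oo --> \oo.
Proof.
apply/cvgnyPge => N; near=> m; have Nm : (N <= m)%N by near: m; exists N.
by rewrite (leq_trans Nm)// -ltnS prednK ?muln_gt0// leq_pmull.
Unshelve. all: by end_near. Qed.

(* The time average of P[V > t] is compared with the average of the backlogs
   found by the arrivals, at most c per unit of time except on an event of
   geometrically small probability. *)
Lemma FZ_le : exists2 C, 0 < C & forall t, 2 <= t -> FZ t <= C * FW (t - 2).
Proof.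
have q0 : 0 <= 1 - rho / 2 by move: rho_lt1 rho_gt0 => ? ?; lra.
(* With N = (c+1) M arrivals in M time units, the factor 4^{-M} beats the 2^M of [pr_arr_le] and
   leaves 2^{-M}. *)
have [c hc] : exists c, (1 - rho / 2) ^+ c.+1 <= 1 / 4.
  have : (1 - rho / 2) ^+ n.+1 @[n --> \oo] --> (0 : R).
    rewrite (cvg_shiftS (fun n => (1 - rho / 2) ^+ n)).
    by apply: cvg_expr; rewrite ger0_norm; move: rho_lt1 rho_gt0 => ? ?; lra.
  move=> /(cvgr_le _ ); have q4 : 0 < 1 / 4 :> R by rewrite divr_gt0.
  by move=> /(_ _ q4) [N _ HN]; exists N; exact: (HN N (leqnn N)).
(* The factors are the number of arrivals allowed per unit of time, the mean number of integer times
   charged to one arrival, and the constant of [backlog_W_tail]. *)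
pose C := c.+1%:R / (1 - rho) * (p q / kappa).
exists C; first by apply: mulr_gt0; apply: divr_gt0 => //; rewrite subr_gt0.
move=> t t2; have t0 : 0 <= t by apply: le_trans t2.
pose v (u : nat) := pr [set w | V q A B X u%:R w > t].
pose y n := p q / kappa * w_tail n.+2 (t - 2).
have cv : arithmetic_mean v m @[m --> \oo] --> FZ t by apply: cesaro; exact: cvg_V.
have cy : arithmetic_mean y m @[m --> \oo] --> p q / kappa * FW (t - 2).
  by apply: cesaro; apply: cvgMl_tmp; exact: cvg_w_tail2.
have cyk : arithmetic_mean y (c.+1 * m.+1).-1 @[m --> \oo] --> p q / kappa * FW (t - 2).
  exact: (cvg_comp _ _ (cvg_index c) cy).
have c2 : (1 / 2 : R) ^+ m.+1 @[m --> \oo] --> (0 : R).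
  rewrite (cvg_shiftS (fun n => (1 / 2 : R) ^+ n)).
  by apply: cvg_expr; rewrite ger0_norm; lra.
have cr : c.+1%:R / (1 - rho) * arithmetic_mean y (c.+1 * m.+1).-1 + (1 / 2) ^+ m.+1
    @[m --> \oo] --> C * FW (t - 2).
  rewrite /C -[_ * _ * FW _]mulrA -[X in _ --> X]addr0; apply: cvgD; last exact: c2.
  exact: cvgMc cyk.
apply: (cvg_bounds cv cr) => m.
pose M := m.+1; pose N := (c.+1 * M)%N.
have M0 : 0 < M%:R :> R by rewrite ltr0n.
have tailN : 2 ^+ M * (1 - rho / 2) ^+ N.+1 <= (1 / 2) ^+ M :> R.
  have -> : (1 / 2) ^+ M = 2 ^+ M * (1 / 4) ^+ M :> R.
    by rewrite -exprMn; congr (_ ^+ _); field.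
  rewrite ler_pM2l ?exprn_gt0//.
  apply: (@le_trans _ _ ((1 - rho / 2) ^+ N)).
    rewrite exprS ler_piMl ?exprn_ge0//; move: rho_gt0 => ?; lra.
  by rewrite exprM lerXn2r// ?nnegrE ?exprn_ge0// divr_ge0.
have marr n (z : R) : measurable [set w | arr A n w <= z].
  by apply: measurable_le_set => //; apply: measurable_sum => i; exact: measurable_funP.
have sumV : series v M <= (1 - rho)^-1 * series y N + M%:R * (1 / 2) ^+ M.
  rewrite /series/= !big_mkord.
  apply: (@le_trans _ _ (\sum_(u < M) (\sum_(n < N) pr (backlog A X n t `&` slot A n u)
      + (1 / 2) ^+ M))).
    apply: ler_sum => u _.
    apply: le_trans (V_upper lam_gt0 ph1 ph2 model N u t0) _; rewrite lerD2l.
    apply: le_trans tailN; apply: le_trans (pr_arr_le lam_gt0 ph1 ph2 model N M).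
    apply: pr_le => // w /= H; apply: le_trans H _.
    by rewrite ler_nat ltnW.
  rewrite big_split/= sumr_const card_ord -[X in _ + X <= _]mulr_natl lerD2r exchange_big/= mulr_sumr.
  apply: ler_sum => n _.
  apply: le_trans (sum_slot_le lam_gt0 ph1 ph2 model M (backlog_history t)) _.
  rewrite mulrC ler_pM2l ?invr_gt0 ?subr_gt0//; exact: backlog_W_tail.
rewrite /arithmetic_mean /= -/M.
have -> : ((c.+1 * M).-1).+1 = N by rewrite prednK// muln_gt0.
rewrite mulrC ler_pdivrMr//; apply: le_trans sumV _.
rewrite mulrDl [M%:R * _]mulrC lerD2r.
rewrite le_eqVlt; apply/orP; left; apply/eqP; rewrite /N natrM.
have c0 : c.+1%:R != 0 :> R by rewrite pnatr_eq0.
have r0 : 1 - rho != 0 by rewrite subr_eq0 gt_eqF.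
move: (series y _) => Y; field; rewrite r0 andbT (gt_eqF M0) /=.
by rewrite addrC natr1 pnatr_eq0.
Qed.

End limits.

Theorem theorem6p2 (R : realType) (q : params R)
  (lam_gt0 : 0 < lam q) (lam_lt1 : lam q < 1)
  (p_gt0 : 0 < p q) (p_lt1 : p q < 1)
  (ph1 : is_phase_type (alpha1 q) (S1 q))
  (ph2 : is_phase_type (alpha2 q) (S2 q))
  (mean1 : pht_mean (alpha q) (Smx q) = 1)
  (d : measure_display) (T : measurableType d) (P : probability T R)
  (A : nat -> {RV P >-> R}) (B : nat -> {RV P >-> bool})
  (X : nat -> {RV P >-> R}) (model : is_model q A B X)
  (FW FZ : R -> R) (thetaZ cW : R)
  (* FW t = P[W^(1) > t], given by its known expression *)
  (FW_stationary : stationary_ccdf1 B (W q A B X) FW)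
  (FW_formula : forall t, 0 <= t -> FW t = W1_formula q t)
  (* FZ t = P[Z > t] *)
  (FZ_stationary : stationary_ccdf P (V q A B X) FZ)
  (thetaZ_def : decay_rate FZ thetaZ)
  (cW_def : prefactor FW thetaZ cW) :
  exists FR : R -> R,
    [/\ stationary_ccdf1 B (Resp q A B X) FR,
        forall t, 0 <= t ->
          FR t = FW t + (1 - lam q) * pht_ccdf (alpha1 q) (S1 q) t
                 - corner (nu1 q) (A1 q) t
                 - corner (pi01 q - pi11 q *m invmx (Rmx q)) (A2 q) t
                 + corner (pi02 q *m invmx (Rmx q)) (A3 q) t,
        decay_rate FR thetaZ
      & (- thetaZ)%:M - S1 q \in unitmx ->
        prefactor FR thetaZ (cW * pht_lst (alpha1 q) (S1 q) (- thetaZ))].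
Proof.
have [Phi HPhi] := W1_convolution ph1.
pose FR t := pht_ccdf (alpha1 q) (S1 q) t + (Phi t t - Phi t 0).
have dPhi (t s : R) : 0 <= s -> s <= t ->
    is_derive s 1 (Phi t) (FW (t - s) * pht_pdf (alpha1 q) (S1 q) s).
  by move=> s0 st; rewrite FW_formula ?subr_ge0//; have [] := HPhi t.
have cR t : 0 <= t -> resp_tail q A B X n t @[n --> \oo] --> FR t.
  move=> t0; apply: (cvg_resp_tail lam_gt0 p_gt0 ph1 ph2 model FW_stationary
    (Phi := Phi t) t0).
have [C C0 FZC] := FZ_le lam_gt0 p_gt0 ph1 ph2 model FW_stationary FZ_stationary.
have FW0 := FW_ge0 p_gt0 model FW_stationary.
(* One constant for both dominations by the shifted tail of W. *)
pose D := Num.max C (((1 - expR (- lam q)) * p q) ^+ 2)^-1.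
have FW2 t : 2 <= t -> 0 <= FW (t - 2) by move=> t2; rewrite FW0// subr_ge0.
have FR_D t : 2 <= t -> FR t <= D * FW (t - 2).
  move=> t2; have t0 : 0 <= t by apply: le_trans t2.
  apply: le_trans (resp_limit_le lam_gt0 p_gt0 ph1 ph2 model FW_stationary t2 (cR t t0)) _.
  by rewrite ler_wpM2r ?FW2// /D le_max lexx orbT.
have FZ_D t : 2 <= t -> FZ t <= D * FW (t - 2).
  move=> t2; apply: le_trans (FZC t t2) _.
  by rewrite ler_wpM2r ?FW2// /D le_max lexx.
have FR_FW t : 0 <= t -> FW t <= FR t.
  by move=> t0; exact: (resp_limit_ge lam_gt0 p_gt0 ph1 ph2 model FW_stationary t0 (cR t t0)).
have FWle := FW_le1 p_gt0 model FW_stationary.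
have FZpos := FZ_gt0 lam_gt0 p_gt0 ph1 ph2 model FZ_stationary.
have FZle := FZ_le1 FZ_stationary.
exists FR; split.
- move=> t t0; have := cR t t0.
  have -> // : resp_tail q A B X ^~ t = fun n =>
    fine (P (type1 B n `&` [set w | Resp q A B X n w > t])) / fine (P (type1 B n)).
  by apply/funext => n; rewrite /resp_tail -(pr_type1 model n).
- move=> t t0; have [_ HE] := HPhi t.
  (* The boundary term of the integration by parts is P[W > 0] G(t) = lam G(t); subtracted from
     P[X_1 > t] = G(t), it leaves the coefficient 1 - lam. *)
  rewrite /FR HE (W1_formula_0 lam_gt0 lam_lt1 p_gt0 p_lt1 ph1 ph2 mean1) FW_formula//.
  set G := pht_ccdf _ _ _; set x1 := corner _ _ _; set x2 := corner _ _ _.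
  set x3 := corner _ _ _; set w := W1_formula _ _.
  by clearbody G x1 x2 x3 w; ring.
- exact: (decay_rate_FR FW0 FR_FW FR_D FZ_D FZpos thetaZ_def cW_def).
- exact: (prefactor_FR ph1 FW0 FWle FR_FW FR_D FZ_D FZpos FZle
    thetaZ_def cW_def (fun t _ => erefl) dPhi).
Qed.
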